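(* Let $n\geq 3$. The irreducible component $X_{\mu^*}^{\mathbf{b}_1,x_0}(\tau_1^* )$ is parametrized by the modifications $\mathcal{E}\dashrightarrow\mathcal{E}^0$ bounded by $\nu_1^*$ such that $\varpi\,\mathrm{F}(\mathcal{E}^\vee)\subset\mathcal{E}$. In particular, it is isomorphic to $X_{I_n^1}([1])^{\mathrm{pf}}$.
   Context: $(\cdot)^{\mathrm{pf}}$ denotes perfection. $F$ is a non-archimedean local field with ring of integers $\mathcal{O}_F$, uniformizer $\varpi$, residue field $k=\mathbb{F}_q$. For a perfect $k$-algebra $R$ put $W_{\mathcal{O}_F}(R)=\varprojlim_m W(R)\otimes_{W(k)}\mathcal{O}_F/\varpi^m$, $D_R=\mathrm{Spec}\,W_{\mathcal{O}_F}(R)$, $D_R^*=\mathrm{Spec}\,W_{\mathcal{O}_F}(R)[1/\varpi]$; $\sigma$ is the $q$-Frobenius. For a reductive $G/\mathcal{O}_F$: $\mathrm{L}^+G(R)=G(W_{\mathcal{O}_F}(R))$, $\mathrm{L}G(R)=G(W_{\mathcal{O}_F}(R)[1/\varpi])$, $\mathrm{Gr}=\mathrm{L}G/\mathrm{L}^+G$ (base changed to $\overline{k}$), which parametrizes $G$-torsors $\mathcal{E}$ on $D_R$ with an isomorphism over $D_R^*$ with the trivial torsor $\mathcal{E}^0$, written as a modification $\mathcal{E}\dashrightarrow\mathcal{E}^0$. For a dominant cocharacter $\lambda$, $\mathrm{Gr}_\lambda$ (resp. $\mathring{\mathrm{Gr}}_\lambda$) is the locus of modifications of relative position $\preceq\lambda$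 (''bounded by $\lambda$'') (resp. equal to $\lambda$, i.e. the $\mathrm{L}^+G$-orbit of $\varpi^\lambda=\lambda(\varpi)$). $F_2/F$ is the unramified quadratic extension, $\Lambda=\mathcal{O}_{F_2}^n$ with hermitian form $(a,a')\mapsto\sum_i\sigma(a_i)a'_{n+1-i}$, $G=\mathrm{GU}(\Lambda)$, with $G_{\mathcal{O}_{F_2}}\simeq\mathrm{GL}_n\times\mathbb{G}_m$ by projection to the first factor of $\mathcal{O}_{F_2}\otimes\mathcal{O}_{F_2}\simeq\mathcal{O}_{F_2}\times\mathcal{O}_{F_2}$, $a\otimes b\mapsto(ab,a\sigma(b))$. Cocharacters are written $\sum_{i=0}^n m_i\varepsilon_i$ ($\varepsilon_0$ for $\mathbb{G}_m$, $\varepsilon_1,\dots,\varepsilon_n$ the standard basis for $\mathrm{GL}_n$); $(\sum m_i\varepsilon_i)^*=-m_0\varepsilon_0-\sum_{i\geq1}m_{n+1-i}\varepsilon_i$. Put $\mu=\varepsilon_0+\varepsilon_1+\varepsilon_2$, $\nu_1=-\varepsilon_n$ (so $\nu_1^*=\varepsilon_1$), $\tau_1=\varepsilon_0$, $X_{\mu^*}(\tau_1^* )=\{g\,\mathrm{L}^+G\in\mathrm{Gr}: g^{-1}\varpi^{\tau_1^*}\sigma(g)\in\overline{\mathrm{L}^+G\varpi^{\mu^*}\mathrm{L}^+G}\}$. Let $\mathrm{Gr}_{(\nu_1^*,\mu^* )}$ parametrize $\mathcal{E}_2\dashrightarrow\mathcal{E}_1\dashrightarrow\mathcal{E}^0$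 with $\mathcal{E}_1\dashrightarrow\mathcal{E}^0$ bounded by $\nu_1^*$ and $\mathcal{E}_2\dashrightarrow\mathcal{E}_1$ bounded by $\mu^*$; it maps to $\mathrm{Gr}$ by composition. Put $\mathrm{Gr}^0_{(\nu_1^*,\mu^* )|\nu_1+\tau_1^*}=\mathrm{Gr}_{(\nu_1^*,\mu^* )}\times_{\mathrm{Gr}}\mathrm{Gr}_{\nu_1+\tau_1^*}$, with open subscheme $\mathring{\mathrm{Gr}}^0$ where all bounds are equalities. It has a unique irreducible component $\mathrm{Gr}^{0,\mathbf{a}_1}$ of dimension $\langle\rho,\nu_1^*+\mu^*+\nu_1+\tau_1^*\rangle$ ($\rho$ the half sum of positive roots); $\mathring{\mathrm{Gr}}^{0,\mathbf{a}_1}=\mathrm{Gr}^{0,\mathbf{a}_1}\cap\mathring{\mathrm{Gr}}^0$. $\mathring{X}_{\mu^*}^{\mathbf{b}_1,x_0}(\tau_1^* )$ is the fiber product of $1\times\varpi^{\tau_1^*}\sigma:\mathring{\mathrm{Gr}}_{\nu_1^*}\to\mathring{\mathrm{Gr}}_{\nu_1^*}\times\mathring{\mathrm{Gr}}_{\nu_1+\tau_1^*}$ and $\mathrm{pr}_1\times m:\mathring{\mathrm{Gr}}^{0,\mathbf{a}_1}\to\mathring{\mathrm{Gr}}_{\nu_1^*}\times\mathring{\mathrm{Gr}}_{\nu_1+\tau_1^*}$ ($\mathrm{pr}_1$ remembers $\mathcal{E}_1$, $m$ is the composition), and $X_{\mu^*}^{\mathbf{b}_1,x_0}(\tau_1^*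 )$ is its closure in $X_{\mu^*}(\tau_1^* )$. Lattice notation: for $\lambda$ trivial on $\mathbb{G}_m$, $\mathrm{Gr}_\lambda\subset\mathrm{Gr}_{\mathrm{GL}_n}$, so its points are rank $n$ vector bundles $\mathcal{E}$ on $D_R$ with a modification to $\mathcal{E}^0=\mathcal{O}_{F_2}^n$, i.e. lattices in $\mathcal{E}^0[1/\varpi]$ (position $\sum m_i\varepsilon_i$ means that $\varpi^{m_1}e_1,\dots,\varpi^{m_n}e_n$ is a basis of $\mathcal{E}$ for some basis $e_j$ of $\mathcal{E}^0$). $\mathrm{F}$ is Frobenius pullback; the hermitian form gives $\mathcal{E}^0\simeq\mathrm{F}((\mathcal{E}^0)^\vee)$, so $\mathrm{F}(\mathcal{E}^\vee)$ is a lattice in $\mathcal{E}^0[1/\varpi]$. Deligne–Lusztig variety: let $\mathbf{V}_0=\mathbb{F}_{q^2}^n$ with hermitian form $\sum a_i^qa'_{n+1-i}$, $\mathbf{G}=\mathrm{GU}(\mathbf{V}_0)_{\overline{\mathbb{F}}_q}\simeq\mathrm{GL}_n\times\mathbb{G}_m$ with Frobenius $\mathrm{F}$, and $(W,S=\{s_1,\dots,s_{n-1}\})$ its Coxeter system. For $I\subset S$, $X_I([1])$ is the scheme of parabolic subgroups $\mathbf{P}$ of type $I$ such that the relative position of $(\mathbf{P},\mathrm{F}(\mathbf{P}))$ is the class of $1$ in $W_I\backslash W/W_{\mathrm{F}(I)}$. $I_n^1=S\setminus\{s_1\}$; concretely $X_{I_n^1}([1])$ parametrizes lines $\ell\subset\overline{\mathbb{F}}_q^n$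 with $\ell\subset\mathrm{F}(\ell^\perp)$, where $\perp$ is for the bilinear form $\sum x_iy_{n+1-i}$ and $\mathrm{F}$ is the coordinatewise $q$-Frobenius. *)

(* Defs.v *)
From HB Require Import structures.
From mathcomp Require Import all_boot all_order all_algebra all_fingroup.
From mathcomp Require Import all_solvable all_field.
From mathcomp Require Import boolp classical_sets functions.

Set Implicit Arguments.
Unset Strict Implicit.
Unset Printing Implicit Defensive.

Import Order.TTheory GRing.Theory Num.Theory.
Local Open Scope classical_set_scope.
Local Open Scope ring_scope.

(** * Perfect algebras *)

(* Only used for algebras over fields of characteristic p, where exactly one p
   is concerned. *)
Definition perfect (R : comNzRingType) : Prop :=
  forall p, p \in [pchar R] -> bijective (fun x : R => x ^+ p).

Record perfAlg (l : comNzRingType) := PerfAlg {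
  perf_ring :> comNzRingType;
  perf_str : {rmorphism l -> perf_ring};
  perf_perfect : perfect perf_ring }.

Record perfHom (l : comNzRingType) (R S : perfAlg l) := PerfHom {
  perf_fun :> {rmorphism R -> S};
  perf_funP : forall a, perf_fun (perf_str R a) = perf_str S a }.

Section Restriction.
Context (k l : comNzRingType) (iota : {rmorphism k -> l}).

Definition restr (R : perfAlg l) : perfAlg k :=
  PerfAlg (perf_str R \o iota) (@perf_perfect _ R).

Definition restr_hom (R S : perfAlg l) (f : perfHom R S) :
  perfHom (restr R) (restr S) :=
  @PerfHom k (restr R) (restr S) (perf_fun f) (fun a => perf_funP f (iota a)).
End Restriction.

Lemma closed_perfect (Om : closedFieldType) : perfect Om.
Proof.
move=> p pcharO; have p_gt0 : (0 < p)%N := prime_gt0 (pcharf_prime pcharO).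
have ex_root y : exists x : Om, x ^+ p == y.
  have [x xE] := solve_monicpoly (fun i => if i == 0%N then y else 0) p_gt0.
  exists x; rewrite xE; case: (p) p_gt0 => // m _.
  rewrite big_ord_recl /= expr0 mulr1 big1 ?addr0 // => i _.
  by rewrite mul0r.
exists (fun y => xchoose (ex_root y)) => [x|y]; last first.
  exact/eqP/(xchooseP (ex_root y)).
have /eqP := xchooseP (ex_root (x ^+ p)).
rewrite -!(pFrobenius_autE pcharO).
exact: fmorph_inj.
Qed.

(* Geometric points of Spec R are the homs from R to such algebras. *)
Definition geom (l : comNzRingType) (Om : closedFieldType)
  (s : {rmorphism l -> Om}) : perfAlg l := PerfAlg s (@closed_perfect Om).

Section Frobenius.
Context (k : finFieldType) (R : perfAlg k).

Definition frobq (x : R) : R := x ^+ #|k|.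

Lemma frobqD : nmod_morphism frobq.
Proof.
split=> [|x y].
  by rewrite /frobq expr0n (gtn_eqF (ltnW (finNzRing_gt1 k))).
have [p p_pr pchark] := finPcharP k.
have pcharR : p \in [pchar R] := rmorph_pchar (perf_str R) pchark.
apply: exprDn_pchar; rewrite (eq_pnat _ (pcharf_eq pcharR)).
have := abelem_pgroup (fin_ring_pchar_abelem pchark).
by rewrite /pgroup cardsT.
Qed.

Lemma frobqM : monoid_morphism frobq.
Proof. by split=> [|x y]; rewrite /frobq ?expr1n ?exprMn. Qed.

HB.instance Definition _ := GRing.isNmodMorphism.Build R R frobq frobqD.
HB.instance Definition _ := GRing.isMonoidMorphism.Build R R frobq frobqM.

Lemma frobq_str a : frobq (perf_str R a) = perf_str R a.
Proof. by rewrite /frobq -rmorphXn expf_card. Qed.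

Definition frob_hom : perfHom R R := PerfHom frobq_str.
End Frobenius.

(** * Ramified Witt vectors *)

(* A is complete and separated for the x-adic topology, x is a nonzerodivisor,
   and red identifies A / x A with R. For R a finite field, this says that A is
   a complete discrete valuation ring with uniformizer x and residue field R,
   i.e. the ring of integers of a non-archimedean local field. *)
Record strict_lift (A R : comNzRingType) (x : A) (red : {rmorphism A -> R}) :
    Prop := StrictLift {
  strict_reg : forall a, x * a = 0 -> a = 0;
  strict_surj : forall r, exists a, red a = r;
  strict_ker : forall a, red a = 0 <-> exists b, a = x * b;
  strict_sep : forall a, (forall m, exists b, a = x ^+ m * b) -> a = 0;
  strict_complete : forall u : nat -> A,
    (forall m, exists b, u m.+1 - u m = x ^+ m * b) ->
    exists a, forall m, exists b, a - u m = x ^+ m * b }.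

(* j : A -> B exhibits B as A[1/x]. *)
Record localization_away (A : comNzRingType) (B : comUnitRingType) (x : A)
    (j : {rmorphism A -> B}) : Prop := LocalizationAway {
  loc_unit : j x \is a GRing.unit;
  loc_ker : forall a, j a = 0 -> exists m, x ^+ m * a = 0;
  loc_surj : forall b, exists a m, b * j x ^+ m = j a }.

(* R |-> W_O(R) and R |-> W_O(R)[1/pi]. For R perfect over k, the completed
   tensor product of W(R) and O over W(k) is, up to unique isomorphism, the only
   pi-torsion free, pi-adically complete O-algebra W_O(R) with W_O(R)/pi = R, and
   homs of k-algebras R -> S lift uniquely to homs of O-algebras
   W_O(R) -> W_O(S) (in particular the functor laws follow from the axioms). *)
Record wittFunctor (O : comNzRingType) (pi : O) (k : finFieldType)
    (red : {rmorphism O -> k}) := WittFunctor {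
  witt : perfAlg k -> comNzRingType;
  wittI : perfAlg k -> comUnitRingType;
  witt_str : forall R, {rmorphism O -> witt R};
  witt_red : forall R, {rmorphism witt R -> R};
  witt_inc : forall R, {rmorphism witt R -> wittI R};
  witt_map : forall R S, perfHom R S -> {rmorphism witt R -> witt S};
  wittI_map : forall R S, perfHom R S -> {rmorphism wittI R -> wittI S};
  witt_lift : forall R, strict_lift (witt_str R pi) (witt_red R);
  witt_red_str : forall R a, witt_red R (witt_str R a) = perf_str R (red a);
  witt_map_str : forall R S (f : perfHom R S) a,
    witt_map f (witt_str R a) = witt_str S a;
  witt_map_red : forall R S (f : perfHom R S) w,
    witt_red S (witt_map f w) = f (witt_red R w);
  witt_loc : forall R, localization_away (witt_str R pi) (witt_inc R);
  wittI_map_inc : forall R S (f : perfHom R S) w,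
    wittI_map f (witt_inc R w) = witt_inc S (witt_map f w) }.

(** * Submodules *)

(* The A-submodule of B^m generated by X, for an A-algebra j : A -> B. *)
Definition span (A B : comNzRingType) (j : A -> B) m (X : set 'cV[B]_m) :
    set 'cV[B]_m :=
  [set y | exists r (a : 'I_r -> A) (x : 'I_r -> 'cV[B]_m),
     (forall i, X (x i)) /\ y = \sum_i j (a i) *: x i].

Definition bil (A : comNzRingType) m (x y : 'cV[A]_m) : A :=
  \sum_i x i 0 * y (rev_ord i) 0.

(** * Functors on perfect algebras *)

(* Raw data of a presheaf. It is only ever used through subfunctors on which
   pres is functorial. *)
Record presheaf (l : comNzRingType) := Presheaf {
  pobj : perfAlg l -> Type;
  pres : forall R S : perfAlg l, perfHom R S -> pobj R -> pobj S }.

Definition prod_presheaf l (X Y : presheaf l) : presheaf l :=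
  @Presheaf l (fun R => (pobj X R * pobj Y R)%type)
    (fun R S f x => (pres f x.1, pres f x.2)).

Definition subfunctor l (X : presheaf l) :=
  forall R : perfAlg l, set (pobj X R).

Section Subfunctors.
Context (l : comNzRingType).
Implicit Types X Y : presheaf l.

Definition subf X (Z Z' : subfunctor X) : Prop := forall R, Z R `<=` Z' R.

Definition iso_subfunctor X Y (Z : subfunctor X) (Z' : subfunctor Y) : Prop :=
  exists phi : forall R, pobj X R -> pobj Y R,
    (forall R, set_bij (Z R) (Z' R) (phi R)) /\
    (forall R S (f : perfHom R S) x, Z R x ->
       phi S (pres f x) = pres f (phi R x)).

(* Z -> Y is a closed immersion: for every Spec R -> Y, the fibre product
   with Z is the closed perfect subscheme of Spec R cut out by I. *)
Definition closed_in X (Y Z : subfunctor X) : Prop :=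
  subf Z Y /\
  forall R x, Y R x -> exists I : set R,
    forall S (f : perfHom R S), Z S (pres f x) <-> (forall a, I a -> f a = 0).

Definition closure_in X (Y Z : subfunctor X) : subfunctor X := fun R =>
  [set x | Y R x /\ forall T, closed_in Y T -> subf Z T -> T R x].

(* The union of two closed subschemes is formed on the underlying spaces, so it
   is tested on geometric points. *)
Definition irreducible_in X (Y Z : subfunctor X) : Prop :=
  [/\ closed_in Y Z,
      exists (Om : closedFieldType) (s : {rmorphism l -> Om}) x, Z (geom s) x &
      forall Z1 Z2, closed_in Y Z1 -> closed_in Y Z2 ->
        (forall (Om : closedFieldType) (s : {rmorphism l -> Om}) x,
           Z (geom s) x -> Z1 (geom s) x \/ Z2 (geom s) x) ->
        subf Z Z1 \/ subf Z Z2].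

Definition irreducible_component X (Y Z : subfunctor X) : Prop :=
  irreducible_in Y Z /\
  forall Z', irreducible_in Y Z' -> subf Z Z' -> subf Z' Z.

Definition dim_ge X (Y Z : subfunctor X) (d : nat) : Prop :=
  exists c : nat -> subfunctor X,
    (forall i, (i <= d)%N -> irreducible_in Y (c i) /\ subf (c i) Z) /\
    (forall i, (i < d)%N -> subf (c i) (c i.+1) /\ ~ subf (c i.+1) (c i)).

(* Krull dimension of the closed subfunctor Z of Y *)
Definition dim_eq X (Y Z : subfunctor X) (d : nat) : Prop :=
  dim_ge Y Z d /\ ~ dim_ge Y Z d.+1.
End Subfunctors.

(** * Cocharacters of GL_n x G_m *)

(* m_0 eps_0 + ... + m_n eps_n is (m_0, (m_1, ..., m_n)); the entry of index
   i : 'I_n of the row vector is m_(i+1). *)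
Definition cochar n := (int * 'rV[int]_n)%type.

Definition eps n (j : nat) : cochar n :=
  ((j == 0%N)%:R, \row_i (i.+1 == j)%:R).

Definition cstar n (la : cochar n) : cochar n :=
  (- la.1, \row_i - la.2 0 (rev_ord i)).

Definition dominant n (la : cochar n) : Prop :=
  forall i j : 'I_n, (i <= j)%N -> la.2 0 j <= la.2 0 i.

(* la' <= la: the difference is a sum of positive coroots eps_i - eps_j. *)
Definition cle n (la' la : cochar n) : Prop :=
  exists c : 'I_n -> 'I_n -> nat,
    la - la' = \sum_(i < n) \sum_(j < n | (i < j)%N)
                 (eps n i.+1 - eps n j.+1) *+ c i j.

Definition rho_pairing n (la : cochar n) : rat :=
  (\sum_(i < n) \sum_(j < n | (i < j)%N) (la.2 0 i - la.2 0 j)%:~R) / 2.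

(** * The unitary similitude group *)

(* O_2 denotes the ring of integers of the unramified quadratic extension. For
   an O_2-algebra A, b (x) a |-> (b a, sigma(b) a) identifies the tensor product
   of O_2 and A over O with A * A, and sigma (x) 1 becomes pswap. *)
Definition pswap (A : Type) (a : A * A) : A * A := (a.2, a.1).

Definition antidiag (A : comNzRingType) n : 'M[A]_n :=
  \matrix_(i, j) (j == rev_ord i)%:R.

(* GU(A), with similitude factor: automorphisms g of (A * A)^n with
   (g a, g a') = c (a, a'), where (a, a') = \sum_i pswap(a_i) a'_(n+1-i). *)
Definition GU (A : comNzRingType) n : set ('M[(A * A)%type]_n * A) :=
  [set g | (map_mx (@pswap A) g.1)^T *m antidiag _ n *m g.1
             = ((g.2, g.2) : (A * A)%type) *: antidiag _ n
           /\ exists c, g.2 * c = 1].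

Section Grassmannian.
Context (O : idomainType) (pi : O) (k : finFieldType)
  (red : {rmorphism O -> k}) (W : wittFunctor pi red).

Section OverK.
Context (m : nat).
Implicit Types R S : perfAlg k.

Definition wspan R (X : set 'cV[wittI W R]_m) := span (witt_inc W R) X.

(* Finitely generated projective W_O(R)-submodules E of W_O(R)[1/pi]^m with
   E[1/pi] = W_O(R)[1/pi]^m (dual basis criterion). These are the vector bundles
   on D_R with a trivialization on the punctured disc. *)
Definition is_lattice R (E : set 'cV[wittI W R]_m) : Prop :=
  wspan E `<=` E /\
  exists r (e : 'I_r -> 'cV[wittI W R]_m) (phi : 'I_r -> 'rV[wittI W R]_m),
    [/\ forall i, E (e i),
        forall i x, E x -> range (witt_inc W R) ((phi i *m x) 0 0) &
        forall x, x = \sum_i (phi i *m x) 0 0 *: e i].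

(* Pullback of lattices: for E projective, the tensor product of E with W_O(S)
   embeds in W_O(S)[1/pi]^m, and its image is generated by that of E. *)
Definition lat_pull R S (f : perfHom R S) (E : set 'cV[wittI W R]_m) :
    set 'cV[wittI W S]_m :=
  wspan [set map_mx (wittI_map W f) x | x in E].

Definition lat_frob R (E : set 'cV[wittI W R]_m) : set 'cV[wittI W R]_m :=
  lat_pull (frob_hom R) E.

Definition std_lattice R : set 'cV[wittI W R]_m :=
  [set x | forall i, range (witt_inc W R) (x i 0)].
End OverK.

(* Hom(E, L), as a lattice via bil *)
Definition lat_hom n (R : perfAlg k) (L : set 'cV[wittI W R]_1)
    (E : set 'cV[wittI W R]_n) : set 'cV[wittI W R]_n :=
  [set y | forall x, E x -> L (bil x y)%:M].

(* lat_frob (lat_dual E) is F(E^\vee), embedded by means of the hermitian form: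
   it consists of the y with \sum_i sigma(x_i) y_(n+1-i) integral for x in E. *)
Definition lat_dual n (R : perfAlg k) (E : set 'cV[wittI W R]_n) :=
  lat_hom (@std_lattice 1 R) E.

Definition piI (R : perfAlg k) : wittI W R := witt_inc W R (witt_str W R pi).

Section LoopGroup.
Context (n : nat).
Implicit Types R : perfAlg k.

Definition loop R := ('M[(wittI W R * wittI W R)%type]_n * wittI W R)%type.

(* The loop group and the positive loop group of GU; R is meant to be over the
   residue field of O_2. *)
Definition LG R : set (loop R) := @GU (wittI W R) n.

Definition LGplus R : set (loop R) :=
  [set (map_mx (fun a => (witt_inc W R a.1, witt_inc W R a.2)) g.1,
        witt_inc W R g.2) | g in @GU (witt W R) n].

Definition loop_mul R (g h : loop R) : loop R := (g.1 *m h.1, g.2 * h.2).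

(* The q-Frobenius 1 (x) sigma; the identification of the tensor product with a
   product of two factors makes it exchange them. *)
Definition loop_frob R (g : loop R) : loop R :=
  let s := wittI_map W (frob_hom R) in
  (map_mx (fun a => (s a.2, s a.1)) g.1, s g.2).

(* la(pi); its second factor is determined by the first one. *)
Definition loop_pi R (la : cochar n) : loop R :=
  (\matrix_(i, j) (if i == j
     then (piI R ^ la.2 0 i, piI R ^ (la.1 - la.2 0 (rev_ord i))) else 0),
   piI R ^ la.1).

(* Pairs (E, L): over the residue field of O_2, the group is GL_n x G_m by
   projection to the first factor, so that torsors are pairs of a rank n vector
   bundle and a line bundle. *)
Definition gr_obj R := (set 'cV[wittI W R]_n * set 'cV[wittI W R]_1)%type.

Definition gr_pull R S (f : perfHom R S) (x : gr_obj R) : gr_obj S :=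
  (lat_pull f x.1, lat_pull f x.2).

Definition loop_act R (g : loop R) (x : gr_obj R) : gr_obj R :=
  ([set map_mx fst g.1 *m v | v in x.1], [set g.2 *: v | v in x.2]).

Definition gr_base R : gr_obj R := (@std_lattice n R, @std_lattice 1 R).

(* The map induced by loop_frob on gr_obj: if x = (g E^0, c O), then the unitary
   condition gives the first factor c J (g^T)^-1 J for the second component of
   an element of GU, and c J (g^T)^-1 J E^0 is Hom(g E^0, c O). *)
Definition gr_frob R (x : gr_obj R) : gr_obj R :=
  (lat_frob (lat_hom x.2 x.1), lat_frob x.2).

(* The modification x --> y has relative position la. *)
Definition rel_pos R (la : cochar n) (x y : gr_obj R) : Prop :=
  exists g, [/\ LG g, y = loop_act g (gr_base R) &
    x = loop_act (loop_mul g (loop_pi R la)) (gr_base R)].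
End LoopGroup.

Section OverKbar.
Context (kbar : closedFieldType) (iota : {rmorphism k -> kbar}) (n : nat).

Definition grP : presheaf kbar :=
  @Presheaf kbar (fun R => gr_obj n (restr iota R))
    (fun R S f => gr_pull (restr_hom iota f)).

Definition Gr : subfunctor grP := fun R =>
  [set x | is_lattice x.1 /\ is_lattice x.2].

Definition base R : pobj grP R := gr_base n (restr iota R).

Definition position (la : cochar n) R (x y : pobj grP R) : Prop :=
  forall (Om : closedFieldType) (s : {rmorphism kbar -> Om})
    (f : perfHom R (geom s)),
    rel_pos (R := restr iota (geom s)) la (pres f x) (pres f y).

Definition bounded (la : cochar n) R (x y : pobj grP R) : Prop :=
  forall (Om : closedFieldType) (s : {rmorphism kbar -> Om})
    (f : perfHom R (geom s)),
    exists la', [/\ dominant la', cle la' la &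
      rel_pos (R := restr iota (geom s)) la' (pres f x) (pres f y)].

Definition Gr_le (la : cochar n) : subfunctor grP := fun R =>
  [set x | Gr x /\ bounded la x (base R)].

Definition Gr_eq (la : cochar n) : subfunctor grP := fun R =>
  [set x | Gr x /\ position la x (base R)].

(* X_la(tau) = {g | g^-1 pi^tau sigma(g) lies in the closure of
   L^+G pi^la L^+G}, this closure being the union of the double cosets of the
   dominant la' <= la. *)
Definition ADLV (la tau : cochar n) : subfunctor grP := fun R =>
  [set x | Gr x /\
    forall (Om : closedFieldType) (s : {rmorphism kbar -> Om})
      (f : perfHom R (geom s)),
      let RO := restr iota (geom s) in
      exists g : loop n RO, [/\ LG g, pres f x = loop_act g (gr_base n RO) &
        exists la' (h1 h2 : loop n RO),
          [/\ dominant la', cle la' la, LGplus h1, LGplus h2 &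
              loop_mul (loop_pi RO tau) (loop_frob g) =
              loop_mul g (loop_mul h1 (loop_mul (loop_pi RO la') h2))]]].

Definition convP : presheaf kbar := prod_presheaf grP grP.

(* Points are (E_1, E_2) for E_2 --> E_1 --> E^0. *)
Definition Conv_le (la mu : cochar n) : subfunctor convP := fun R =>
  [set x | [/\ Gr x.1, Gr x.2, bounded la x.1 (base R) & bounded mu x.2 x.1]].

Definition Conv_eq (la mu : cochar n) : subfunctor convP := fun R =>
  [set x | [/\ Gr x.1, Gr x.2, position la x.1 (base R) & position mu x.2 x.1]].

Definition Gr0_le (la mu ka : cochar n) : subfunctor convP := fun R =>
  [set x | Conv_le la mu x /\ Gr_le ka x.2].

Definition Gr0_eq (la mu ka : cochar n) : subfunctor convP := fun R =>
  [set x | Conv_eq la mu x /\ Gr_eq ka x.2].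

Definition twisted_frob (tau : cochar n) R (x : pobj grP R) : pobj grP R :=
  loop_act (loop_pi (restr iota R) tau) (gr_frob x).

(* The fibre product of (1, pi^tau sigma) and (pr_1, m), where C is the chosen
   component. Since (pr_1, m) is (E_1, E_2) |-> (E_1, E_2), it embeds into Gr. *)
Definition Xopen (la mu ka tau : cochar n) (C : subfunctor convP) :
  subfunctor grP := fun R =>
  [set x | [/\ Gr_eq la x, C R (x, twisted_frob tau x) &
                        Gr0_eq la mu ka (R := R) (x, twisted_frob tau x)]].

(** * The Deligne-Lusztig variety *)

Definition lineP : presheaf kbar :=
  @Presheaf kbar (fun R => set 'cV[R]_n)
    (fun R S f M => span idfun [set map_mx f x | x in M]).

(* Direct summands of rank one of R^n *)
Definition is_line (R : perfAlg kbar) (M : set 'cV[R]_n) : Prop :=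
  exists P : 'M[R]_n, [/\ P *m P = P, M = range (mulmx P : 'cV_n -> 'cV_n) &
    forall (Om : closedFieldType) (s : {rmorphism kbar -> Om})
      (f : perfHom R (geom s)), \rank (map_mx f P : 'M[Om]_n) = 1%N].

Definition line_perp (R : perfAlg kbar) (M : set 'cV[R]_n) : set 'cV[R]_n :=
  [set y | forall x, M x -> bil x y = 0].

Definition line_frob (R : perfAlg kbar) (M : set 'cV[R]_n) : set 'cV[R]_n :=
  span idfun [set map_mx (fun a : R => a ^+ #|k|) x | x in M].

(* Parabolic subgroups of type S \ {s_1} are the stabilizers of lines, and P is in
   relative position 1 with F(P) when the line l satisfies l \subset F(l^perp).
   This is the functor of points on perfect algebras, which is that of the
   perfection: Spec R -> X factors uniquely through it for R perfect. *)
Definition DLV : subfunctor lineP := fun R =>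
  [set M | is_line M /\ M `<=` line_frob (line_perp M)].
End OverKbar.
End Grassmannian.

Definition mu n : cochar n := eps n 0 + eps n 1 + eps n 2.
Definition nu1 n : cochar n := - eps n n.
Definition tau1 n : cochar n := eps n 0.

Section Component.
Context (O : idomainType) (pi : O) (k : finFieldType)
  (red : {rmorphism O -> k}) (W : wittFunctor pi red)
  (kbar : closedFieldType) (iota : {rmorphism k -> kbar}) (n : nat).

Let la := cstar (nu1 n).
Let mus := cstar (mu n).
Let taus := cstar (tau1 n).
Let ka := nu1 n + taus.

Definition Gr0 : subfunctor (convP W iota n) := Gr0_le la mus ka.

(* C is the irreducible component of the expected dimension. *)
Definition is_Gr0_a1 (C : subfunctor (convP W iota n)) : Prop :=
  irreducible_component Gr0 C /\
  exists d, dim_eq Gr0 C d /\ d%:R = rho_pairing (la + mus + nu1 n + taus).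

Definition X_b1_x0 (C : subfunctor (convP W iota n)) :
    subfunctor (grP W iota n) :=
  closure_in (ADLV mus taus) (Xopen la mus ka taus C).
End Component.

(* Main.v *)
(* All the cocharacters involved are minuscule up to the center, so every bound
   is an equality and a point of the locus is a lattice E between pi W^n and W^n:
   it is the preimage LP P of the kernel of an idempotent P over R, of rank one
   at the geometric points (a lattice is of this form as soon as it is so at the
   geometric points, because R is reduced). In these terms F(E^\vee) is
   pi^-1 LP (perp_mx (frobmx P)).

   Gr^0 consists of the flags (line in a hyperplane) of the reduction, hence is
   homogeneous under GL_n. Its points at geometric points are pulled back from a
   single family over the perfection of k[x_ij][1/det], which is a domain, so
   Gr^0 is irreducible and the component C is everything. Then Xopen is the
   locus itself, i.e. it is given by pi F(E^\vee) \subset E; this is closed in the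
   affine Deligne-Lusztig variety, because divisibility by a power of pi in
   W_O(R) amounts to the vanishing of Witt coordinates and the position of E
   follows by comparing determinants. Hence taking the closure changes nothing.
   Finally E corresponds to the line orthogonal to its image in R^n, and
   pi F(E^\vee) \subset E to this line being orthogonal to its Frobenius twist. *)

Require Import Defs.
From HB Require Import structures.
From mathcomp Require Import all_boot all_order all_algebra all_field.
From mathcomp Require Import boolp classical_sets functions.
From mathcomp Require Import ring_quotient perm zify ring.
Set Implicit Arguments.
Unset Strict Implicit.
Unset Printing Implicit Defensive.
Import Order.TTheory GRing.Theory Num.Theory.
Local Open Scope classical_set_scope.
Local Open Scope ring_scope.

(** * Geometric points *)

(** The Witt vectors are known only through axioms, so no Witt coordinates are available and every
    statement over a general R has to be brought to algebraically closed fields, where [W_O(R)]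
    behaves as a discrete valuation ring and elementary divisors exist. Two facts make this
    possible: a perfect R is reduced, so equations in R can be checked at geometric points, and
    integrality in [W_O(R)[1/pi]] is itself a system of equations in R. Geometric points must in
    turn be produced from ideals, whence the construction of algebraically closed extensions.

    The position in the affine Deligne-Lusztig variety is forced by determinants only because
    Frobenius acts on the first factor of GU through the inverse transpose: it reverses the sign of
    the valuation of the determinant, so that comparing both sides of the defining relation yields
    an equation for this valuation instead of cancelling it.

    Irreducibility needs a universal flag whose ring both embeds into one algebraically closed field
    and maps to every geometric point in all prescribed ways. *)

Definition is_ideal (A : comNzRingType) (I : set A) : Prop :=
  [/\ I 0, forall x y, I x -> I y -> I (x + y) & forall a x, I x -> I (a * x)].

Record maximal_ideal (A : comNzRingType) := MaximalIdeal {
  mi_set :> set A;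
  mi_ideal : is_ideal mi_set;
  mi_proper : ~ mi_set 1;
  mi_max : forall x, ~ mi_set x -> exists a, mi_set (1 - a * x) }.

Lemma exists_maximal_ideal (A : comNzRingType) (I : set A) :
  is_ideal I -> ~ I 1 -> exists M : maximal_ideal A, I `<=` M.
Proof.
move=> iI nI1.
(* The property is imposed on the union with I because Zorn's lemma also considers the empty chain,
   whose union is the empty set. *)
pose P (J : set A) := is_ideal (I `|` J) /\ ~ (I `|` J) 1.
have [|J [[[J0 JD JM] J1] Jmax]] := @Zorn_bigcup A P.
  move=> F FP Ftot; split; last first.
    case=> // -[X FX X1]; case: (FP _ FX) => _; apply; by right.
  split.
  - by left; case: iI.
  - move=> x y [Ix|[X FX Xx]] [Iy|[Y FY Yy]].
    + by left; case: iI => _ + _; apply.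
    + have [[_ h _] _] := FP _ FY.
      have [] := h x y (or_introl Ix) (or_intror Yy); first by left.
      by move=> ?; right; exists Y.
    + have [[_ h _] _] := FP _ FX.
      have [] := h x y (or_intror Xx) (or_introl Iy); first by left.
      by move=> ?; right; exists X.
    + have [XY|YX] := Ftot X Y FX FY.
      * have [[_ h _] _] := FP _ FY.
        have [] := h x y (or_intror (XY _ Xx)) (or_intror Yy); first by left.
        by move=> ?; right; exists Y.
      * have [[_ h _] _] := FP _ FX.
        have [] := h x y (or_intror Xx) (or_intror (YX _ Yy)); first by left.
        by move=> ?; right; exists X.
  - move=> a x [Ix|[X FX Xx]]; first by left; case: iI => _ _; apply.
    have [[_ _ h] _] := FP _ FX.
    have [] := h a x (or_intror Xx); first by left.
    by move=> ?; right; exists X.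
have hM x : ~ (I `|` J) x -> exists a, (I `|` J) (1 - a * x).
  move=> nx; apply: contrapT => nex.
  pose B := [set y | exists a, (I `|` J) (y - a * x)].
  have JB : J `<=` B by move=> y Jy; exists 0; rewrite mul0r subr0; right.
  have IB : I `<=` B by move=> y Jy; exists 0; rewrite mul0r subr0; left.
  have Bx : B x by exists 1; rewrite mul1r subrr.
  have IBE : I `|` B = B by apply/setUidPr.
  apply: (Jmax B).
    split=> //; apply/existsNP; exists x; apply/not_implyP; split => // Jx.
    by apply: nx; right.
  split; rewrite IBE; last by [].
  split; first exact: IB _ (let: And3 h _ _ := iI in h).
    move=> y z [a ya] [b zb]; exists (a + b).
    by have := JD _ _ ya zb; rewrite mulrDl opprD addrACA.
  move=> c y [a ya]; exists (c * a).
  by have := JM c _ ya; rewrite mulrBr mulrA.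
exists (MaximalIdeal (And3 J0 JD JM) J1 hM) => x Ix; by left.
Qed.

Section ResidueField.
Context (A : comNzRingType) (M : maximal_ideal A).

Definition mi_pred : {pred A} := fun x => `[< mi_set M x >].

Lemma mi_predP : idealr_closed mi_pred.
Proof.
have [M0 MD MM] := mi_ideal M.
split; first exact/asboolP.
  by apply/negP => /asboolP; apply: mi_proper.
move=> a x y /asboolP Mx /asboolP My; apply/asboolP; apply: MD => //.
exact: MM.
Qed.

HB.instance Definition _ := isIdealr.Build A mi_pred mi_predP.

Definition residue_field := {ideal_quot mi_pred}.
HB.instance Definition _ := GRing.ComNzRing.on residue_field.

Definition to_residue : {rmorphism A -> residue_field} := \pi_residue_field%qT.

Lemma to_residueE x : (to_residue x == 0) = `[< mi_set M x >].
Proof.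
rewrite -[0](rmorph0 to_residue).
by rewrite -(Quotient.idealrBE mi_pred x 0) subr0.
Qed.

Lemma residue_field_inv (u : residue_field) :
  exists v, (u != 0 -> v * u = 1) /\ (u = 0 -> v = 0).
Proof.
have [->|u0] := eqVneq u 0; first by exists 0.
have uE : u = to_residue (repr u) by rewrite /= reprK.
have /mi_max[a Ma] : ~ mi_set M (repr u).
  by move=> h; case/negP: u0; rewrite uE to_residueE; apply/asboolP.
exists (to_residue a); split=> [_|u00]; last by rewrite u00 eqxx in u0.
rewrite {1}uE -rmorphM; apply/eqP; rewrite eq_sym -subr_eq0.
by rewrite -(rmorph1 to_residue) -rmorphB to_residueE; apply/asboolP.
Qed.

Definition residue_inv (u : residue_field) : residue_field := xget 0 [set v | (u != 0 -> v * u = 1) /\ (u = 0 -> v = 0)].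

Lemma residue_invP u : (u != 0 -> residue_inv u * u = 1) /\ (u = 0 -> residue_inv u = 0).
Proof. exact: (xgetPex 0 (residue_field_inv u)). Qed.

HB.instance Definition _ := GRing.ComNzRing_isField.Build residue_field
  (fun x => (residue_invP x).1) ((residue_invP 0).2 erefl).
End ResidueField.

Lemma proper_ideal_field (A : comNzRingType) (I : set A) :
  is_ideal I -> ~ I 1 ->
  exists (K : fieldType) (f : {rmorphism A -> K}), forall x, I x -> f x = 0.
Proof.
move=> iI /(exists_maximal_ideal iI)[M IM].
exists (residue_field M), (to_residue M) => x /IM Mx.
by apply/eqP; rewrite to_residueE; apply/asboolP.
Qed.

(** No irreducible factor is chosen: the quotient of [{poly K}] by any maximal ideal containing p
    has the class of ['X] as a root. *)
Lemma exists_root_field (K : fieldType) (p : {poly K}) : (1 < size p)%N ->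
  exists (L : fieldType) (f : {rmorphism K -> L}) x, root (map_poly f p) x.
Proof.
move=> p1; have [||L [f fI]] := @proper_ideal_field {poly K} [set q | p %| q].
- split=> /= [|x y|a x]; [exact: dvdp0|exact: dvdp_add|exact: dvdp_mull].
- by move=> /=; rewrite dvdp1 => /eqP p_1; rewrite p_1 in p1.
pose g : {rmorphism K -> L} := f \o polyC.
exists L, g, (f 'X); apply/rootP.
rewrite -[RHS](fI p) ?dvdpp //= map_poly_comp horner_map /=.
by rewrite -/(comp_poly 'X p) comp_polyXr.
Qed.

Lemma exists_splitting_field (K : fieldType) (p : {poly K}) : p != 0 ->
  exists (L : fieldType) (f : {rmorphism K -> L}) (s : seq L),
    map_poly f p = lead_coef (map_poly f p) *: \prod_(z <- s) ('X - z%:P).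
Proof.
have [m] := ubnP (size p); elim: m K p => // m IH K p pm p0.
have [p1|p1] := leqP (size p) 1.
  have /size_poly1P[c c0 ->] : size p == 1%N.
    by rewrite eqn_leq p1 size_poly_gt0.
  exists K, idfun, [::]; rewrite map_poly_id // lead_coefC big_nil.
  by rewrite -mul_polyC mulr1.
have [L [f [x /factor_theorem[q qE]]]] := exists_root_field p1.
have p0' : map_poly f p != 0 by rewrite map_poly_eq0.
have q0 : q != 0 by apply: contra_neq p0' => q0; rewrite qE q0 mul0r.
have [|//|L' [g [s sE]]] := IH L q.
  by move: pm; rewrite -(size_map_poly f) qE size_Mmonic ?monicXsubC // size_XsubC addn2.
exists L', (g \o f), (g x :: s).
rewrite map_poly_comp qE rmorphM /= rmorphB /= map_polyX map_polyC /=.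
rewrite lead_coefM lead_coefXsubC mulr1 {1}sE big_cons mulrC.
by rewrite -scalerAr.
Qed.

Section Product.
Context (T : Type) (L : T -> fieldType) (t0 : T).

(* The witness t0 of the index set makes the product a nonzero ring. *)
Definition field_prod (_ : T) := forall t, L t.
Local Notation P := (field_prod t0).
HB.instance Definition _ := gen_eqMixin P.
HB.instance Definition _ := gen_choiceMixin P.

Let zero : P := fun=> 0.
Let one : P := fun=> 1.
Let opp (x : P) : P := fun t => - x t.
Let add (x y : P) : P := fun t => x t + y t.
Let mul (x y : P) : P := fun t => x t * y t.

Let funE (x y : P) : (forall t, x t = y t) -> x = y.
Proof. exact: functional_extensionality_dep. Qed.

Let addA : associative add.
Proof. by move=> x y z; apply: funE => t; rewrite /add addrA. Qed.
Let addC : commutative add.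
Proof. by move=> x y; apply: funE => t; rewrite /add addrC. Qed.
Let add0 : left_id zero add.
Proof. by move=> x; apply: funE => t; rewrite /add add0r. Qed.
Let addN : left_inverse zero opp add.
Proof. by move=> x; apply: funE => t; rewrite /add addNr. Qed.
HB.instance Definition _ := GRing.isZmodule.Build P addA addC add0 addN.

Let mulA : associative mul.
Proof. by move=> x y z; apply: funE => t; rewrite /mul mulrA. Qed.
Let mulC : commutative mul.
Proof. by move=> x y; apply: funE => t; rewrite /mul mulrC. Qed.
Let mul1 : left_id one mul.
Proof. by move=> x; apply: funE => t; rewrite /mul mul1r. Qed.
Let mulD : left_distributive mul add.
Proof. by move=> x y z; apply: funE => t; rewrite /mul /add mulrDl. Qed.
Let one_neq0 : one != zero.
Proof.
by apply/negP => /eqP/(congr1 (fun x : P => x t0))/eqP; rewrite oner_eq0.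
Qed.
HB.instance Definition _ :=
  GRing.Zmodule_isComNzRing.Build P mulA mulC mul1 mulD one_neq0.

Definition prod_ev t (x : P) : L t := x t.

Lemma prod_ev_additive t : nmod_morphism (prod_ev t). Proof. by []. Qed.
Lemma prod_ev_multiplicative t : monoid_morphism (prod_ev t). Proof. by []. Qed.
HB.instance Definition _ t :=
  GRing.isNmodMorphism.Build P (L t) (prod_ev t) (prod_ev_additive t).
HB.instance Definition _ t :=
  GRing.isMonoidMorphism.Build P (L t) (prod_ev t) (prod_ev_multiplicative t).

Context (A : comNzRingType) (f : forall t, {rmorphism A -> L t}).

Definition prod_map (a : A) : P := fun t => f t a.

Lemma prod_map_additive : nmod_morphism prod_map.
Proof.
by split=> [|x y]; apply: funE => t; rewrite /prod_map ?rmorph0 ?rmorphD.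
Qed.
Lemma prod_map_multiplicative : monoid_morphism prod_map.
Proof.
by split=> [|x y]; apply: funE => t; rewrite /prod_map ?rmorph1 ?rmorphM.
Qed.
HB.instance Definition _ :=
  GRing.isNmodMorphism.Build A P prod_map prod_map_additive.
HB.instance Definition _ :=
  GRing.isMonoidMorphism.Build A P prod_map prod_map_multiplicative.
End Product.

(* Quotient of the product over all polynomials p of splitting fields of p, by
   a maximal ideal containing the families that vanish at all multiples of some
   p. *)
Lemma exists_splitting_all (K : fieldType) :
  exists (L : fieldType) (f : {rmorphism K -> L}), forall p : {poly K}, p != 0 ->
    exists s : seq L, map_poly f p %= \prod_(z <- s) ('X - z%:P).
Proof.
pose T := {p : {poly K} | p != 0}.
pose t0 : T := exist _ 1 (oner_neq0 _).
have spl (t : T) := cid (exists_splitting_field (svalP t)).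
pose L t := projT1 (spl t).
have splf (t : T) := cid (projT2 (spl t)).
pose f t : {rmorphism K -> L t} := projT1 (splf t).
(* The number of factors depends on t alone, so the i-th roots in the various [L t'] assemble to one
   element of the product for each i. Where t does not divide t' the values are arbitrary, the ideal
   [J] below ignoring them. *)
have root_mul (t t' : T) : exists s : nat -> L t', sval t %| sval t' ->
    map_poly (f t') (sval t) =
    (f t' (lead_coef (sval t))) *: \prod_(i < (size (sval t)).-1) ('X - (s i)%:P).
  have [dv|] := boolP (sval t %| sval t'); last by exists (fun=> 0).
  have [s sE] := projT2 (splf t').
  have : map_poly (f t') (sval t) %| \prod_(z <- s) ('X - z%:P).
    have : map_poly (f t') (sval t) %| map_poly (f t') (sval t').
      by rewrite dvdp_map.
    rewrite {1}sE dvdpZr // lead_coef_eq0 map_poly_eq0.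
    exact: (svalP t').
  move=> /dvdp_prod_XsubC[m]; set s' := mask m s => s'E.
  exists (fun i => s'`_i) => _.
  have /eqpP[[c d] /= /andP[c0 d0] cdE] := s'E.
  have tE : map_poly (f t') (sval t) = (d / c) *: \prod_(z <- s') ('X - z%:P).
    by rewrite mulrC -scalerA -cdE scalerA mulVf // scale1r.
  have lE : f t' (lead_coef (sval t)) = d / c.
    rewrite -lead_coef_map tE lead_coefZ (monicP _) ?mulr1 //.
    exact: monic_prod_XsubC.
  have szE : (size (sval t)).-1 = size s'.
    rewrite -(size_map_poly (f t')) tE size_scale ?size_prod_XsubC //.
    by rewrite mulf_neq0 ?invr_eq0.
  by rewrite lE tE szE (big_nth 0) big_mkord.
have [s sP] : exists s : forall (t t' : T), nat -> L t', forall t t',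
    sval t %| sval t' -> map_poly (f t') (sval t) =
    (f t' (lead_coef (sval t))) *: \prod_(i < (size (sval t)).-1) ('X - (s t t' i)%:P).
  by exists (fun t t' => projT1 (cid (root_mul t t'))) => t t'; case: cid.
pose P := @field_prod T L t0.
pose J : set P := [set x : P | exists t : T, forall t' : T, sval t %| sval t' -> x t' = 0].
have [||F [g gJ]] := @proper_ideal_field P J.
- split.
  + by exists t0.
  + move=> x y [t xt] [u yu].
    have tuP : sval t * sval u != 0 by rewrite mulf_neq0 ?(svalP t) ?(svalP u).
    pose tu : T := exist _ (sval t * sval u) tuP.
    exists tu => /= t' dv.
    have -> : (x + y) t' = x t' + y t' by [].
    rewrite xt ?yu ?addr0 //; apply: dvdp_trans dv.
      exact: dvdp_mull.
    exact: dvdp_mulr.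
  + move=> a x [t xt]; exists t => t' dv.
    have -> : (a * x) t' = a t' * x t' by [].
    by rewrite xt ?mulr0.
- case=> t /(_ t (dvdpp _))/eqP.
  by have -> : (1 : P) t = 1 by []; rewrite oner_eq0.
exists F, (g \o prod_map t0 f) => p p0.
pose t : T := exist _ p p0.
pose z i : P := fun t' => s t t' i.
exists [seq g (z i) | i <- index_iota 0 (size p).-1].
(* A polynomial identity that holds at all multiples of p survives in [F]; it is applied to the
   factorization of p with roots [z i]. *)
have killJ (q : {poly P}) : (forall t', p %| sval t' ->
    map_poly (prod_ev t') q = 0) -> map_poly g q = 0.
  move=> qt; apply/polyP => i; rewrite coef_map coef0 /= gJ //.
  exists t => t' dv; have /polyP/(_ i) := qt t' dv.
  by rewrite coef_map coef0.
pose q := map_poly (prod_map t0 f) p -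
  prod_map t0 f (lead_coef p) *: \prod_(i < (size p).-1) ('X - (z i)%:P).
have /eqP : map_poly g q = 0.
  apply: killJ => t' dv; rewrite rmorphB /= -map_poly_comp map_polyZ /=.
  rewrite rmorph_prod /=; apply/eqP; rewrite subr_eq0; apply/eqP.
  rewrite (_ : map_poly _ p = map_poly (f t') p); last exact: eq_map_poly.
  rewrite (sP t t' dv); congr (_ *: _); apply: eq_bigr => i _.
  by rewrite rmorphB /= map_polyX map_polyC.
rewrite rmorphB subr_eq0 /= map_polyZ -map_poly_comp => /eqP ->.
rewrite big_map big_mkord rmorph_prod /=.
have -> : \prod_(i < (size p).-1) map_poly g ('X - (z i)%:P) =
    \prod_(i < (size p).-1) ('X - (g (z i))%:P).
  by apply: eq_bigr => i _; rewrite rmorphB /= map_polyX map_polyC.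
apply: eqp_scale; rewrite (fmorph_eq0 (g \o prod_map t0 f)).
by rewrite lead_coef_eq0.
Qed.

Section RelativeClosure.
Context (K L : fieldType) (f : {rmorphism K -> L}).

Definition algebraic_pred : {pred L} := fun x => `[< algebraicOver f x >].

Lemma algebraic_pred_divring : divring_closed algebraic_pred.
Proof.
split=> [|x y /asboolP fx /asboolP fy|x y /asboolP fx /asboolP fy];
  apply/asboolP; [exact: algebraic1|exact: algebraic_sub|exact: algebraic_div].
Qed.
HB.instance Definition _ :=
  GRing.isDivringClosed.Build L algebraic_pred algebraic_pred_divring.

Definition rel_closure := {x : L | algebraic_pred x}.
HB.instance Definition _ := [isSub of rel_closure for sval].
HB.instance Definition _ := [Choice of rel_closure by <:].
HB.instance Definition _ := [SubChoice_isSubIntegralDomain of rel_closure by <:].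
HB.instance Definition _ := [SubIntegralDomain_isSubField of rel_closure by <:].

Lemma algebraic_pred_id a : algebraic_pred (f a).
Proof. exact/asboolP/algebraic_id. Qed.

Definition to_rel_closure (a : K) : rel_closure :=
  exist _ (f a) (algebraic_pred_id a).

Lemma to_rel_closure_additive : nmod_morphism to_rel_closure.
Proof. by split=> [|x y]; apply: val_inj; rewrite /= ?rmorph0 ?rmorphD. Qed.
Lemma to_rel_closure_multiplicative : monoid_morphism to_rel_closure.
Proof. by split=> [|x y]; apply: val_inj; rewrite /= ?rmorph1 ?rmorphM. Qed.
HB.instance Definition _ :=
  GRing.isNmodMorphism.Build K rel_closure to_rel_closure to_rel_closure_additive.
HB.instance Definition _ :=
  GRing.isMonoidMorphism.Build K rel_closure to_rel_closure
    to_rel_closure_multiplicative.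

End RelativeClosure.

(** Let L split all polynomials over K, and let F consist of the elements of L algebraic over K. A
    root y of a polynomial over F, taken in some extension of L, is algebraic over K; the polynomial
    over K that kills it already splits in L, so y lies in F. *)
Lemma exists_closed_extension (K : fieldType) :
  exists (Om : closedFieldType) (f : {rmorphism K -> Om}), True.
Proof.
have [L [f fsplit]] := exists_splitting_all K.
pose F := rel_closure f.
have root_alg (p : {poly F}) : (1 < size p)%N -> exists x, root p x.
  move=> p1; pose v : {rmorphism F -> L} := val.
  have pv1 : (1 < size (map_poly v p))%N by rewrite size_map_poly.
  have [E [g [y py]]] := exists_root_field pv1.
  have p0 : p != 0 by rewrite -size_poly_gt0 ltnW.
  have : algebraicOver (g \o f) y.
    apply/integral_algebraic; apply: (@integral_root _ _ _ (map_poly (g \o v) p)).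
    - by rewrite map_poly_eq0.
    - by rewrite map_poly_comp.
    apply/integral_poly => i; rewrite coef_map /=.
    by apply: integral_rmorph; apply/integral_algebraic/asboolP/(svalP (p`_i)).
  case=> q q0 qy; have [s sE] := fsplit q q0.
  have : root (map_poly g (map_poly f q)) y by rewrite -map_poly_comp.
  rewrite (eqp_root (_ : _ %= map_poly g (\prod_(z <- s) ('X - z%:P)))); last first.
    by rewrite eqp_map.
  rewrite rmorph_prod /= (eq_bigr (fun z => 'X - (g z)%:P)); last first.
    by move=> z _; rewrite rmorphB /= map_polyX map_polyC.
  rewrite -(big_map g predT (fun z => 'X - z%:P)) root_prod_XsubC.
  case/mapP => z zs yE.
  have fz : algebraic_pred f z.
    apply/asboolP; exists q => //; rewrite (eqp_root sE) root_prod_XsubC //.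
  exists (exist _ z fz); rewrite -(fmorph_root v) -(fmorph_root g) /= -yE.
  by [].
have ax : GRing.closed_field_axiom F.
  move=> m P m0; pose p := 'X^m - \poly_(i < m) P i.
  have [|x] := root_alg p.
    rewrite size_polyDl size_polyXn // size_polyN ltnS; exact: size_poly.
  rewrite /root !hornerE horner_poly subr_eq0 => /eqP; by exists x.
pose C := HB.pack_for closedFieldType F (Field_isAlgClosed.Build F ax).
by exists C, (to_rel_closure f).
Qed.

Lemma geometric_point (l : comNzRingType) (R : perfAlg l) (I : set R) :
  is_ideal I -> ~ I 1 ->
  exists (Om : closedFieldType) (s : {rmorphism l -> Om})
    (f : perfHom R (geom s)), forall x, I x -> f x = 0.
Proof.
move=> iI /(proper_ideal_field iI)[K [g gI]].
have [Om [h _]] := exists_closed_extension K.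
pose s : {rmorphism l -> Om} := h \o (g \o perf_str R).
pose f : {rmorphism R -> Om} := h \o g.
exists Om, s, (@PerfHom l R (geom s) f (fun=> erefl)) => x /gI /= ->.
exact: rmorph0.
Qed.

(** Rabinowitsch's trick: a becomes invertible in R[X]/(aX - 1). This ring is nonzero, because 1 = q
    (aX - 1) forces the coefficients of q to be the -a^i, which never vanish. *)
Lemma geometric_neq0 (l : comNzRingType) (R : perfAlg l) (a : R) :
  (forall m, a ^+ m != 0) ->
  exists (Om : closedFieldType) (s : {rmorphism l -> Om})
    (f : perfHom R (geom s)), f a != 0.
Proof.
move=> an0; pose P : {poly R} := 'X * a%:P - 1.
have [||K [g gI]] := @proper_ideal_field {poly R} [set q | exists r, q = r * P].
- split=> /= [|_ _ [r ->] [r' ->]|b _ [r ->]].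
  + by exists 0; rewrite mul0r.
  + by exists (r + r'); rewrite mulrDl.
  + by exists (b * r); rewrite mulrA.
- case=> q qE.
  have qc i : q`_i = - a ^+ i.
    elim: i => [|i IHi]; have /polyP := qE.
      move=> /(_ 0%N); rewrite mulrBr mulr1 !coefE mulrA coefMC coefMX /= mul0r sub0r.
      by move/(congr1 -%R); rewrite opprK expr0 => <-.
    move=> /(_ i.+1); rewrite mulrBr mulr1 !coefE mulrA coefMC coefMX /= IHi.
    by move/esym/eqP; rewrite subr_eq0 exprSr mulNr => /eqP <-.
  have := qc (size q); rewrite nth_default // => /esym/eqP.
  by rewrite oppr_eq0 (negPf (an0 _)).
have [Om [h _]] := exists_closed_extension K.
pose f : {rmorphism R -> Om} := h \o (g \o polyC).
pose s : {rmorphism l -> Om} := f \o perf_str R.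
exists Om, s, (@PerfHom l R (geom s) f (fun=> erefl)) => /=.
have /gI : exists r, P = r * P by exists 1; rewrite mul1r.
rewrite /P => /(congr1 h); rewrite !(rmorphB, rmorphM, rmorph1, rmorph0) => /eqP.
rewrite subr_eq0 => /eqP fa; apply/negP => /eqP fa0.
by move: fa; rewrite fa0 mulr0 => /eqP; rewrite eq_sym oner_eq0.
Qed.

(** * Strict lifts and the functoriality of Witt vectors *)

Section StrictLift.
Context (A R : comNzRingType) (x : A) (red : {rmorphism A -> R}).
Hypothesis lift : strict_lift x red.

Definition cong m (a b : A) := exists c, a - b = x ^+ m * c.

Lemma congD m a b a' b' : cong m a b -> cong m a' b' -> cong m (a + a') (b + b').
Proof. by move=> [c ac] [d ad]; exists (c + d); rewrite mulrDr -ac -ad; ring. Qed.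

Lemma congMx m a b : cong m a b -> cong m.+1 (x * a) (x * b).
Proof. by move=> [d ad]; exists d; rewrite exprS -mulrA -ad; ring. Qed.

Lemma strict_reg_exp m a : x ^+ m * a = 0 -> a = 0.
Proof.
by elim: m => [|m IH]; rewrite ?mul1r // exprS -mulrA => /(strict_reg lift).
Qed.

Lemma cong1P a b : red a = red b <-> cong 1 a b.
Proof.
split=> [ab|[c abE]].
  have [c cE] : exists c, a - b = x * c.
    by apply/(strict_ker lift); rewrite rmorphB ab subrr.
  by exists c; rewrite expr1.
apply/eqP; rewrite -subr_eq0 -rmorphB; apply/eqP/(strict_ker lift).
by exists c; rewrite abE expr1.
Qed.

Context (p : nat) (charp : p \in [pchar R]).

(** The cofactor of a - b in a^p - b^p is a sum of p terms that agree modulo x, hence divisible by x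
    since R has characteristic p. *)
Lemma cong_exp m a b : cong m.+1 a b -> cong m.+2 (a ^+ p) (b ^+ p).
Proof.
move=> [c abE]; have ab : red a = red b.
  by apply/cong1P; exists (x ^+ m * c); rewrite abE expr1 exprS mulrA.
have [d dE] : exists d, \sum_(i < p) a ^+ (p.-1 - i) * b ^+ i = x * d.
  apply/(strict_ker lift); rewrite rmorph_sum /=.
  rewrite (eq_bigr (fun=> red b ^+ p.-1)) => [|i _].
    by rewrite sumr_const card_ord -mulr_natr (pcharf0 charp) mulr0.
  rewrite rmorphM !rmorphXn ab -exprD subnK // -ltnS prednK //.
  exact: prime_gt0 (pcharf_prime charp).
by exists (c * d); rewrite subrXX abE dE [in RHS]exprS; ring.
Qed.

Lemma cong_expX m a b : red a = red b -> cong m.+1 (a ^+ (p ^ m)) (b ^+ (p ^ m)).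
Proof.
move=> ab; elim: m => [|m IHm]; first by rewrite expn0 !expr1; apply/cong1P.
by rewrite expnSr !exprM; apply: cong_exp.
Qed.

(** With [b0] lifting r, [a * b0] is 1 - t with t divisible by x, and the geometric series in t
    converges by completeness. *)
Lemma lift_unit a r : red a * r = 1 -> exists b, a * b = 1.
Proof.
have [b0 <-] := strict_surj lift r.
rewrite -rmorphM -(rmorph1 red) => /cong1P[c cE].
pose t := - x * c; have aE : a * b0 = 1 - t.
  by rewrite /t mulNr opprK -[LHS](subrK 1) cE expr1 addrC.
pose u m := \sum_(i < m) t ^+ i.
have tX m : t ^+ m = x ^+ m * (- c) ^+ m by rewrite -exprMn; congr (_ ^+ _); rewrite /t; ring.
have [v vE] : exists v, forall m, exists d, v - u m = x ^+ m * d.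
  apply: (strict_complete lift) => m.
  by exists ((- c) ^+ m); rewrite /u big_ord_recr /= -tX addrAC subrr add0r.
exists (b0 * v); rewrite mulrA aE; apply/eqP; rewrite -subr_eq0; apply/eqP.
apply: (strict_sep lift) => m; have [d dE] := vE m.
exists ((1 - t) * d - (- c) ^+ m).
have -> : (1 - t) * v - 1 = (1 - t) * (v - u m) + ((1 - t) * u m - 1) by ring.
have -> : (1 - t) * u m - 1 = - t ^+ m.
  have := subrX1 t m; rewrite -/(u m) => h.
  have -> : (1 - t) * u m = - ((t - 1) * u m) by ring.
  by rewrite -h; ring.
by rewrite dE tX; ring.
Qed.
End StrictLift.

Section StrictMaps.
Context (A R : comNzRingType) (x : A) (red : {rmorphism A -> R}).
Hypothesis lift : strict_lift x red.
Context (p : nat) (charp : p \in [pchar R]) (perfR : perfect R).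

Lemma perfect_root m r : exists t : R, t ^+ (p ^ m) = r.
Proof.
have [g _ gK] := perfR charp; elim: m r => [|m IHm] r; first by exists r; rewrite expr1.
by have [t tE] := IHm (g r); exists t; rewrite expnSr exprM tE gK.
Qed.

(** One step of the Witt expansion: b lifts a p^m-th root of [red a], so [b ^+ (p ^ m)] approximates
    the Teichmueller lift of [red a] modulo x^(m+1). *)
Lemma strict_decomp m a : exists b c, a = b ^+ (p ^ m) + x * c.
Proof.
have [t tE] := perfect_root m (red a).
have [b bE] := strict_surj lift t.
have /(cong1P lift)[c cE] : red a = red (b ^+ (p ^ m)) by rewrite rmorphXn bE tE.
by exists b, c; rewrite -[x * c](congr1 ( *%R^~ c) (expr1 x)) -cE; ring.
Qed.

Context (A' R' : comNzRingType) (x' : A') (red' : {rmorphism A' -> R'}).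
Hypothesis lift' : strict_lift x' red'.

(** By induction on the precision: in [strict_decomp] the images of b agree modulo x', so their
    p^m-th powers agree modulo x'^(m+1), and the factor x improves the precision on c by one. *)
Lemma strict_uniq (phi psi : {rmorphism A -> A'}) :
  phi x = x' -> psi x = x' -> p \in [pchar R'] ->
  (forall a, red' (phi a) = red' (psi a)) -> phi =1 psi.
Proof.
move=> phix psix charp' phipsi.
suff phipsiX m a : cong x' m (phi a) (psi a).
  by move=> a; apply/eqP; rewrite -subr_eq0; apply/eqP/(strict_sep lift') => m; apply: phipsiX.
elim: m a => [|m IHm] a; first by exists (phi a - psi a); rewrite mul1r.
have [b [c ->]] := strict_decomp m a.
rewrite !rmorphD !rmorphM !rmorphXn phix psix.
apply: congD; last by apply: congMx; apply: IHm.
by apply: (cong_expX lift' charp'); apply: phipsi.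
Qed.

(* I consists of the first N Witt coordinates of a, up to Frobenius twists. *)
Lemma closed_divisibility N a : exists I : set R,
  forall (A' R' : comNzRingType) (x' : A') (red' : {rmorphism A' -> R'})
    (phi : {rmorphism A -> A'}) (f : {rmorphism R -> R'}),
  perfect R' -> strict_lift x' red' -> phi x = x' -> (forall a, red' (phi a) = f (red a)) ->
  (exists b, phi a = x' ^+ N * b) <-> (forall r, I r -> f r = 0).
Proof.
elim: N a => [|N IHN] a.
  exists set0 => B S y redB phi f _ _ _; split=> // _.
  by exists (phi a); rewrite mul1r.
have [b [c aE]] := strict_decomp N a; have [I IP] := IHN c.
exists (red a |` I) => B S y redB phi f perfS liftB phix redphi.
have {}IP := IP B S y redB phi f perfS liftB phix redphi.
have charS : p \in [pchar S] := rmorph_pchar f charp.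
(* Once the first coordinate dies in the reduced ring S, the whole Teichmueller term is divisible by
   y^(N+1). Divisibility of [phi a] by y^(N+1) then amounts to that of [phi c] by y^N. *)
have phi_b : f (red a) = 0 -> exists d, phi (b ^+ (p ^ N)) = y ^+ N.+1 * d.
  rewrite aE rmorphD rmorphM rmorphXn.
  have -> : red x = 0 by apply/(strict_ker lift); exists 1; rewrite mulr1.
  rewrite mul0r addr0 rmorphXn -redphi => fb0.
  have fb : redB (phi b ^+ (p ^ N)) = redB 0 by rewrite rmorphXn fb0 rmorph0.
  have {}fb : redB (phi b) = redB 0.
    rewrite rmorph0; move: fb; rewrite rmorphXn rmorph0; move: (redB _) => r.
    have /bij_inj pinj := perfS p charS.
    elim: (N) => [|m IH]; first by rewrite expr1.
    rewrite expnSr exprM => rm; apply: IH; apply: pinj.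
    by rewrite rm expr0n (gtn_eqF (prime_gt0 (pcharf_prime charS))).
  have [d dE] := cong_expX liftB charS N fb.
  exists d; rewrite rmorphXn -dE expr0n expn_eq0.
  by rewrite (gtn_eqF (prime_gt0 (pcharf_prime charS))) subr0.
have phi_aE : phi a = phi (b ^+ (p ^ N)) + y * phi c.
  by rewrite {1}aE rmorphD [phi (_ * _)]rmorphM phix.
split.
- move=> [e eE] r.
  have fa0 : f (red a) = 0.
    by rewrite -redphi eE; apply/(strict_ker liftB); exists (y ^+ N * e); rewrite exprS mulrA.
  case=> [->//|Ir]; apply: (IP.1 _ r Ir).
  have [d dE] := phi_b fa0; exists (e - d).
  apply/eqP; rewrite -subr_eq0; apply/eqP/(strict_reg liftB).
  rewrite mulrBr; move: phi_aE; rewrite eE dE => h; rewrite mulrA -exprS.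
  have -> : y * phi c = y ^+ N.+1 * e - y ^+ N.+1 * d by rewrite h; ring.
  by ring.
- move=> fI; have fa0 : f (red a) = 0 by apply: fI; left.
  have [d dE] := phi_b fa0.
  have [e eE] : exists e, phi c = y ^+ N * e by apply/IP => r Ir; apply: fI; right.
  by exists (d + e); rewrite phi_aE dE eE exprS; ring.
Qed.
End StrictMaps.

Section PerfHom.
Context (l : comNzRingType).

Definition perf_id (R : perfAlg l) : perfHom R R :=
  @PerfHom l R R idfun (fun=> erefl).

Lemma perf_compP (R S T : perfAlg l) (g : perfHom S T) (f : perfHom R S) a :
  (perf_fun g \o perf_fun f) (perf_str R a) = perf_str T a.
Proof. by rewrite /= !perf_funP. Qed.

Definition perf_comp (R S T : perfAlg l) (g : perfHom S T) (f : perfHom R S) :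
  perfHom R T := PerfHom (perf_compP g f).

Lemma perf_reduced (R : perfAlg l) p (r : R) m :
  p \in [pchar R] -> r ^+ m = 0 -> r = 0.
Proof.
move=> charp rm; have /bij_inj pinj := @perf_perfect _ R p charp.
have p_gt1 := prime_gt1 (pcharf_prime charp).
have : r ^+ (p ^ m) = 0.
  by rewrite -(subnK (ltnW (ltn_expl m p_gt1))) exprD rm mulr0.
elim: (m) => [|i IH]; first by rewrite expr1.
rewrite expnSr exprM => ri; apply: IH; apply: pinj.
by rewrite ri expr0n (gtn_eqF (ltnW p_gt1)).
Qed.
End PerfHom.

Section Witt.
Context (O : idomainType) (pi : O) (k : finFieldType)
  (red : {rmorphism O -> k}) (W : wittFunctor pi red).

Lemma exists_pchar : exists p, p \in [pchar k].
Proof. by have [p _ pchark] := finPcharP k; exists p. Qed.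

Definition char_k := projT1 (cid exists_pchar).

Lemma char_kP (R : perfAlg k) : char_k \in [pchar R].
Proof.
rewrite /char_k; case: cid => p /= charp.
exact: (rmorph_pchar (perf_str R) charp).
Qed.

Definition integral (R : perfAlg k) : set (wittI W R) := range (witt_inc W R).

Lemma witt_inc_inj R : injective (witt_inc W R).
Proof.
move=> a b ab; apply/eqP; rewrite -subr_eq0; apply/eqP.
have [|m] := loc_ker (witt_loc W R) (a := a - b).
  by rewrite rmorphB ab subrr.
exact: strict_reg_exp (witt_lift W R) m _.
Qed.

Lemma piI_unit R : piI W R \is a GRing.unit.
Proof. exact: loc_unit (witt_loc W R). Qed.
#[local] Hint Resolve piI_unit : core.

Section Ring.
Context (R : perfAlg k).
Implicit Types a b : wittI W R.

Lemma integral_inc w : integral (witt_inc W R w). Proof. by exists w. Qed.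
Lemma integral0 : integral (0 : wittI W R). Proof. by exists 0; rewrite ?rmorph0. Qed.
Lemma integral1 : integral (1 : wittI W R). Proof. by exists 1; rewrite ?rmorph1. Qed.
Lemma integral_pi : integral (piI W R). Proof. exact: integral_inc. Qed.
Lemma integralD a b : integral a -> integral b -> integral (a + b).
Proof. by move=> [x _ <-] [y _ <-]; rewrite -rmorphD; apply: integral_inc. Qed.
Lemma integralM a b : integral a -> integral b -> integral (a * b).
Proof. by move=> [x _ <-] [y _ <-]; rewrite -rmorphM; apply: integral_inc. Qed.
Lemma wittI_frac b : exists w m, b * piI W R ^+ m = witt_inc W R w.
Proof. exact: loc_surj (witt_loc W R) b. Qed.
End Ring.

Lemma witt_map_pi R S (f : perfHom R S) :
  witt_map W f (witt_str W R pi) = witt_str W S pi.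
Proof. exact: witt_map_str. Qed.

Lemma wittI_map_pi R S (f : perfHom R S) : wittI_map W f (piI W R) = piI W S.
Proof. by rewrite /piI wittI_map_inc witt_map_pi. Qed.

Lemma integral_map R S (f : perfHom R S) b :
  integral b -> integral (wittI_map W f b).
Proof. by move=> [w _ <-]; rewrite wittI_map_inc; apply: integral_inc. Qed.

Lemma wittI_map_uniq R S (phi psi : {rmorphism wittI W R -> wittI W S}) :
  (forall w, phi (witt_inc W R w) = psi (witt_inc W R w)) -> phi =1 psi.
Proof.
move=> phipsi b; have [w [m bE]] := wittI_frac b.
have u : phi (piI W R) ^+ m \is a GRing.unit.
  by rewrite -rmorphXn rmorph_unit // unitrX // piI_unit.
apply: (mulIr u); rewrite -rmorphXn -rmorphM bE phipsi -bE rmorphM; congr (_ * _).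
by rewrite !rmorphXn /piI phipsi.
Qed.

Lemma wittI_map_id R (f : perfHom R R) : f =1 id -> wittI_map W f =1 id.
Proof.
move=> fid; apply: (@wittI_map_uniq R R _ idfun) => w /=.
rewrite wittI_map_inc; congr (witt_inc W R _).
apply: (strict_uniq (witt_lift W R) (char_kP R) (@perf_perfect _ R)
  (witt_lift W R) (psi := idfun) (witt_map_pi f) erefl (char_kP R)) => a /=.
by rewrite witt_map_red fid.
Qed.

Lemma wittI_map_comp R S T (f : perfHom R S) (g : perfHom S T)
    (h : perfHom R T) : h =1 g \o f ->
  wittI_map W h =1 wittI_map W g \o wittI_map W f.
Proof.
move=> hgf; apply: (@wittI_map_uniq R T _ (wittI_map W g \o wittI_map W f)) => w /=.
rewrite !wittI_map_inc; congr (witt_inc W T _).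
apply: (strict_uniq (witt_lift W R) (char_kP R) (@perf_perfect _ R)
  (witt_lift W T) (psi := witt_map W g \o witt_map W f)
  (witt_map_pi h) _ (char_kP T)) => [|a] /=; first by rewrite !witt_map_pi.
by rewrite !witt_map_red hgf.
Qed.

(** After clearing denominators, integrality of b is divisibility of an element of [witt W R] by a
    power of pi. The same equations serve for every base change. *)
Lemma closed_integral R (b : wittI W R) : exists I : set R,
  forall S (f : perfHom R S),
    integral (wittI_map W f b) <-> (forall r, I r -> f r = 0).
Proof.
have [w [m bE]] := wittI_frac b.
have [I IP] := closed_divisibility (witt_lift W R) (char_kP R) (@perf_perfect _ R) m w.
exists I => S f.
have {}IP := IP _ _ _ _ (witt_map W f) (perf_fun f) (@perf_perfect _ S)
  (witt_lift W S) (witt_map_pi f) (witt_map_red f).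
rewrite -IP; have := congr1 (wittI_map W f) bE.
rewrite rmorphM rmorphXn wittI_map_inc wittI_map_pi => fbE.
split=> [[v _ vE]|[v vE]].
  exists v; apply: (@witt_inc_inj S).
  by rewrite -fbE rmorphM rmorphXn -vE mulrC.
exists v => //; apply: (mulIr (unitrX m (piI_unit S))).
by rewrite fbE vE rmorphM rmorphXn mulrC.
Qed.

Lemma witt_unit R (w : witt W R) r : witt_red W R w * r = 1 ->
  exists v, w * v = 1.
Proof. exact: lift_unit (witt_lift W R) w r. Qed.

Context (kbar : closedFieldType) (iota : {rmorphism k -> kbar}).

Lemma geometric_eq0 (R : perfAlg kbar) (r : R) :
  (forall (Om : closedFieldType) (s : {rmorphism kbar -> Om}) (f : perfHom R (geom s)), f r = 0) ->
  r = 0.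
Proof.
move=> r0; apply: contrapT => /eqP rn0.
have [|Om [s [f /eqP fr]]] := @geometric_neq0 kbar R r; last exact: fr (r0 _ _ _).
move=> m; apply: contra_neq rn0.
exact: (perf_reduced (R := R) (char_kP (restr iota R))).
Qed.

(** Integrality is the vanishing of certain elements of R, and these are detected by geometric
    points because R is reduced. *)
Lemma geometric_integral (R : perfAlg kbar) (b : wittI W (restr iota R)) :
  (forall (Om : closedFieldType) (s : {rmorphism kbar -> Om}) (f : perfHom R (geom s)),
     integral (wittI_map W (restr_hom iota f) b)) -> integral b.
Proof.
move=> fb; have [I IP] := closed_integral b.
rewrite -(@wittI_map_id _ (perf_id _) (frefl _) b); apply/IP => r Ir /=.
apply: (@geometric_eq0 R) => Om s f.
exact: (IP _ (restr_hom iota f)).1 (fb _ _ _) r Ir.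
Qed.
End Witt.

(** * Lattices by dual bases *)

Section Lattices.
Context (O : idomainType) (pi : O) (k : finFieldType)
  (red : {rmorphism O -> k}) (W : wittFunctor pi red).
Implicit Types R S : perfAlg k.

Definition mxint R m r (M : 'M[wittI W R]_(m, r)) := forall i j, integral (M i j).

Local Notation incmx := (map_mx (witt_inc W _)).
Local Notation redmx := (map_mx (witt_red W _)).
Local Notation fmx f := (map_mx (wittI_map W f)).

Section MxInt.
Context (R : perfAlg k).

Lemma mxintP m r (M : 'M[wittI W R]_(m, r)) : mxint M <-> exists N, M = incmx N.
Proof.
split=> [iM|[N ->] i j]; last by rewrite mxE; apply: integral_inc.
pose c i j := cid2 (iM i j); exists (\matrix_(i, j) s2val (c i j)).
by apply/matrixP => i j; rewrite !mxE (s2valP' (c i j)).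
Qed.

Lemma mxint_inc m r (N : 'M[witt W R]_(m, r)) : mxint (incmx N).
Proof. by apply/mxintP; exists N. Qed.

Lemma mxintM m r q (M : 'M[wittI W R]_(m, r)) (N : 'M_(r, q)) :
  mxint M -> mxint N -> mxint (M *m N).
Proof. by move=> /mxintP[M' ->] /mxintP[N' ->]; rewrite -map_mxM; apply: mxint_inc. Qed.

Lemma mxintD m r (M N : 'M[wittI W R]_(m, r)) : mxint M -> mxint N -> mxint (M + N).
Proof. by move=> iM iN i j; rewrite mxE; apply: integralD. Qed.

Lemma mxintZ m r a (M : 'M[wittI W R]_(m, r)) : integral a -> mxint M -> mxint (a *: M).
Proof. by move=> ia iM i j; rewrite mxE; apply: integralM. Qed.

Lemma mxint_tr m r (M : 'M[wittI W R]_(m, r)) : mxint M -> mxint M^T.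
Proof. by move=> iM i j; rewrite mxE. Qed.

Lemma mxint_antidiag n : mxint (antidiag (wittI W R) n).
Proof. by move=> i j; rewrite mxE; case: eqP => _; [exact: integral1|exact: integral0]. Qed.

Lemma mxint_scalar n a : integral a -> mxint (a%:M : 'M[wittI W R]_n).
Proof.
by move=> ia i j; rewrite mxE; case: eqP => _; [rewrite mulr1n|exact: integral0].
Qed.

Lemma mxint_col m r (M : 'M[wittI W R]_(m, r)) : mxint M <-> forall j, mxint (col j M).
Proof.
by split=> [iM j i c|iM i j]; [rewrite mxE; apply: iM|move: (iM j i 0); rewrite mxE].
Qed.

Lemma mxint_col_mx m1 m2 r (M1 : 'M[wittI W R]_(m1, r)) (M2 : 'M_(m2, r)) :
  mxint (col_mx M1 M2) <-> mxint M1 /\ mxint M2.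
Proof.
split=> [iM|[iM1 iM2] i j].
  by split=> i j; [have := iM (lshift _ i) j|have := iM (rshift _ i) j];
     rewrite ?col_mxEu ?col_mxEd.
by rewrite mxE; case: splitP => i' _; [apply: iM1|apply: iM2].
Qed.

Lemma mxint_row_mx m r1 r2 (M1 : 'M[wittI W R]_(m, r1)) (M2 : 'M_(m, r2)) :
  mxint (row_mx M1 M2) <-> mxint M1 /\ mxint M2.
Proof.
split=> [iM|[iM1 iM2] i j].
  by split=> i j; [have := iM i (lshift _ j)|have := iM i (rshift _ j)];
     rewrite ?row_mxEl ?row_mxEr.
by rewrite mxE; case: splitP => j' _; [apply: iM1|apply: iM2].
Qed.

Lemma incmx_inj m r : injective (map_mx (witt_inc W R) : 'M_(m, r) -> 'M_(m, r)).
Proof.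
by move=> M N /matrixP MN; apply/matrixP => i j; have := MN i j;
  rewrite !mxE => /witt_inc_inj.
Qed.

Lemma witt_red_pi : witt_red W R (witt_str W R pi) = 0.
Proof. by apply/(strict_ker (witt_lift W R)); exists 1; rewrite mulr1. Qed.

Lemma integral_divpi w : integral ((piI W R)^-1 * witt_inc W R w) <-> witt_red W R w = 0.
Proof.
rewrite (strict_ker (witt_lift W R)); split=> [[v _ vE]|[v ->]].
  exists v; apply: (@witt_inc_inj _ _ _ _ W); rewrite rmorphM vE.
  by rewrite mulrA -/(piI W R) divrr ?mul1r ?piI_unit.
by rewrite rmorphM mulKr ?piI_unit //; apply: integral_inc.
Qed.

Lemma mxint_divpi m r (N : 'M[witt W R]_(m, r)) :
  mxint ((piI W R)^-1 *: incmx N) <-> redmx N = 0.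
Proof.
split=> [iN|/matrixP rN i j].
  by apply/matrixP => i j; have := iN i j; rewrite !mxE => /integral_divpi.
by rewrite !mxE; apply/integral_divpi; have := rN i j; rewrite !mxE.
Qed.

Lemma lift_mx m r (P : 'M[R]_(m, r)) : exists Q : 'M_(m, r), redmx Q = P.
Proof.
pose c i j := cid (strict_surj (witt_lift W R) (P i j)).
exists (\matrix_(i, j) projT1 (c i j)).
by apply/matrixP => i j; rewrite !mxE (projT2 (c i j)).
Qed.

Lemma wspan_sub m (E : set 'cV[wittI W R]_m) :
  E 0 -> (forall x y, E x -> E y -> E (x + y)) ->
  (forall a x, integral a -> E x -> E (a *: x)) -> wspan E `<=` E.
Proof.
move=> E0 ED EZ _ [r [a [x [xE ->]]]]; apply: big_ind => // i _.
by apply: EZ; [exact: integral_inc|exact: xE].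
Qed.

Lemma wspan_sum m (E : set 'cV[wittI W R]_m) r (M : 'M[wittI W R]_(m, r))
    (c : 'cV_r) : wspan E `<=` E -> (forall i, E (col i M)) -> mxint c ->
  E (M *m c).
Proof.
move=> Esub EM /mxintP[d ->]; apply: Esub; exists r, (fun i => d i 0), (fun i => col i M).
split=> //; apply/colP => i; rewrite !mxE summxE; apply: eq_bigr => j _.
by rewrite !mxE mulrC.
Qed.
End MxInt.

(** Giving a lattice by functionals rather than by generators makes membership, inclusion and base
    change questions of integrality of matrices, to which [closed_integral] and [geometric_integral]
    apply. *)
Definition lat R m r (phi : 'M[wittI W R]_(r, m)) : set 'cV[wittI W R]_m :=
  [set x | mxint (phi *m x)].

Lemma lat_sub R m r (phi : 'M[wittI W R]_(r, m)) : wspan (lat phi) `<=` lat phi.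
Proof.
apply: wspan_sub => [|x y|a x ia]; rewrite /lat /=.
- by rewrite mulmx0 => i j; rewrite mxE; apply: integral0.
- by rewrite mulmxDr; apply: mxintD.
- by rewrite -scalemxAr; apply: mxintZ.
Qed.

(* e and phi are the two halves of a dual basis. *)
Definition dual_pair R m r (e : 'M[wittI W R]_(m, r)) (phi : 'M_(r, m)) :=
  e *m phi = 1%:M /\ mxint (phi *m e).

Lemma lat_col R m r (e : 'M[wittI W R]_(m, r)) phi i :
  dual_pair e phi -> lat phi (col i e).
Proof. by case=> _ /mxint_col/(_ i); rewrite /lat /= !colE mulmxA. Qed.

Lemma is_latticeP R m (E : set 'cV[wittI W R]_m) : is_lattice E <->
  exists r (e : 'M_(m, r)) phi, dual_pair e phi /\ E = lat phi.
Proof.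
split=> [[Esub [r [e [phi [Ee Ephi eE]]]]]|[r [e [phi [dp ->]]]]].
  pose M : 'M_(m, r) := \matrix_(i, j) e j i 0.
  pose N : 'M_(r, m) := \matrix_(i, j) phi i 0 j.
  have Ncol i x : (N *m x) i 0 = (phi i *m x) 0 0.
    by rewrite !mxE; apply: eq_bigr => j _; rewrite mxE.
  have Mcol i : col i M = e i by apply/colP => j; rewrite !mxE.
  have MN : M *m N = 1%:M.
    apply/matrixP => i j; have /colP/(_ i) := eE (delta_mx j 0).
    rewrite !mxE eqxx andbT => ->; rewrite summxE; apply: eq_bigr => l _.
    by rewrite -Ncol !mxE mulrC (bigD1 j) //= big1 => [|j' /negPf nj];
      rewrite !mxE ?eqxx ?mulr1 ?addr0 // nj mulr0.
  have EP x : E x <-> lat N x.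
    split=> [Ex i j|Nx]; first by rewrite ord1 Ncol; apply: Ephi.
    rewrite -[x]mul1mx -MN -mulmxA; apply: wspan_sum => // i.
    by rewrite Mcol.
  exists r, M, N; split; last by apply/seteqP; split=> x /EP.
  split=> //; apply/mxint_col => j; rewrite colE -mulmxA -(colE j M) Mcol.
  exact/EP.
split; first exact: lat_sub.
exists r, (fun i => col i e), (fun i => row i phi); split=> [i|i x phix|x].
- exact: lat_col.
- by rewrite -row_mul mxE; apply: phix.
- rewrite -{1}[x]mul1mx -dp.1 -mulmxA; apply/colP => i; rewrite !mxE summxE.
  by apply: eq_bigr => j _; rewrite -row_mul !mxE mulrC.
Qed.

Lemma lat_is_lattice R m r (e : 'M[wittI W R]_(m, r)) phi :
  dual_pair e phi -> is_lattice (lat phi).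
Proof. by move=> dp; apply/is_latticeP; exists r, e, phi. Qed.

Lemma mxint_fmx R S (f : perfHom R S) m r (M : 'M[wittI W R]_(m, r)) :
  mxint M -> mxint (fmx f M).
Proof. by move=> iM i j; rewrite mxE; apply: integral_map. Qed.

Lemma dual_pair_pull R S (f : perfHom R S) m r (e : 'M[wittI W R]_(m, r)) phi :
  dual_pair e phi -> dual_pair (fmx f e) (fmx f phi).
Proof.
move=> [ephi phie]; split; first by rewrite -map_mxM ephi map_mx1.
by rewrite -map_mxM; apply: mxint_fmx.
Qed.

(** A dual basis stays one after base change, and expresses each x on the right through the images
    of the columns of e, with coefficients the entries of [fmx f phi *m x]. *)
Lemma lat_pullE R S (f : perfHom R S) m r (e : 'M[wittI W R]_(m, r)) phi :
  dual_pair e phi -> lat_pull f (lat phi) = lat (fmx f phi).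
Proof.
move=> dp; apply/seteqP; split=> [_ [q [a [x [xE ->]]]]|x phix].
  apply: lat_sub; exists q, a, x; split=> // i.
  have [y phiy <-] := xE i; rewrite /lat /= -map_mxM; exact: mxint_fmx.
have [ephi _] := dual_pair_pull f dp.
have /mxintP[d dE] : mxint (fmx f phi *m x) := phix.
exists r, (fun i => d i 0), (fun i => fmx f (col i e)); split=> [i|].
  by exists (col i e) => //; apply: lat_col.
rewrite -[x]mul1mx -ephi -mulmxA dE; apply/colP => i.
by rewrite !mxE summxE; apply: eq_bigr => j _; rewrite !mxE mulrC.
Qed.

Lemma lat_pull_comp R S T (f : perfHom R S) (g : perfHom S T) (h : perfHom R T)
    m (E : set 'cV[wittI W R]_m) : h =1 g \o f -> is_lattice E ->
  lat_pull h E = lat_pull g (lat_pull f E).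
Proof.
move=> hgf /is_latticeP[r [e [phi [dp ->]]]].
rewrite (lat_pullE h dp) (lat_pullE f dp) (lat_pullE g (dual_pair_pull f dp)).
congr lat; apply/matrixP => i j; rewrite !mxE.
exact: wittI_map_comp.
Qed.

Lemma lat_pull_id R (f : perfHom R R) m (E : set 'cV[wittI W R]_m) :
  f =1 id -> is_lattice E -> lat_pull f E = E.
Proof.
move=> fid /is_latticeP[r [e [phi [dp ->]]]]; rewrite (lat_pullE f dp).
by congr lat; apply/matrixP => i j; rewrite !mxE wittI_map_id.
Qed.

Lemma lat_pull_lattice R S (f : perfHom R S) m (E : set 'cV[wittI W R]_m) :
  is_lattice E -> is_lattice (lat_pull f E).
Proof.
move=> /is_latticeP[r [e [phi [dp ->]]]]; rewrite (lat_pullE f dp).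
exact: lat_is_lattice (dual_pair_pull f dp).
Qed.

Lemma dual_pair1 R m : dual_pair (1%:M : 'M[wittI W R]_m) 1%:M.
Proof. by rewrite /dual_pair mulmx1; split=> //; apply: mxint_scalar; apply: integral1. Qed.

Lemma std_latticeE R m : @std_lattice _ _ _ _ W m R = lat 1%:M.
Proof.
apply/seteqP; split=> x; rewrite /lat /std_lattice /= mul1mx => ix i.
  by move=> j; rewrite ord1.
exact: ix.
Qed.

Lemma std_pull R S (f : perfHom R S) m :
  lat_pull f (@std_lattice _ _ _ _ W m R) = @std_lattice _ _ _ _ W m S.
Proof. by rewrite !std_latticeE (lat_pullE f (dual_pair1 R m)) map_mx1. Qed.

Lemma bilE (A : comNzRingType) n (x y : 'cV[A]_n) :
  (bil x y)%:M = x^T *m antidiag A n *m y :> 'M_1.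
Proof.
apply/matrixP => i j; rewrite !ord1 !mxE mulr1n /bil.
rewrite (reindex_inj rev_ord_inj) /=; apply: eq_bigr => l _; rewrite rev_ordK.
rewrite !mxE (bigD1 (rev_ord l)) //= !mxE rev_ordK eqxx mulr1 big1 ?addr0 //.
by move=> l' /negPf nl; rewrite !mxE -(inj_eq rev_ord_inj) rev_ordK eq_sym nl mulr0.
Qed.

Lemma antidiagK (A : comNzRingType) n : antidiag A n *m antidiag A n = 1%:M.
Proof.
apply/matrixP => i j; rewrite !mxE (bigD1 (rev_ord i)) //= !mxE eqxx mul1r rev_ordK.
by rewrite eq_sym big1 ?addr0 // => l /negPf nl; rewrite !mxE nl mul0r.
Qed.

Lemma antidiag_tr (A : comNzRingType) n : (antidiag A n)^T = antidiag A n.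
Proof. by apply/matrixP => i j; rewrite !mxE -(inj_eq rev_ord_inj) rev_ordK eq_sym. Qed.

Lemma map_antidiag (A B : comNzRingType) (f : {rmorphism A -> B}) n :
  map_mx f (antidiag A n) = antidiag B n.
Proof. by apply/matrixP => i j; rewrite !mxE rmorph_nat. Qed.

(** It suffices to pair y with the generators of the lattice, the columns of e. *)
Lemma lat_dualE R n r (e : 'M[wittI W R]_(n, r)) phi :
  dual_pair e phi -> lat_dual (lat phi) = lat (e^T *m antidiag _ n).
Proof.
move=> dp; have [ephi phie] := dp.
apply/seteqP; split=> y; rewrite /lat_dual /lat_hom std_latticeE /lat /=.
  move=> yE i j; rewrite ord1; have := yE _ (lat_col i dp) 0 0.
  by rewrite mul1mx bilE tr_col -!row_mul mxE.
move=> ey x phix; rewrite mul1mx bilE.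
have -> : x = e *m (phi *m x) by rewrite mulmxA ephi mul1mx.
rewrite trmx_mul -!mulmxA; apply: mxintM; first exact: mxint_tr.
by rewrite mulmxA.
Qed.

Lemma dual_pair_dual R n r (e : 'M[wittI W R]_(n, r)) phi : dual_pair e phi ->
  dual_pair (antidiag _ n *m phi^T) (e^T *m antidiag _ n).
Proof.
move=> [ephi phie]; split.
  by rewrite -mulmxA (mulmxA phi^T) -trmx_mul ephi trmx1 mul1mx antidiagK.
rewrite -mulmxA (mulmxA (antidiag _ _)) antidiagK mul1mx -trmx_mul.
exact: mxint_tr.
Qed.
End Lattices.

(** * Lattices between pi W^m and W^m *)

Section ReductionLattices.
Context (O : idomainType) (pi : O) (k : finFieldType)
  (red : {rmorphism O -> k}) (W : wittFunctor pi red).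
Implicit Types R S : perfAlg k.
Local Notation incmx := (map_mx (witt_inc W _)).
Local Notation redmx := (map_mx (witt_red W _)).
Local Notation fmx f := (map_mx (wittI_map W f)).

Definition scale_set (A : comNzRingType) m (a : A) (E : set 'cV[A]_m) :=
  [set a *: y | y in E].

Lemma scale_lat R m r a (phi : 'M[wittI W R]_(r, m)) : a \is a GRing.unit ->
  scale_set a (lat phi) = lat (a^-1 *: phi).
Proof.
move=> ua; apply/seteqP; split=> [_ [y phiy <-]|x phix].
  by rewrite /lat /= -scalemxAl -scalemxAr scalerA mulVr // scale1r.
exists (a^-1 *: x); last by rewrite scalerA mulrV // scale1r.
by move: phix; rewrite /lat /= -scalemxAl -scalemxAr.
Qed.

Lemma dual_pair_scale R m r a (e : 'M[wittI W R]_(m, r)) phi :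
  a \is a GRing.unit -> dual_pair e phi -> dual_pair (a *: e) (a^-1 *: phi).
Proof.
move=> ua [ephi phie]; split.
  by rewrite -scalemxAl -scalemxAr scalerA mulrV // scale1r.
by rewrite -scalemxAl -scalemxAr scalerA mulVr // scale1r.
Qed.

Lemma lat_pull_scale R S (f : perfHom R S) m a (E : set 'cV[wittI W R]_m) :
  a \is a GRing.unit -> is_lattice E ->
  lat_pull f (scale_set a E) = scale_set (wittI_map W f a) (lat_pull f E).
Proof.
move=> ua /is_latticeP[r [e [phi [dp ->]]]].
rewrite scale_lat // (lat_pullE f (dual_pair_scale ua dp)) (lat_pullE f dp).
rewrite scale_lat ?rmorph_unit // map_mxZ rmorphV //.
Qed.

Lemma scale_set_lattice R m a (E : set 'cV[wittI W R]_m) :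
  a \is a GRing.unit -> is_lattice E -> is_lattice (scale_set a E).
Proof.
move=> ua /is_latticeP[r [e [phi [dp ->]]]].
by rewrite scale_lat //; apply: lat_is_lattice (dual_pair_scale ua dp).
Qed.

Lemma scale_setK (A : comUnitRingType) m (a : A) (E : set 'cV[A]_m) :
  a \is a GRing.unit -> scale_set a (scale_set a^-1 E) = E.
Proof.
move=> ua; apply/seteqP; split=> [_ [_ [y Ey <-] <-]|y Ey].
  by rewrite scalerA mulrV // scale1r.
by exists (a^-1 *: y); [exists y|rewrite scalerA mulrV // scale1r].
Qed.

Definition LP R m (P : 'M[R]_m) : set 'cV[wittI W R]_m :=
  [set x | exists2 w, x = incmx w & P *m redmx w = 0].

(** For Q lifting an idempotent P, the functionals express that x and Q x / pi are integral, and
    [LP_e] gives the generators 1 - Q and pi. The lift itself need not be idempotent: only Q (1 - Q)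
    / pi has to be integral. *)
Definition LP_phi R m (Q : 'M[witt W R]_m) : 'M[wittI W R]_(m + m, m) :=
  col_mx 1%:M ((piI W R)^-1 *: incmx Q).

Definition LP_e R m (Q : 'M[witt W R]_m) : 'M[wittI W R]_(m, m + m) :=
  row_mx (1%:M - incmx Q) (piI W R)%:M.

Lemma LP_dual_pair R m (Q : 'M[witt W R]_m) :
  redmx Q *m redmx Q = redmx Q -> dual_pair (LP_e Q) (LP_phi Q).
Proof.
move=> QQ; split.
  rewrite mul_row_col mulmx1 mul_scalar_mx scalerA mulrV ?piI_unit // scale1r.
  by rewrite subrK.
rewrite mul_col_row mul1mx mul1mx -scalemxAl -scalemxAl mul_mx_scalar scalerA.
rewrite mulVr ?piI_unit // scale1r.
apply/mxint_col_mx; split; apply/mxint_row_mx; split.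
- by apply/mxintP; exists (1%:M - Q); rewrite map_mxB map_mx1.
- exact/mxint_scalar/integral_pi.
- have -> : incmx Q *m (1%:M - incmx Q) = incmx (Q *m (1%:M - Q)).
    by rewrite map_mxM map_mxB map_mx1.
  apply/mxint_divpi.
  by rewrite map_mxM map_mxB map_mx1 mulmxBr mulmx1 QQ subrr.
- exact: mxint_inc.
Qed.

Lemma LP_latE R m (Q : 'M[witt W R]_m) : LP (redmx Q) = lat (LP_phi Q).
Proof.
have phiE x : LP_phi Q *m x = col_mx x ((piI W R)^-1 *: (incmx Q *m x)).
  by rewrite mul_col_mx mul1mx scalemxAl.
apply/seteqP; split=> x; rewrite /lat /= phiE.
  case=> w -> Qw; apply/mxint_col_mx; split; first exact: mxint_inc.
  by rewrite -map_mxM; apply/mxint_divpi; rewrite map_mxM.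
case/mxint_col_mx => /mxintP[w ->]; rewrite -map_mxM => /mxint_divpi Qw.
by exists w => //; rewrite -map_mxM.
Qed.

Lemma LP_lattice R m (P : 'M[R]_m) : P *m P = P -> is_lattice (LP P).
Proof.
have [Q <-] := lift_mx W P => QQ.
by rewrite LP_latE; apply: lat_is_lattice (LP_dual_pair QQ).
Qed.

Lemma redmx_map R S (f : perfHom R S) m r (Q : 'M[witt W R]_(m, r)) :
  redmx (map_mx (witt_map W f) Q) = map_mx f (redmx Q).
Proof. by apply/matrixP => i j; rewrite !mxE witt_map_red. Qed.

Lemma fmx_inc R S (f : perfHom R S) m r (Q : 'M[witt W R]_(m, r)) :
  fmx f (incmx Q) = incmx (map_mx (witt_map W f) Q).
Proof. by apply/matrixP => i j; rewrite !mxE wittI_map_inc. Qed.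

Lemma LP_pull R S (f : perfHom R S) m (P : 'M[R]_m) : P *m P = P ->
  lat_pull f (LP P) = LP (map_mx f P).
Proof.
have [Q <-] := lift_mx W P => QQ.
rewrite LP_latE (lat_pullE f (LP_dual_pair QQ)) -redmx_map LP_latE; congr lat.
rewrite /LP_phi map_col_mx map_mx1 map_mxZ fmx_inc rmorphV ?piI_unit //.
by rewrite wittI_map_pi.
Qed.

Lemma LP_sub R m (P P' : 'M[R]_m) : P *m P = P ->
  LP P `<=` LP P' <-> P' *m (1%:M - P) = 0.
Proof.
move=> PP; split=> [sub|P'P x [w -> Pw]]; last first.
  exists w => //; have -> : redmx w = (1%:M - P) *m redmx w.
    by rewrite mulmxBl mul1mx Pw subr0.
  by rewrite mulmxA P'P mul0mx.
apply/matrixP => i j; have [w wE] := lift_mx W (col j (1%:M - P)).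
have /sub[w' /incmx_inj <-] : LP P (incmx w).
  exists w => //; rewrite wE colE mulmxA mulmxBr mulmx1 PP subrr.
  by rewrite mul0mx.
by rewrite wE colE mulmxA -colE => /colP/(_ i); rewrite !mxE.
Qed.

Lemma LP_sub_std R m (P : 'M[R]_m) : LP P `<=` @std_lattice _ _ _ _ W m R.
Proof. by move=> _ [w -> _] i; rewrite mxE; apply: integral_inc. Qed.

(** For idempotent P, this is an idempotent whose kernel is the orthogonal complement of the kernel
    of P for the form [bil]; that complement is the image of J P^T J with J the antidiagonal
    matrix. *)
Definition perp_mx (A : comNzRingType) n (P : 'M[A]_n) : 'M[A]_n :=
  1%:M - antidiag A n *m P^T *m antidiag A n.

Lemma perp_mx_idem (A : comNzRingType) n (P : 'M[A]_n) :
  P *m P = P -> perp_mx P *m perp_mx P = perp_mx P.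
Proof.
move=> PP; rewrite /perp_mx; set Q := _ *m _ *m _.
have QQ : Q *m Q = Q.
  rewrite /Q -!mulmxA (mulmxA (antidiag A n) (antidiag A n)) antidiagK mul1mx.
  by rewrite (mulmxA P^T) -trmx_mul PP.
by rewrite mulmxBl mul1mx mulmxBr mulmx1 QQ subrr subr0.
Qed.

Lemma map_perp_mx (A B : comNzRingType) (f : {rmorphism A -> B}) n (P : 'M[A]_n) :
  map_mx f (perp_mx P) = perp_mx (map_mx f P).
Proof. by rewrite /perp_mx map_mxB map_mx1 !map_mxM -matrix.map_trmx !map_antidiag. Qed.

(** Pairing with the generators pi of [LP P] says that pi y is integral; pairing with the generators
    1 - Q says that the reduction of pi y is orthogonal to the kernel of P. *)
Lemma lat_dual_LP R n (P : 'M[R]_n) : P *m P = P ->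
  lat_dual (LP P) = scale_set (piI W R)^-1 (LP (perp_mx P)).
Proof.
have [Q <-] := lift_mx W P => QQ; have dp := LP_dual_pair QQ.
rewrite LP_latE (lat_dualE dp).
have upi := piI_unit W R.
have perpE (w : 'cV[witt W R]_n) : perp_mx (redmx Q) *m redmx w = 0 <->
    mxint ((piI W R)^-1 *: incmx ((1%:M - Q)^T *m antidiag _ n *m w)).
  rewrite mxint_divpi !map_mxM -matrix.map_trmx map_mxB map_mx1 map_antidiag.
  set J := antidiag R n; set P' := redmx Q.
  have JJ : J *m J = 1%:M := antidiagK _ _.
  have -> : perp_mx P' = J *m ((1%:M - P')^T *m J).
    by rewrite raddfB /= trmx1 mulmxBl mul1mx mulmxBr JJ mulmxA.
  split=> [h|h]; last by rewrite -!mulmxA in h *; rewrite h mulmx0.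
  have := congr1 (mulmx J) h; rewrite mulmx0 !mulmxA JJ mul1mx.
  by [].
have eE (y : 'cV[wittI W R]_n) : (LP_e Q)^T *m antidiag _ n *m y =
    col_mx ((1%:M - incmx Q)^T *m antidiag _ n *m y)
           (antidiag _ n *m (piI W R *: y)).
  rewrite tr_row_mx !mul_col_mx; congr col_mx.
  by rewrite tr_scalar_mx mul_scalar_mx -scalemxAl scalemxAr.
have incE w : (1%:M - incmx Q)^T *m antidiag _ n *m ((piI W R)^-1 *: incmx w) =
    (piI W R)^-1 *: incmx ((1%:M - Q)^T *m antidiag _ n *m w).
  by rewrite -scalemxAr !map_mxM -matrix.map_trmx map_mxB map_mx1 map_antidiag.
apply/seteqP; split=> [y|_ [_ [w -> Pw] <-]]; rewrite /lat /= eE.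
  case/mxint_col_mx=> iy ipy.
  have /mxintP[w wE] : mxint (piI W R *: y).
    rewrite -[_ *: y]mul1mx -(antidiagK _ n) -mulmxA.
    by apply: mxintM; [exact: mxint_antidiag|].
  have yE : y = (piI W R)^-1 *: incmx w by rewrite -wE scalerA mulVr // scale1r.
  exists (incmx w) => //; exists w => //.
  by apply/perpE; rewrite -incE -yE.
apply/mxint_col_mx; split; first by rewrite incE; apply/perpE.
rewrite scalerA mulrV // scale1r; apply: mxintM; first exact: mxint_antidiag.
exact: mxint_inc.
Qed.

Definition frobmx (R : perfAlg k) m r (P : 'M[R]_(m, r)) : 'M[R]_(m, r) :=
  map_mx (frob_hom R) P.

Lemma frob_dual_LP R n (P : 'M[R]_n) : P *m P = P ->
  lat_frob (lat_dual (LP P)) = scale_set (piI W R)^-1 (LP (perp_mx (frobmx P))).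
Proof.
move=> PP; rewrite lat_dual_LP // /lat_frob lat_pull_scale ?unitrV ?piI_unit //; last first.
  by apply: LP_lattice; apply: perp_mx_idem.
rewrite rmorphV ?piI_unit // wittI_map_pi LP_pull ?perp_mx_idem //.
by rewrite map_perp_mx.
Qed.
End ReductionLattices.
Arguments LP {O pi k red} W {R m} P.

(** * Matrices of constant rank over reduced rings *)

Lemma exists_minor (F : fieldType) m r (a : 'M[F]_(m, r)) :
  exists (g : 'I_(\rank a) -> 'I_m) (h : 'I_(\rank a) -> 'I_r),
    \det (mxsub g h a) != 0.
Proof.
pose B := rowsub (maxrankfun a) a.
have Bfull : row_full B^T by rewrite /row_full mxrank_tr; apply: maxrowsub_free.
exists (maxrankfun a), (fullrankfun Bfull).
have := fullrowsub_full Bfull; rewrite row_full_unit unitmxE unitfE.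
rewrite -det_tr; congr (\det _ != 0); apply/matrixP => i j.
by rewrite !mxE.
Qed.

(** If D = G a H is invertible, the rows of G a span those of a, and H D^-1 G is a pseudo-inverse of
    a. Multiplying by det D twice gives an identity without denominators that also holds for det D =
    0, so that it can be transferred from geometric points to a reduced ring. *)
Lemma minor_pseudo_inverse (F : fieldType) m r s (a : 'M[F]_(m, r))
    (G : 'M_(s, m)) (H : 'M_(r, s)) : (\rank a <= s)%N ->
  \det (G *m a *m H) *: (a *m (H *m \adj (G *m a *m H) *m G) *m a
    - \det (G *m a *m H) *: a) = 0.
Proof.
move=> ra; set D := G *m a *m H.
have [->|d0] := eqVneq (\det D) 0; first by rewrite scale0r.
have uD : D \in unitmx by rewrite unitmxE unitfE.
have adjE : \adj D = \det D *: invmx D.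
  by rewrite /invmx uD scalerA divff // scale1r.
have rGa : \rank (G *m a) = s.
  apply/eqP; rewrite eqn_leq rank_leq_row /=.
  by have := mxrankM_maxl (G *m a) H; rewrite mxrank_unit.
have /submxP[X aE] : (a <= G *m a)%MS.
  have := mxrank_leqif_sup (submxMl G a); rewrite rGa => -[h].
  by rewrite eqn_leq ra (leq_trans _ h) // => <-.
suff -> : a *m (H *m \adj D *m G) *m a = \det D *: a by rewrite subrr scaler0.
rewrite adjE -scalemxAr -scalemxAl -scalemxAr -scalemxAl; congr (_ *: _).
transitivity (X *m (D *m invmx D *m (G *m a))).
  by rewrite {1}aE /D !mulmxA.
by rewrite mulmxV // mul1mx -aE.
Qed.

Section Geometric.
Context (k : finFieldType) (kbar : closedFieldType) (iota : {rmorphism k -> kbar}).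
Implicit Types R : perfAlg kbar.

Definition geom_rank R m r (a : 'M[R]_(m, r)) (s : nat) :=
  forall (Om : closedFieldType) (t : {rmorphism kbar -> Om})
    (f : perfHom R (geom t)), \rank (map_mx f a : 'M[Om]_(m, r)) = s.

Lemma geometric_mx0 R m r (a : 'M[R]_(m, r)) :
  (forall (Om : closedFieldType) (t : {rmorphism kbar -> Om})
    (f : perfHom R (geom t)), map_mx f a = 0) -> a = 0.
Proof.
move=> a0; apply/matrixP => i j; rewrite mxE.
apply: (geometric_eq0 iota) => Om t f; have /matrixP/(_ i j) := a0 Om t f.
by rewrite !mxE.
Qed.

(** The scalars f for which f a has the form a b a make up an ideal. Were it proper, it would vanish
    at a geometric point, where some minor of size s does not; but the squares of these minors
    belong to the ideal. *)
Lemma geom_pseudo_inverse R m r (a : 'M[R]_(m, r)) s :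
  geom_rank a s -> exists b, a *m b *m a = a.
Proof.
move=> ra; pose J := [set f : R | exists b, a *m b *m a = f *: a].
suff [b bE] : J 1 by exists b; rewrite bE scale1r.
apply: contrapT => J1; have [|//|Om [t [f fJ]]] := @geometric_point _ R J.
  split=> [|x y [b bE] [c cE]|x y [b bE]].
  - by exists 0; rewrite mulmx0 mul0mx scale0r.
  - by exists (b + c); rewrite mulmxDr mulmxDl bE cE scalerDl.
  - by exists (x *: b); rewrite -scalemxAr -scalemxAl bE scalerA.
have := exists_minor (map_mx f a : 'M[Om]_(m, r)); rewrite ra => -[g [h]].
apply/negP; rewrite negbK; apply/eqP.
pose G : 'M[R]_(s, m) := rowsub g 1%:M; pose H : 'M[R]_(r, s) := colsub h 1%:M.
pose D := G *m a *m H.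
have DE : D = mxsub g h a.
  by rewrite /D mul_rowsub_mx mul1mx mulmx_colsub mulmx1; apply/matrixP => i j; rewrite !mxE.
(* The square comes from the two factors det D in [minor_pseudo_inverse]. *)
have : f (\det D ^+ 2) = 0.
  apply: fJ; exists (\det D *: (H *m \adj D *m G)).
  apply/eqP; rewrite -subr_eq0 -scalemxAr -scalemxAl expr2 -scalerA -scalerBr.
  apply/eqP; apply: geometric_mx0 => Om' t' f'.
  rewrite map_mxZ map_mxB map_mxZ !map_mxM map_mx_adj -det_map_mx !map_mxM.
  by apply: minor_pseudo_inverse; rewrite ra.
rewrite rmorphXn => /eqP; rewrite expf_eq0 /= => /eqP.
by rewrite DE -det_map_mx map_mxsub.
Qed.

Lemma idem_rankC (F : fieldType) m (P : 'M[F]_m) : P *m P = P ->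
  (\rank P + \rank (1%:M - P)%R)%N = m.
Proof.
move=> PP; apply/eqP; rewrite eqn_leq mulmx0_rank_max; last first.
  by rewrite mulmxBr mulmx1 PP subrr.
rewrite -[X in (X <= _)%N](mxrank1 F m).
have {1}-> : 1%:M = P + (1%:M - P)%R :> 'M[F]_m by rewrite addrC subrK.
exact: mxrank_add.
Qed.
End Geometric.

Section GeometricLattices.
Context (O : idomainType) (pi : O) (k : finFieldType)
  (red : {rmorphism O -> k}) (W : wittFunctor pi red)
  (kbar : closedFieldType) (iota : {rmorphism k -> kbar}).
Local Notation incmx := (map_mx (witt_inc W _)).
Local Notation redmx := (map_mx (witt_red W _)).
Local Notation fmx f := (map_mx (wittI_map W f)).

Lemma LP_gens (R : perfAlg k) m r (e0 : 'M[witt W R]_(m, r)) phi (P : 'M[R]_m) :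
  dual_pair (incmx e0) phi -> P *m P = P -> lat phi = LP W P ->
  P *m redmx e0 = 0 /\ exists b, 1%:M - P = redmx e0 *m b.
Proof.
move=> dp PP phiE; split.
  apply/matrixP => i j; have : LP W P (col j (incmx e0)).
    by rewrite -phiE; apply: lat_col.
  case=> w; rewrite -map_col => /incmx_inj <- /colP/(_ i).
  by rewrite map_col colE mulmxA -colE !mxE.
have [Q QE] := lift_mx W (1%:M - P).
have /mxintP[c cE] : mxint (phi *m incmx Q).
  apply/mxint_col => j; rewrite colE -mulmxA -colE.
  have : LP W P (col j (incmx Q)).
    exists (col j Q); first by rewrite map_col.
    by rewrite map_col QE colE mulmxA -colE mulmxBr mulmx1 PP subrr colE mul0mx.
  by rewrite -phiE.
exists (redmx c); rewrite -QE -map_mxM; congr (redmx _); apply: incmx_inj.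
by rewrite map_mxM -cE mulmxA dp.1 mul1mx.
Qed.

(* R is reduced, so constant rank at the geometric points yields a direct
   summand of R^m. *)
Lemma geometric_LP (R : perfAlg kbar) m s (E : set 'cV[wittI W (restr iota R)]_m) :
  is_lattice E ->
  (forall (Om : closedFieldType) (t : {rmorphism kbar -> Om})
     (f : perfHom R (geom t)), exists P : 'M[restr iota (geom t)]_m,
     [/\ P *m P = P, \rank (P : 'M[Om]_m) = s &
         lat_pull (restr_hom iota f) E = LP W P]) ->
  exists P : 'M[R]_m, [/\ P *m P = P, geom_rank P s & E = LP W (P : 'M[restr iota R]_m)].
Proof.
move=> /is_latticeP[r [e [phi [dp ->]]]] geomE.
have /mxintP[e0 eE] : mxint e.
  move=> i j; apply: geometric_integral => Om t f.
  have [P [PP _]] := geomE Om t f; rewrite (lat_pullE _ dp) => LE.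
  have : LP W P (col j (fmx (restr_hom iota f) e)).
    by rewrite -LE; apply: lat_col (dual_pair_pull _ dp).
  by move/LP_sub_std => /(_ i); rewrite !mxE.
(* This says that the lattice contains pi W^m, which holds at the geometric points. *)
have /mxintP[psi psiE] : mxint (piI W (restr iota R) *: phi).
  move=> i j; apply: geometric_integral => Om t f.
  have [P [PP _]] := geomE Om t f; rewrite (lat_pullE _ dp) => LE.
  have : LP W P (piI W _ *: delta_mx j 0).
    exists (witt_str W _ pi *: delta_mx j 0); first by rewrite map_mxZ map_delta_mx.
    by rewrite map_mxZ witt_red_pi scale0r mulmx0.
  rewrite -LE => /(_ i 0).
  by rewrite -scalemxAr -colE !mxE rmorphM wittI_map_pi.
subst e; have := dp => -[ephi phie].
(* At each geometric point the reduced generators span the kernel of an idempotent of rank s. *)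
have rke : geom_rank (redmx e0 : 'M[R]_(m, r)) (m - s).
  move=> Om t f; have [P [PP Pr]] := geomE Om t f; rewrite (lat_pullE _ dp) => LE.
  have := dual_pair_pull (restr_hom iota f) dp; rewrite fmx_inc => dpf.
  have [Pe [b bE]] := LP_gens dpf PP LE.
  have := redmx_map (restr_hom iota f) e0 => /= eE; rewrite eE in Pe bE.
  have := idem_rankC (PP : (P : 'M[Om]_m) *m P = P); rewrite Pr => mE.
  have sm : (s <= m)%N by rewrite -Pr; exact: rank_leq_row.
  apply/eqP; rewrite eqn_leq; apply/andP; split.
    have := mulmx0_rank_max (Pe : (P : 'M[Om]_m) *m _ = 0); rewrite Pr.
    by rewrite leq_subRL.
  have -> : (m - s)%N = \rank (1%:M - (P : 'M[Om]_m))%R.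
    by apply/eqP; rewrite -(eqn_add2l s) mE subnKC.
  rewrite (bE : 1%:M - (P : 'M[Om]_m) = _ *m b).
  exact: mxrankM_maxl.
have [b ebe] := geom_pseudo_inverse iota rke.
(* Q projects onto the image of the lattice in R^m, which is to be the kernel of the idempotent
   sought, namely 1 - Q. *)
pose Q : 'M[R]_m := redmx e0 *m b.
have QQ : Q *m Q = Q by rewrite /Q mulmxA ebe.
have PP : (1%:M - Q) *m (1%:M - Q) = 1%:M - Q.
  by rewrite mulmxBl mul1mx mulmxBr mulmx1 QQ subrr subr0.
exists (1%:M - Q); split=> // [Om t f|].
  have [P [PP' Pr _]] := geomE Om t f.
  have sm : (s <= m)%N by rewrite -Pr rank_leq_row.
  have : (map_mx f Q : 'M[Om]_m) *m map_mx f Q = map_mx f Q by rewrite -map_mxM QQ.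
  move/idem_rankC; rewrite map_mxB map_mx1.
  have -> : \rank (map_mx f Q : 'M[Om]_m) = (m - s)%N.
    have QE : map_mx f Q = map_mx f (redmx e0 : 'M[R]_(m, r)) *m map_mx f b.
      by rewrite -map_mxM.
    have eE : map_mx f (redmx e0 : 'M[R]_(m, r)) =
        map_mx f Q *m map_mx f (redmx e0 : 'M[R]_(m, r)).
      by rewrite -map_mxM /Q ebe.
    apply/eqP; rewrite eqn_leq; apply/andP; split.
      rewrite -(rke Om t f) QE; exact: (@mxrankM_maxl Om).
    rewrite -(rke Om t f) eE; exact: (@mxrankM_maxl Om).
  by move=> h; apply/eqP; rewrite -(eqn_add2l (m - s)) h subnK.
apply/seteqP; split=> x.
  move=> /mxintP[d dE].
  exists (e0 *m d); first by rewrite map_mxM -dE mulmxA ephi mul1mx.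
  by rewrite map_mxM mulmxA mulmxBl mul1mx ebe subrr mul0mx.
case=> w -> /eqP; rewrite mulmxBl mul1mx subr_eq0 => /eqP wE.
have [v vE] := lift_mx W ((b : 'M[restr iota R]__) *m redmx w).
have : redmx (w - e0 *m v) = 0.
  by rewrite map_mxB map_mxM vE mulmxA -wE subrr.
move/mxint_divpi => /mxintP[u uE].
have -> : incmx w = incmx e0 *m incmx v + piI W _ *: incmx u.
  rewrite -uE scalerA mulrV ?piI_unit // scale1r map_mxB map_mxM.
  by rewrite addrC subrK.
rewrite /lat /= mulmxDr mulmxA -scalemxAr scalemxAl psiE.
apply: mxintD; first by apply: mxintM => //; apply: mxint_inc.
by apply: mxintM; apply: mxint_inc.
Qed.
End GeometricLattices.

(** * Loop groups *)

Section UnitaryPairs.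
Context (A : comNzRingType) (n : nat).
Local Notation J := (antidiag A n).

Definition pair_mx (g1 g2 : 'M[A]_n) : 'M[(A * A)%type]_n :=
  \matrix_(i, j) (g1 i j, g2 i j).

Lemma pair_mx_fst g1 g2 : map_mx fst (pair_mx g1 g2) = g1.
Proof. by apply/matrixP => i j; rewrite !mxE. Qed.
Lemma pair_mx_snd g1 g2 : map_mx snd (pair_mx g1 g2) = g2.
Proof. by apply/matrixP => i j; rewrite !mxE. Qed.

Lemma pair_mx_inj (g h : 'M[(A * A)%type]_n) :
  map_mx fst g = map_mx fst h -> map_mx snd g = map_mx snd h -> g = h.
Proof.
move=> /matrixP g1 /matrixP g2; apply/matrixP => i j.
have := g1 i j; have := g2 i j; rewrite !mxE.
by case: (g i j) (h i j) => ? ? [? ?] /= -> ->.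
Qed.

(** The two components of the unitary condition are transposes of each other, J being symmetric, so
    one of them suffices. *)
Lemma GUP (g : 'M[(A * A)%type]_n) (c : A) : GU (g, c) <->
  (map_mx snd g)^T *m J *m map_mx fst g = c *: J /\ exists c', c * c' = 1.
Proof.
pose f1 : {rmorphism (A * A)%type -> A} := fst.
pose f2 : {rmorphism (A * A)%type -> A} := snd.
have swap1 : map_mx f1 (map_mx (@pswap A) g)^T = (map_mx snd g)^T.
  by apply/matrixP => i j; rewrite !mxE.
have swap2 : map_mx f2 (map_mx (@pswap A) g)^T = (map_mx fst g)^T.
  by apply/matrixP => i j; rewrite !mxE.
rewrite /GU /=; split=> -[gc cu]; split=> //.
  have := congr1 (map_mx f1) gc; rewrite map_mxZ !map_mxM swap1.
  by rewrite !map_antidiag.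
apply: pair_mx_inj.
  have := map_mxZ f1 ((c, c) : (A * A)%type) (antidiag _ n) => /= ->.
  have := map_mxM f1 => /= h; rewrite !h; rewrite swap1.
  have := map_antidiag f1 n => /= ->.
  exact: gc.
have := map_mxZ f2 ((c, c) : (A * A)%type) (antidiag _ n) => /= ->.
have := map_mxM f2 => /= h; rewrite !h; rewrite swap2.
have := map_antidiag f2 n => /= ->.
by move: (congr1 trmx gc); rewrite !trmx_mul trmxK linearZ /= antidiag_tr mulmxA.
Qed.
End UnitaryPairs.

Section LoopGroups.
Context (O : idomainType) (pi : O) (k : finFieldType)
  (red : {rmorphism O -> k}) (W : wittFunctor pi red) (R : perfAlg k) (n : nat).
Local Notation L := (loop W n R).
Local Notation J := (antidiag (wittI W R) n).
Local Notation incmx := (map_mx (witt_inc W R)).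

Definition loop1 (g : L) : 'M[wittI W R]_n := map_mx fst g.1.
Definition loop2 (g : L) : 'M[wittI W R]_n := map_mx snd g.1.

Lemma loop_ext (g h : L) :
  loop1 g = loop1 h -> loop2 g = loop2 h -> g.2 = h.2 -> g = h.
Proof.
by case: g h => [g c] [h d] gh1 gh2 /= ->; congr (_, _); apply: pair_mx_inj.
Qed.

Lemma LGP (g : L) : LG g <->
  (loop2 g)^T *m J *m loop1 g = g.2 *: J /\ g.2 \is a GRing.unit.
Proof.
case: g => g c; rewrite /LG GUP; split=> -[gc cu]; split=> //.
  by case: cu => c' cc'; apply/unitrP; exists c'; rewrite mulrC.
by exists c^-1; rewrite mulrV.
Qed.

Lemma J_unit : J \in unitmx.
Proof. by have /mulmx1_unit[] := antidiagK (wittI W R) n. Qed.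

Lemma LG_unit (g : L) : LG g -> loop1 g \in unitmx.
Proof.
case/LGP => gE cu; have : g.2 *: J \in unitmx by rewrite unitmxZ // J_unit.
by rewrite -gE unitmx_mul => /andP[].
Qed.

Lemma LG_snd (g : L) : LG g ->
  loop2 g = g.2 *: (J *m (invmx (loop1 g))^T *m J).
Proof.
move=> Lg; have u1 := LG_unit Lg; have [gE cu] := (LGP g).1 Lg.
have : (loop2 g)^T = g.2 *: (J *m invmx (loop1 g) *m J).
  have E : (loop2 g)^T *m J = g.2 *: J *m invmx (loop1 g) by rewrite -gE mulmxK.
  by rewrite -[LHS]mulmx1 -(antidiagK _ n) mulmxA E -!scalemxAl.
by move/(congr1 trmx); rewrite trmxK linearZ /= !trmx_mul antidiag_tr mulmxA.
Qed.

Lemma LG_ext (g h : L) : LG g -> LG h -> loop1 g = loop1 h -> g.2 = h.2 -> g = h.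
Proof.
move=> Lg Lh gh1 gh2; apply: loop_ext => //.
by rewrite (LG_snd Lg) (LG_snd Lh) gh1 gh2.
Qed.

(** The inverse of the identification of [LG] with GL_n x G_m by the first factor and the
    similitude; the second factor is the one dictated by [LG_snd]. *)
Definition loop_mk (B : 'M[wittI W R]_n) (c : wittI W R) : L :=
  (pair_mx B (c *: (J *m (invmx B)^T *m J)), c).

Lemma loop_mk1 B c : loop1 (loop_mk B c) = B.
Proof. exact: pair_mx_fst. Qed.

Lemma LG_mk B c : B \in unitmx -> c \is a GRing.unit -> LG (loop_mk B c).
Proof.
move=> uB cu; apply/LGP; split=> //; rewrite loop_mk1 /loop2 pair_mx_snd.
rewrite linearZ /= !trmx_mul antidiag_tr trmxK -!scalemxAl mulmxA.
rewrite -(mulmxA (_ *m _) J J) antidiagK mulmx1.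
by rewrite -mulmxA mulVmx // mulmx1.
Qed.

Lemma loop_mul1 (g h : L) : loop1 (loop_mul g h) = loop1 g *m loop1 h.
Proof.
pose f1 : {rmorphism (wittI W R * wittI W R)%type -> wittI W R} := fst.
exact: (map_mxM f1).
Qed.

Lemma loop_mul2 (g h : L) : loop2 (loop_mul g h) = loop2 g *m loop2 h.
Proof.
pose f2 : {rmorphism (wittI W R * wittI W R)%type -> wittI W R} := snd.
exact: (map_mxM f2).
Qed.

Lemma LG_mul (g h : L) : LG g -> LG h -> LG (loop_mul g h).
Proof.
move=> /LGP[gE gu] /LGP[hE hu]; apply/LGP; split; last by rewrite unitrM gu.
rewrite loop_mul1 loop_mul2.
have -> : (loop2 g *m loop2 h)^T *m J *m (loop1 g *m loop1 h) =
    (loop2 h)^T *m ((loop2 g)^T *m J *m loop1 g) *m loop1 h.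
  by rewrite trmx_mul !mulmxA.
by rewrite gE -scalemxAr -scalemxAl hE scalerA.
Qed.

Definition GLW (B : 'M[wittI W R]_n) :=
  [/\ B \in unitmx, mxint B & mxint (invmx B)].

Definition unitW (c : wittI W R) :=
  [/\ c \is a GRing.unit, integral c & integral c^-1].

Lemma LGplusP (h : L) : LGplus h <-> [/\ LG h, GLW (loop1 h) & unitW h.2].
Proof.
split.
  case=> -[g c] /GUP[gE [c' cc']] <-.
  pose g1 := map_mx fst g; pose g2 := map_mx snd g.
  have cE : witt_inc W R c * witt_inc W R c' = 1 by rewrite -rmorphM cc' rmorph1.
  have cu : witt_inc W R c \is a GRing.unit.
    by apply/unitrP; exists (witt_inc W R c'); rewrite mulrC.
  have cV : (witt_inc W R c)^-1 = witt_inc W R c'.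
    by rewrite -[LHS]mulr1 -cE mulKr.
  set h' : L := (_, _).
  have h1 : loop1 h' = incmx g1 by apply/matrixP => i j; rewrite !mxE.
  have h2 : loop2 h' = incmx g2 by apply/matrixP => i j; rewrite !mxE.
  have Lh : LG h'.
    apply/LGP; split=> //; rewrite h1 h2 -(map_antidiag (witt_inc W R)) /=.
    by rewrite matrix.map_trmx -!map_mxM gE map_mxZ.
  have gV : invmx (incmx g1) = incmx (c' *: (antidiag _ n *m g2^T *m antidiag _ n)).
    have E : incmx (c' *: (antidiag _ n *m g2^T *m antidiag _ n)) *m incmx g1 = 1%:M.
      rewrite -map_mxM -scalemxAl -!mulmxA (mulmxA g2^T) gE -scalemxAr scalerA.
      by rewrite antidiagK mulrC cc' scale1r map_mx1.
    have [u _] := mulmx1_unit E; have u1 : incmx g1 \in unitmx.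
      by rewrite -h1; apply: LG_unit.
    by rewrite -[RHS](mulmxK u1) E mul1mx.
  split=> //; last by split=> //=; rewrite ?cV; exact: integral_inc.
  split; first exact: LG_unit.
    by rewrite h1; apply: mxint_inc.
  by rewrite h1 gV; apply: mxint_inc.
case=> Lh [uh /mxintP[g1 g1E] /mxintP[g1' g1'E]] [uc [c _ cE] [c' _ c'E]].
pose g2 := c *: (antidiag (witt W R) n *m g1'^T *m antidiag _ n).
have g1g1' : g1' *m g1 = 1%:M.
  by apply: (@incmx_inj _ _ _ _ W); rewrite map_mxM map_mx1 -g1E -g1'E mulVmx.
exists (pair_mx g1 g2, c).
  apply/GUP; rewrite pair_mx_fst pair_mx_snd; split; last first.
    exists c'; apply: (@witt_inc_inj _ _ _ _ W); rewrite rmorphM rmorph1.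
    by rewrite cE c'E mulrV.
  rewrite linearZ /= !trmx_mul antidiag_tr trmxK -!scalemxAl mulmxA.
  rewrite -(mulmxA (_ *m _) (antidiag _ n) (antidiag _ n)) antidiagK mulmx1.
  by rewrite -mulmxA g1g1' mulmx1.
apply: loop_ext => //=.
- by rewrite g1E; apply/matrixP => i j; rewrite !mxE.
- rewrite (LG_snd Lh) g1'E -cE -(map_antidiag (witt_inc W R)) matrix.map_trmx.
  by rewrite -!map_mxM -map_mxZ; apply/matrixP => i j; rewrite !mxE.
Qed.

Definition pi_mx (la : cochar n) : 'M[wittI W R]_n :=
  diag_mx (\row_i piI W R ^ la.2 0 i).

Lemma loop_pi1 (la : cochar n) : loop1 (loop_pi W R la) = pi_mx la.
Proof.
apply/matrixP => i j; rewrite !mxE; case: eqP => [->|] /=; first by rewrite mulr1n.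
by rewrite mulr0n.
Qed.

Lemma LG_pi (la : cochar n) : LG (loop_pi W R la).
Proof.
have upi := piI_unit W R.
apply/LGP; split; last by rewrite /= unitrXz.
apply/matrixP => i j; rewrite loop_pi1 mul_mx_diag !mxE.
rewrite (bigD1 i) //= big1 ?addr0; last first.
  by move=> l /negPf nl; rewrite !mxE nl mul0r.
rewrite !mxE eqxx /=; have [->|] := eqVneq j; last by rewrite !mulr0 mul0r.
by rewrite !mulr1 -exprzDr // subrK.
Qed.

Lemma loop_frob1 (g : L) :
  loop1 (loop_frob g) = map_mx (wittI_map W (frob_hom R)) (loop2 g).
Proof. by apply/matrixP => i j; rewrite !mxE. Qed.

Lemma loop_frob2 (g : L) :
  loop2 (loop_frob g) = map_mx (wittI_map W (frob_hom R)) (loop1 g).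
Proof. by apply/matrixP => i j; rewrite !mxE. Qed.

Lemma LG_frob (g : L) : LG g -> LG (loop_frob g).
Proof.
move=> /LGP[gE gu]; apply/LGP; split; last exact: rmorph_unit.
rewrite loop_frob1 loop_frob2 -(map_antidiag (wittI_map W (frob_hom R))).
rewrite /= matrix.map_trmx -!map_mxM -map_mxZ; congr map_mx.
by move/(congr1 trmx): gE; rewrite !trmx_mul trmxK linearZ /= antidiag_tr mulmxA.
Qed.
End LoopGroups.

Lemma invmx_mul (A : comUnitRingType) n (B C : 'M[A]_n) :
  B \in unitmx -> C \in unitmx -> invmx (B *m C) = invmx C *m invmx B.
Proof.
move=> uB uC; have uBC : B *m C \in unitmx by rewrite unitmx_mul uB.
by rewrite -[RHS](mulmxK uBC) mulmxA mulmxKV // mulVmx // mul1mx.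
Qed.

Lemma sum_ord_lt n s : (\sum_(i < n) (i < s))%N = minn n s.
Proof.
elim: n => [|n IH]; first by rewrite big_ord0 min0n.
rewrite big_ord_recr /= IH; case: ltnP => h.
  by rewrite !(minn_idPl _) ?addn1 // ltnW.
by rewrite !(minn_idPr _) ?addn0 // leqW.
Qed.

(** * Free lattices and matrices invertible over the Witt vectors *)

Section GLW.
Context (O : idomainType) (pi : O) (k : finFieldType)
  (red : {rmorphism O -> k}) (W : wittFunctor pi red) (R : perfAlg k) (n : nat).
Local Notation incmx := (map_mx (witt_inc W R)).
Local Notation redmx := (map_mx (witt_red W R)).
Local Notation std := (@std_lattice _ _ _ _ W n R).

Lemma GLW_inv (A : 'M[wittI W R]_n) : GLW A -> GLW (invmx A).
Proof. by move=> [uA iA iA']; split; rewrite ?unitmx_inv ?invmxK. Qed.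

Lemma unitW_mul (a b : wittI W R) : unitW a -> unitW b -> unitW (a * b).
Proof.
move=> [ua ia ia'] [ub ib ib']; split; first by rewrite unitrM ua.
  exact: integralM.
by rewrite invrM //; apply: integralM.
Qed.

Lemma unitW_inv (a : wittI W R) : unitW a -> unitW a^-1.
Proof. by move=> [ua ia ia']; split; rewrite ?unitrV ?invrK. Qed.

Lemma unitW1 : unitW (1 : wittI W R).
Proof. by split; rewrite ?unitr1 ?invr1 //; apply: integral1. Qed.

Lemma integral_det (A : 'M[wittI W R]_n) : mxint A -> integral (\det A).
Proof. by move=> /mxintP[B ->]; rewrite det_map_mx; apply: integral_inc. Qed.

Lemma GLW_det (A : 'M[wittI W R]_n) : GLW A -> unitW (\det A).
Proof.
move=> [uA iA iA']; split; [by rewrite -unitmxE|exact: integral_det|].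
by rewrite -det_inv; apply: integral_det.
Qed.

Lemma GLW_inc (g h : 'M[witt W R]_n) : g *m h = 1%:M ->
  GLW (incmx g) /\ invmx (incmx g) = incmx h.
Proof.
move=> gh; have E : incmx g *m incmx h = 1%:M by rewrite -map_mxM gh map_mx1.
have [u _] := mulmx1_unit E.
have V : invmx (incmx g) = incmx h by rewrite -[RHS](mulKmx u) E mulmx1.
by split=> //; split; rewrite ?V //; apply: mxint_inc.
Qed.

Lemma GLWP (A : 'M[wittI W R]_n) : GLW A ->
  exists g h, [/\ A = incmx g, invmx A = incmx h, g *m h = 1%:M & h *m g = 1%:M].
Proof.
move=> [uA /mxintP[g gE] /mxintP[h hE]]; exists g, h; split=> //;
  apply: (@incmx_inj _ _ _ _ W); rewrite map_mxM map_mx1 -gE -hE.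
- exact: mulmxV.
- exact: mulVmx.
Qed.

Lemma mxint_unit_lift (g : 'M[witt W R]_n) (Q : 'M[R]_n) :
  redmx g *m Q = 1%:M -> GLW (incmx g).
Proof.
move=> gQ; have := congr1 determinant gQ; rewrite det_mulmx det1 det_map_mx.
case/witt_unit => v vE.
have [] := @GLW_inc g (v *: \adj g); last by [].
by rewrite -scalemxAr mul_mx_adj scale_scalar_mx mulrC vE.
Qed.

Definition latg (A : 'M[wittI W R]_n) := [set A *m v | v in std].

Lemma latgE (A : 'M[wittI W R]_n) : A \in unitmx -> latg A = lat (invmx A).
Proof.
move=> uA; apply/seteqP; split=> [_ [v vE <-]|x xE].
  by rewrite /lat /= mulKmx //; move: vE; rewrite std_latticeE /lat /= mul1mx.
exists (invmx A *m x); last by rewrite mulKVmx.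
by rewrite std_latticeE /lat /= mul1mx.
Qed.

Lemma latg_dual_pair (A : 'M[wittI W R]_n) : A \in unitmx -> dual_pair A (invmx A).
Proof.
move=> uA; split; first exact: mulmxV.
by rewrite mulVmx //; apply: mxint_scalar; apply: integral1.
Qed.

Lemma latg1 : latg 1%:M = std.
Proof. by rewrite latgE ?unitmx1 // invmx1 std_latticeE. Qed.

Lemma latg_sub (A B : 'M[wittI W R]_n) : A \in unitmx -> B \in unitmx ->
  latg A `<=` latg B <-> mxint (invmx B *m A).
Proof.
move=> uA uB; rewrite !latgE //; split=> [AB|BA x Ax].
  apply/mxint_col => j; rewrite colE -mulmxA -colE; apply: AB.
  by rewrite /lat /= colE mulKmx // => i l; rewrite mxE; case: (_ && _);
    [apply: integral1|apply: integral0].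
by rewrite /lat /= -[x](mulKVmx uA) mulmxA; apply: mxintM.
Qed.

Lemma latg_GLW (A B : 'M[wittI W R]_n) : A \in unitmx -> GLW B -> latg (A *m B) = latg A.
Proof.
move=> uA [uB iB iB']; have uAB : A *m B \in unitmx by rewrite unitmx_mul uA.
apply/seteqP; split.
  by apply/latg_sub => //; rewrite mulKmx.
by apply/latg_sub => //; rewrite invmx_mul // -mulmxA mulVmx // mulmx1.
Qed.

Lemma latg_eq (A B : 'M[wittI W R]_n) : A \in unitmx -> B \in unitmx -> latg A = latg B ->
  GLW (invmx A *m B).
Proof.
move=> uA uB AB; split; first by rewrite unitmx_mul unitmx_inv uA.
  by apply/latg_sub => //; rewrite AB.
by rewrite invmx_mul ?unitmx_inv // invmxK; apply/latg_sub => //; rewrite AB.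
Qed.

Lemma scale_latg a A : scale_set a (latg A) = latg (a *: A).
Proof.
apply/seteqP; split=> [_ [_ [v vE <-] <-]|_ [v vE <-]].
  by exists v; rewrite // scalemxAl.
by exists (A *m v); [exists v|rewrite scalemxAl].
Qed.

(** On the GL_n part every cocharacter of the problem is some [step s] plus a constant vector, so it
    is represented by a power of pi times [Dmx s]. *)
Definition step s : 'rV[int]_n := \row_i (i < s)%:R.
Definition Dmx s : 'M[wittI W R]_n := pi_mx W R (0, step s).

Lemma pi_mx_unit (la : cochar n) : pi_mx W R la \in unitmx.
Proof.
rewrite unitmxE det_diag rpred_prod // => i _.
by rewrite !mxE unitrXz // piI_unit.
Qed.

Lemma pi_mx_inv (la : cochar n) : invmx (pi_mx W R la) = pi_mx W R (- la).
Proof.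
have E : pi_mx W R la *m pi_mx W R (- la) = 1%:M.
  rewrite mulmx_diag -diag_const_mx; congr diag_mx; apply/rowP => i.
  by rewrite !mxE -invr_expz mulrV // unitrXz // piI_unit.
by rewrite -[RHS](mulKmx (pi_mx_unit la)) E mulmx1.
Qed.

Lemma pi_mxE (la : cochar n) s t : (forall i, la.2 0 i = (i < s)%:R + t) ->
  pi_mx W R la = piI W R ^ t *: Dmx s.
Proof.
move=> laE; apply/matrixP => i j; rewrite !mxE laE mulrnAr.
by rewrite exprzDr ?piI_unit // mulrC.
Qed.

Lemma det_Dmx s : (s <= n)%N -> \det (Dmx s) = piI W R ^+ s.
Proof.
move=> sn; rewrite det_diag.
rewrite (eq_bigr (fun i : 'I_n => piI W R ^+ (i < s))); last first.
  by move=> i _; rewrite !mxE; case: ltnP.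
by rewrite prodrXr sum_ord_lt (minn_idPr _).
Qed.
End GLW.

(** * Elementary divisors at geometric points *)

Section GeometricPoint.
Context (O : idomainType) (pi : O) (k : finFieldType)
  (red : {rmorphism O -> k}) (W : wittFunctor pi red)
  (Om : closedFieldType) (t : {rmorphism k -> Om}).
Local Notation R := (geom t).
Local Notation wI := (wittI W R).
Local Notation p := (piI W R).
Local Notation incmx := (map_mx (witt_inc W R)).
Local Notation redmx := (map_mx (witt_red W R)).

Lemma redO_neq0 : (1 : R) <> 0.
Proof. by move/eqP; rewrite (oner_eq0 Om). Qed.

Lemma integral_expz z : integral (p ^ z : wI) -> 0 <= z.
Proof.
case: z => // m [w _ wE].
have : witt_str W R pi ^+ m.+1 * w = 1.
  apply: (@witt_inc_inj _ _ _ _ W); rewrite rmorphM rmorphXn rmorph1 wE.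
  by rewrite NegzE -invr_expz mulrV // unitrX // piI_unit.
move/(congr1 (witt_red W R)); rewrite rmorphM rmorphXn witt_red_pi expr0n mul0r rmorph1.
by move/esym/redO_neq0.
Qed.

Lemma unitW_expz z : unitW (p ^ z : wI) -> z = 0.
Proof.
move=> [_ /integral_expz z0]; rewrite invr_expz => /integral_expz.
by rewrite oppr_ge0 => z0'; apply/eqP; rewrite eq_le z0 z0'.
Qed.

(** Otherwise pi could be split off again and again, and w would vanish by separatedness. *)
Lemma witt_val (w : witt W R) : w <> 0 ->
  exists d v, [/\ w = witt_str W R pi ^+ d * v & witt_red W R v <> 0].
Proof.
move=> w0; apply: contrapT => nex; apply: w0.
apply: (strict_sep (witt_lift W R)); elim=> [|m [b wE]].
  by exists w; rewrite mul1r.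
have /(strict_ker (witt_lift W R))[c bE] : witt_red W R b = 0.
  by apply: contrapT => rb; apply: nex; exists m, b.
by exists c; rewrite wE bE exprS; ring.
Qed.

Lemma wittI_val (b : wI) : b \is a GRing.unit ->
  exists z u, b = p ^ z * u /\ unitW u.
Proof.
move=> ub; have [w [m bE]] := wittI_frac b.
have w0 : w <> 0.
  move=> w0; have : b * p ^+ m \is a GRing.unit by rewrite unitrM ub unitrX ?piI_unit.
  rewrite bE w0 rmorph0 => /unitrP[x [_]]; rewrite mul0r => /esym h.
  have := @witt_inc_inj _ _ _ _ W R 1 0; rewrite rmorph1 rmorph0 => /(_ h).
  by move/(congr1 (witt_red W R)); rewrite rmorph1 rmorph0 => /redO_neq0.
have [d [v [wE v0]]] := witt_val w0.
have [v' vv'] : exists v', v * v' = 1.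
  by apply: (@witt_unit _ _ _ _ W R v (witt_red W R v)^-1); apply: (@mulfV Om); apply/eqP.
have vE : witt_inc W R v * witt_inc W R v' = 1 by rewrite -rmorphM vv' rmorph1.
have vu : witt_inc W R v \is a GRing.unit.
  by apply/unitrP; exists (witt_inc W R v'); rewrite mulrC.
exists (d%:Z - m%:Z), (witt_inc W R v); split; last first.
  split=> //; first exact: integral_inc.
  have -> : (witt_inc W R v)^-1 = witt_inc W R v' by rewrite -[LHS]mulr1 -vE mulKr.
  exact: integral_inc.
apply: (mulIr (unitrX m (piI_unit W R))); rewrite bE wE rmorphM rmorphXn -/p.
by rewrite exprzDr ?piI_unit // -invr_expz mulrAC divrK // unitrX // piI_unit.
Qed.

Section Mx.
Context (n : nat).

Lemma lift_GLW (Q : 'M[Om]_n) : Q \in unitmx ->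
  exists2 g : 'M[witt W R]_n, redmx g = (Q : 'M[R]_n) & GLW (incmx g).
Proof.
move=> uQ; have [g gE] := lift_mx W (Q : 'M[R]_n); exists g => //.
apply: (mxint_unit_lift (Q := invmx Q : 'M[R]_n)); rewrite gE.
exact: (mulmxV uQ).
Qed.

Lemma GLW_red (g h : 'M[witt W R]_n) : g *m h = 1%:M ->
  (redmx g : 'M[Om]_n) \in unitmx.
Proof.
move=> gh; have : (redmx g : 'M[Om]_n) *m redmx h = 1%:M.
  by have := congr1 redmx gh; rewrite map_mxM map_mx1.
by case/mulmx1_unit.
Qed.

Lemma Dmx_mem s (x : 'cV[wI]_n) : mxint (invmx (Dmx W R n s) *m x) <->
  exists2 w, x = incmx w & (pid_mx s : 'M[R]_n) *m redmx w = 0.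
Proof.
have E (y : 'cV[wI]_n) i : (invmx (Dmx W R n s) *m y) i 0 = p ^- (i < s) * y i 0.
  rewrite pi_mx_inv mul_diag_mx !mxE; case: (ltnP i s) => h /=.
    by rewrite exprN1 expr1.
  by rewrite oppr0 expr0z expr0 invr1.
have pidE (w : 'cV[witt W R]_n) i : ((pid_mx s : 'M[R]_n) *m redmx w) i 0 =
    if (i < s)%N then witt_red W R (w i 0) else 0.
  rewrite mxE (bigD1 i) //= !mxE eqxx /= big1 ?addr0 => [|j /negPf nj].
    by case: ltnP => _; rewrite ?mul1r ?mul0r.
  by rewrite !mxE eq_sym (inj_eq (@ord_inj n)) nj mul0r.
split=> [ix|[w -> pw] i j].
  have /mxintP[w xE] : mxint x.
    move=> i j; rewrite ord1; have := ix i 0; rewrite E; case: ltnP => _ /=.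
      rewrite expr1 => h; rewrite -[x i 0](mulVKr (piI_unit W R)).
      by apply: integralM => //; apply: integral_pi.
    by rewrite expr0 invr1 mul1r.
  exists w => //; apply/colP => i; rewrite pidE [RHS]mxE.
  have := ix i 0; rewrite E; case: ltnP => // _.
  by rewrite expr1 xE mxE => /integral_divpi.
rewrite ord1 E mxE; have := pidE w i; rewrite pw mxE; case: ltnP => _ /= h.
  by rewrite expr1; apply/integral_divpi.
by rewrite expr0 invr1 mul1r; apply: integral_inc.
Qed.

(** The invertible C does not affect the kernel, and a lift of Q to the Witt vectors carries [LP P]
    to the standard lattice attached to [pid_mx s]. *)
Lemma LP_factor (P C Q : 'M[Om]_n) s : C \in unitmx -> Q \in unitmx ->
  P = C *m pid_mx s *m Q ->
  exists2 G : 'M[wI]_n, GLW G & LP W (P : 'M[R]_n) = latg (G *m Dmx W R n s).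
Proof.
move=> uC uQ PE; have [g gE Gg] := lift_GLW uQ.
exists (invmx (incmx g)); first exact: GLW_inv.
have [ug _ _] := Gg; have uD := pi_mx_unit W R (0, step n s).
rewrite latgE ?unitmx_mul ?unitmx_inv ?ug // invmx_mul ?unitmx_inv // invmxK.
have PwE (w : 'cV[witt W R]_n) : (P : 'M[R]_n) *m redmx w = 0 <->
    (pid_mx s : 'M[R]_n) *m redmx (g *m w) = 0.
  rewrite map_mxM gE PE; split=> [h|h].
    have : invmx C *m (C *m pid_mx s *m Q *m (redmx w : 'cV[Om]_n)) = invmx C *m 0.
      by congr (_ *m _).
    by rewrite mulmx0 -!mulmxA mulKmx.
  have : C *m (pid_mx s *m (Q *m (redmx w : 'cV[Om]_n))) = C *m 0 by congr (_ *m _).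
  by rewrite mulmx0 !mulmxA.
apply/seteqP; split=> x; rewrite /lat /=.
  case=> w -> /PwE h; rewrite -mulmxA; apply/Dmx_mem.
  by exists (g *m w) => //; rewrite map_mxM.
rewrite -mulmxA => /Dmx_mem[w wE pw].
have [g' [h' [/incmx_inj <- hE gh hg]]] := GLWP Gg.
exists (h' *m w); last by apply/PwE; rewrite mulmxA gh mul1mx.
by rewrite map_mxM -wE -hE mulKmx.
Qed.

Lemma LP_latg (P : 'M[Om]_n) : exists2 G : 'M[wI]_n, GLW G &
  LP W (P : 'M[R]_n) = latg (G *m Dmx W R n (\rank P)).
Proof.
apply: (LP_factor (col_ebase_unit P) (row_ebase_unit P)).
by rewrite mulmx_ebase.
Qed.

Lemma latg_LP (G : 'M[wI]_n) s : (s <= n)%N -> GLW G ->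
  exists P : 'M[Om]_n, [/\ P *m P = P, \rank P = s &
    latg (G *m Dmx W R n s) = LP W (P : 'M[R]_n)].
Proof.
move=> sn GG; have [g [h [gE hE gh hg]]] := GLWP GG.
have ug := GLW_red gh; have uh := GLW_red hg.
have ghr : (redmx h : 'M[Om]_n) *m redmx g = 1%:M.
  by have := congr1 redmx hg; rewrite map_mxM map_mx1.
pose E : 'M[Om]_n := pid_mx s.
exists ((redmx g : 'M[Om]_n) *m E *m redmx h).
split.
- rewrite -!mulmxA (mulmxA (redmx h : 'M[Om]_n)) ghr mul1mx (mulmxA E).
  by rewrite pid_mx_id.
- by rewrite mxrankMfree ?row_free_unit // eqmxMfull ?row_full_unit // rank_pid_mx.
have uD := pi_mx_unit W R (0, step n s); have [uG _ _] := GG.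
rewrite latgE ?unitmx_mul ?uG // invmx_mul // hE.
have PwE (w : 'cV[witt W R]_n) :
    ((redmx g : 'M[Om]_n) *m E *m redmx h : 'M[R]_n) *m redmx w = 0 <->
    (pid_mx s : 'M[R]_n) *m redmx (h *m w) = 0.
  rewrite map_mxM -!mulmxA; split=> [e|->]; last exact: (@mulmx0 Om).
  have e' : (redmx g : 'M[Om]_n) *m
    (E *m ((redmx h : 'M[Om]_n) *m (redmx w : 'cV[Om]_n))) = 0 := e.
  by have := congr1 (mulmx (invmx (redmx g : 'M[Om]_n))) e'; rewrite mulKmx // mulmx0.
apply/seteqP; split=> x; rewrite /lat /=.
  rewrite -(mulmxA (invmx _)) => /Dmx_mem[w wE pw]; exists (g *m w).
    by rewrite map_mxM -gE -wE -hE mulKVmx.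
  by apply/PwE; rewrite mulmxA hg mul1mx.
case=> w -> /PwE pw; rewrite -mulmxA; apply/Dmx_mem.
by exists (h *m w) => //; rewrite map_mxM.
Qed.

(** Elementary divisors by linear algebra over Om alone: the lattice spanned by A lies between pi
    W^n and W^n, so it is some [LP P], hence spanned by some [G *m Dmx s]; two bases of one lattice
    differ by an element of GL_n of the Witt vectors. *)
Lemma minuscule_decomp (A : 'M[wI]_n) :
  A \in unitmx -> mxint A -> mxint (p *: invmx A) ->
  exists s G Q, [/\ (s <= n)%N, GLW G, GLW Q & A = G *m Dmx W R n s *m Q].
Proof.
move=> uA /[dup] iA /mxintP[a aE] /mxintP[b bE].
(* The kernel of P is the column space of the reduction of A; the transposes are there because
   [cokermx] works with row spaces. *)
pose P : 'M[Om]_n := (cokermx (redmx a : 'M[Om]_n)^T)^T.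
have [G GG LE] := LP_latg P.
have uD := pi_mx_unit W R (0, step n (\rank P)); have [uG _ _] := GG.
have Pa : P *m (redmx a : 'M[Om]_n) = 0.
  by rewrite /P -[X in _ *m X]trmxK -trmx_mul mulmx_coker trmx0.
have AE : latg A = LP W (P : 'M[R]_n).
  apply/seteqP; split=> x.
    case=> v vE <-; have /mxintP[d ->] : mxint v.
      by move: vE; rewrite std_latticeE /lat /= mul1mx.
    exists (a *m d); first by rewrite map_mxM -aE.
    rewrite map_mxM mulmxA.
    by rewrite (Pa : (P : 'M[R]_n) *m redmx a = 0) mul0mx.
  case=> w -> Pw; rewrite latgE // /lat /=.
  have /submxP[y yE] : ((redmx w : 'cV[Om]_n)^T <= (redmx a : 'M[Om]_n)^T)%MS.
    by rewrite submxE; apply/eqP; rewrite -[cokermx _]trmxK -trmx_mul -/P (Pw : P *m _ = 0) trmx0.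
  have [d dE] := lift_mx W (y^T : 'cV[R]_n).
  have : redmx (w - a *m d) = 0.
    rewrite map_mxB map_mxM dE; apply/eqP; rewrite subr_eq0; apply/eqP.
    by have := congr1 trmx yE; rewrite trmxK trmx_mul trmxK.
  move/mxint_divpi => /mxintP[u uE].
  have -> : incmx w = A *m incmx d + p *: incmx u.
    rewrite -uE scalerA mulrV ?piI_unit // scale1r map_mxB map_mxM aE.
    by rewrite addrC subrK.
  rewrite mulmxDr mulKmx // -scalemxAr scalemxAl bE.
  by apply: mxintD; [exact: mxint_inc|apply: mxintM; exact: mxint_inc].
have := latg_eq (A := G *m Dmx W R n (\rank P)) (B := A).
rewrite unitmx_mul uG uD => /(_ isT uA); rewrite AE => /(_ (esym LE)) GQ.
exists (\rank P), G, (invmx (G *m Dmx W R n (\rank P)) *m A); split=> //.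
  exact: rank_leq_row.
by rewrite mulKVmx // unitmx_mul uG.
Qed.
End Mx.
End GeometricPoint.

(** * Relative positions *)

Section Cocharacters.
Context (n : nat).
Implicit Types la : cochar n.

Lemma cochar_sum (I : Type) (r : seq I) (P : pred I) (F : I -> cochar n) l :
  (\sum_(i <- r | P i) F i).2 0 l = \sum_(i <- r | P i) (F i).2 0 l.
Proof.
by apply: (big_morph (fun la : cochar n => la.2 0 l)) => [x y|]; rewrite !mxE.
Qed.

Lemma cochar_sum1 (I : Type) (r : seq I) (P : pred I) (F : I -> cochar n) :
  (\sum_(i <- r | P i) F i).1 = \sum_(i <- r | P i) (F i).1.
Proof. exact: (big_morph (fun la : cochar n => la.1)). Qed.

Lemma cochar_mulrn la m l : (la *+ m).2 0 l = la.2 0 l *+ m.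
Proof.
elim: m => [|m IH]; first by rewrite !mulr0n mxE.
by rewrite !mulrS /= mxE IH.
Qed.

Lemma cochar_mulrn1 la m : (la *+ m).1 = la.1 *+ m.
Proof. by elim: m => [//|m IH]; rewrite !mulrS /= IH. Qed.

Lemma cle_entry la' la (c : 'I_n -> 'I_n -> nat) l :
  la - la' = \sum_(i < n) \sum_(j < n | (i < j)%N)
                 (eps n i.+1 - eps n j.+1) *+ c i j ->
  la.2 0 l - la'.2 0 l = \sum_(i < n) \sum_(j < n | (i < j)%N)
    ((l == i)%:R - (l == j)%:R) *+ c i j.
Proof.
move/(congr1 (fun la : cochar n => la.2 0 l)); rewrite /= !mxE => ->.
rewrite cochar_sum; apply: eq_bigr => i _; rewrite cochar_sum.
by apply: eq_bigr => j _; rewrite cochar_mulrn !mxE !eqSS.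
Qed.

Lemma cle_refl la : cle la la.
Proof.
exists (fun _ _ => 0%N); rewrite subrr; symmetry.
by apply: big1 => i _; apply: big1 => j _; rewrite mulr0n.
Qed.

(* la is minuscule up to a central cocharacter. *)
Lemma cle_step la' la s t : (forall i, la.2 0 i = (i < s)%:R + t) ->
  dominant la' -> cle la' la -> la' = la.
Proof.
move=> laE dom' [c cE].
have E1 : la'.1 = la.1.
  have := congr1 (fun la : cochar n => la.1) cE; rewrite /= cochar_sum1.
  rewrite big1 => [/eqP|i _]; first by rewrite subr_eq0 => /eqP.
  by rewrite cochar_sum1 big1 // => j _; rewrite cochar_mulrn1 /= subrr mul0rn.
have El l := cle_entry l cE.
have Esum : \sum_l la'.2 0 l = \sum_l la.2 0 l.
  apply/esym/eqP; rewrite -subr_eq0 -sumrB; apply/eqP.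
  rewrite (eq_bigr _ (fun l _ => El l)) exchange_big big1 // => i _.
  rewrite exchange_big big1 // => j _; rewrite sumrMnl sumrB.
  have one (i' : 'I_n) : \sum_(l < n) (l == i')%:R = 1 :> int.
    by rewrite (bigD1 i') //= eqxx big1 ?addr0 // => l /negPf ->.
  by rewrite !one subrr mul0rn.
(* The last coordinate of each eps_i - eps_j with i < j is at most 0, so the last entry of la' is at
   least that of la, and dominance extends the bound to all entries. The upper bound comes in the
   same way from the first coordinate. *)
have lo l : t <= la'.2 0 l.
  have z_lt : (n.-1 < n)%N by rewrite prednK // (leq_ltn_trans (leq0n l)).
  pose z : 'I_n := Ordinal z_lt.
  have lz : (l <= z)%N by rewrite /= -ltnS prednK // (leq_ltn_trans (leq0n l)).
  apply: le_trans (dom' _ _ lz); have : la.2 0 z - la'.2 0 z <= 0.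
    rewrite El; apply: sumr_le0 => i _; apply: sumr_le0 => j ij.
    have -> : (z == i) = false.
      apply/negbTE; rewrite -(inj_eq val_inj) /= neq_ltn orbC.
      by have := ltn_ord j; lia.
    by rewrite sub0r mulNrn oppr_le0 mulrn_wge0.
  by rewrite laE; lia.
have hi l : la'.2 0 l <= 1 + t.
  have z_lt : (0 < n)%N by rewrite (leq_ltn_trans (leq0n l)).
  pose z : 'I_n := Ordinal z_lt.
  apply: le_trans (dom' z l (leq0n l)) _; have : 0 <= la.2 0 z - la'.2 0 z.
    rewrite El; apply: sumr_ge0 => i _; apply: sumr_ge0 => j ij.
    have -> : (z == j) = false.
      by apply/negbTE; rewrite -(inj_eq val_inj) /= neq_ltn; lia.
    by rewrite subr0 mulrn_wge0.
  by rewrite laE; case: (_ < _)%N => /=; lia.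
have sum0 (a b : 'I_n -> int) : \sum_l a l = \sum_l b l -> (forall l, a l <= b l) ->
    a =1 b.
  move=> ab le_ab l; apply/eqP; rewrite eq_sym -subr_eq0.
  have : \sum_l (b l - a l) == 0 by rewrite sumrB ab subrr.
  rewrite psumr_eq0 => [/allP/(_ l)|i _]; last by rewrite subr_ge0.
  by rewrite mem_index_enum => /(_ isT).
have E2 l : la'.2 0 l = la.2 0 l.
  (* Both sequences are decreasing with values t and t + 1. If la' < la at l, then la is t + 1 up to
     l and la' is t from l on, so la' <= la everywhere, and equality of the sums excludes this. The
     other case is symmetric. *)
  have [lt|gt|//] := ltgtP (la'.2 0 l) (la.2 0 l).
    apply: (sum0 (fun l => la'.2 0 l) (fun l => la.2 0 l)) => // j; have [jl|lj] := leqP j l.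
      have := hi j; have := lo l; move: lt; rewrite !laE.
      have : (l < s)%N -> (j < s)%N by lia.
      by case: (l < s)%N; case: (j < s)%N => //=; lia.
    have := dom' _ _ (ltnW lj); have := lo l; have := hi l; move: lt; rewrite !laE.
    by case: (l < s)%N; case: (j < s)%N => //=; lia.
  apply/esym; apply: (sum0 (fun l => la.2 0 l) (fun l => la'.2 0 l)) => // j.
  have [jl|lj] := leqP j l.
    have := dom' _ _ jl; have := lo l; have := hi l; move: gt; rewrite !laE.
    by case: (l < s)%N; case: (j < s)%N => //=; lia.
  have := lo j; have := hi l; move: gt; rewrite !laE.
  have : (j < s)%N -> (l < s)%N by lia.
  by case: (l < s)%N; case: (j < s)%N => //=; lia.
by case: (la') (la) E1 E2 => [a b] [a' b'] /= -> bb'; congr (_, _); apply/rowP.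
Qed.

Lemma step_dominant la s t : (forall i, la.2 0 i = (i < s)%:R + t) -> dominant la.
Proof.
move=> laE i j ij; rewrite !laE lerD2r.
have : (j < s)%N -> (i < s)%N by lia.
by case: (i < s)%N; case: (j < s)%N => //= h; have := h isT.
Qed.
End Cocharacters.

Section RelPos.
Context (O : idomainType) (pi : O) (k : finFieldType)
  (red : {rmorphism O -> k}) (W : wittFunctor pi red) (R : perfAlg k) (n : nat).
Local Notation p := (piI W R).
Local Notation std1 := (@std_lattice _ _ _ _ W 1 R).

Definition lats (c : wittI W R) := scale_set c std1.

Lemma lats_lat c : c \is a GRing.unit -> lats c = lat (c^-1 *: 1%:M).
Proof. by move=> uc; rewrite /lats std_latticeE scale_lat. Qed.

Lemma lats_dual_pair (c : wittI W R) : c \is a GRing.unit ->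
  dual_pair (c *: 1%:M : 'M_1) (c^-1 *: 1%:M).
Proof. by move=> uc; apply: dual_pair_scale => //; apply: dual_pair1. Qed.

Lemma lats_lattice c : c \is a GRing.unit -> is_lattice (lats c).
Proof. by move=> uc; rewrite lats_lat //; apply: lat_is_lattice (lats_dual_pair uc). Qed.

Lemma lats1 : lats 1 = std1.
Proof. by rewrite lats_lat ?unitr1 // invr1 scale1r std_latticeE. Qed.

Lemma lats_sub c d : c \is a GRing.unit -> d \is a GRing.unit ->
  lats c `<=` lats d <-> integral (d^-1 * c).
Proof.
move=> uc ud; rewrite !lats_lat //; split=> [sub|idc x].
  have /sub : lat (c^-1 *: 1%:M) (c *: 1%:M : 'M[wittI W R]_1).
    rewrite /lat /= -scalemxAl mul1mx scalerA mulVr // scale1r.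
    by apply: mxint_scalar; apply: integral1.
  by move=> /(_ 0 0); rewrite -scalemxAl mul1mx scalerA !mxE mulr1.
rewrite /lat /= -!scalemxAl !mul1mx => cx.
have -> : d^-1 *: x = (d^-1 * c) *: (c^-1 *: x) by rewrite scalerA mulrK.
exact: mxintZ.
Qed.

Lemma lats_eq c d : c \is a GRing.unit -> d \is a GRing.unit ->
  lats c = lats d <-> unitW (d^-1 * c).
Proof.
move=> uc ud; split=> [cd|[u i i']].
  split; first by rewrite unitrM unitrV ud.
    by apply/lats_sub => //; rewrite cd.
  by rewrite invrM ?unitrV // invrK; apply/lats_sub => //; rewrite cd.
apply/seteqP; split; first by apply/lats_sub.
by apply/lats_sub => //; rewrite -[_ * _](invrK) invrM ?unitrV // invrK.
Qed.

Lemma loop_actE (g : loop W n R) :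
  loop_act g (gr_base W n R) = (latg (loop1 g), lats g.2).
Proof. by []. Qed.

Lemma rel_posP (la : cochar n) (x y : gr_obj W n R) : rel_pos la x y <->
  exists A c, [/\ A \in unitmx, c \is a GRing.unit, y = (latg A, lats c) &
    x = (latg (A *m pi_mx W R la), lats (c * p ^ la.1))].
Proof.
split=> [[g [Lg -> ->]]|[A [c [uA uc -> ->]]]].
  exists (loop1 g), g.2; split=> //; first exact: LG_unit.
    by case/LGP: Lg.
  by rewrite loop_actE loop_mul1 loop_pi1.
exists (loop_mk A c); split; first exact: LG_mk.
  by rewrite loop_actE loop_mk1.
by rewrite loop_actE loop_mul1 loop_mk1 loop_pi1.
Qed.

Lemma base_pos (A : 'M[wittI W R]_n) c : A \in unitmx -> c \is a GRing.unit ->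
  gr_base W n R = (latg A, lats c) -> GLW A /\ unitW c.
Proof.
move=> uA uc [stdA std1c]; split.
  have := @latg_eq _ _ _ _ W R n 1%:M A; rewrite unitmx1 latg1 stdA => /(_ isT uA erefl).
  by rewrite invmx1 mul1mx.
have := (lats_eq uc (unitr1 _)).1; rewrite invr1 mul1r lats1; apply.
by rewrite std1c.
Qed.

Lemma rel_pos_base (la : cochar n) (x : gr_obj W n R) s z :
  (forall i, la.2 0 i = (i < s)%:R + z) -> rel_pos la x (gr_base W n R) <->
  exists2 G, GLW G & x = (scale_set (p ^ z) (latg (G *m Dmx W R n s)), lats (p ^ la.1)).
Proof.
move=> laE; have upi := piI_unit W R; rewrite rel_posP; split.
  case=> A [c [uA uc /(base_pos uA uc)[GA Uc] ->]]; exists A => //.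
  rewrite (pi_mxE W R laE) -scalemxAr scale_latg; congr (_, _).
  apply/lats_eq; rewrite ?unitrM ?unitrXz ?uc //.
  by rewrite mulrC mulrK ?unitrXz.
case=> G GG ->; have [uG _ _] := GG; exists G, 1; split=> //; first exact: unitr1.
  by rewrite lats1 -[G]mul1mx latg_GLW ?unitmx1 // latg1.
by rewrite (pi_mxE W R laE) -scalemxAr scale_latg mul1r.
Qed.
End RelPos.

Section GeomRelPos.
Context (O : idomainType) (pi : O) (k : finFieldType)
  (red : {rmorphism O -> k}) (W : wittFunctor pi red)
  (Om : closedFieldType) (t : {rmorphism k -> Om}) (n : nat).
Local Notation R := (geom t).
Local Notation p := (piI W R).
Local Notation std1 := (@std_lattice _ _ _ _ W 1 R).
Local Notation D := (Dmx W R n).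

Lemma det_GD (G : 'M[wittI W R]_n) s : (s <= n)%N -> GLW G ->
  exists2 u, unitW u & \det (G *m D s) = p ^ (s%:Z) * u.
Proof.
move=> sn GG; exists (\det G); first exact: GLW_det.
by rewrite det_mulmx det_Dmx // mulrC.
Qed.

Lemma rel_pos_base_LP (la : cochar n) (x : gr_obj W n R) s z : (s <= n)%N ->
  (forall i, la.2 0 i = (i < s)%:R + z) -> rel_pos la x (gr_base W n R) <->
  exists P : 'M[Om]_n, [/\ P *m P = P, \rank P = s &
     x = (scale_set (p ^ z) (LP W (P : 'M[R]_n)), lats (p ^ la.1))].
Proof.
move=> sn laE; rewrite (rel_pos_base _ laE); split.
  case=> G GG ->; have [P [PP Pr ->]] := latg_LP sn GG.
  by exists P.
case=> P [PP <- ->]; have [G GG ->] := LP_latg W t P; by exists G.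
Qed.

(* The determinant gives the number of elementary divisors equal to pi. *)
Lemma rel_pos_LP (la : cochar n) (P1 P2 : 'M[Om]_n) z : (2 <= n)%N ->
  P1 *m P1 = P1 -> P2 *m P2 = P2 -> \rank P1 = 1%N -> \rank P2 = n.-1 ->
  (forall i, la.2 0 i = (i < n - 2)%:R - 1) -> la.1 = z ->
  rel_pos la (scale_set p^-1 (LP W (P2 : 'M[R]_n)), lats (p ^ z))
             (LP W (P1 : 'M[R]_n), std1) <-> P1 *m (1%:M - P2) = 0.
Proof.
move=> n2 PP1 PP2 Pr1 Pr2 laE <-; have upi := piI_unit W R.
rewrite rel_posP; split.
  case=> A [c [uA uc [E1 _] [E2 _]]].
  apply/(@LP_sub _ _ _ _ W R n P2 P1 PP2).
  move: E2; rewrite E1 (pi_mxE W R laE) -scalemxAr -scale_latg exprN1.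
  move=> /(congr1 (scale_set p)); rewrite !scale_setK // => ->.
  apply/latg_sub => //; first by rewrite unitmx_mul uA pi_mx_unit.
  rewrite mulKmx // => i j; rewrite !mxE; case: eqP => _; last exact: integral0.
  by rewrite mulr1n; case: ltnP => _; [exact: integral_pi|exact: integral1].
move/(@LP_sub _ _ _ _ W R n P2 P1 PP2) => sub21.
have [G1 GG1 E1] := LP_latg W t P1; have [G2 GG2 E2] := LP_latg W t P2.
rewrite Pr1 in E1; rewrite Pr2 in E2.
pose A := G1 *m D 1; pose B := G2 *m D n.-1.
have uA : A \in unitmx by rewrite unitmx_mul pi_mx_unit; case: GG1 => ->.
have uB : B \in unitmx by rewrite unitmx_mul pi_mx_unit; case: GG2 => ->.
(* The smaller lattice contains pi W^n, hence pi times the larger one; so N and pi N^-1 are integral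
   and N has elementary divisors 1 and pi only. *)
pose N := invmx A *m B.
have uN : N \in unitmx by rewrite unitmx_mul unitmx_inv uA.
have iN : mxint N by apply/latg_sub => //; rewrite -E1 -E2.
have iN' : mxint (p *: invmx N).
  rewrite invmx_mul ?unitmx_inv // invmxK scalemxAr; apply/latg_sub => //.
    by rewrite unitmxZ.
  rewrite -scale_latg /A /B -E1 -E2 => _ [_ [w -> _] <-].
  exists (witt_str W R pi *: w); first by rewrite map_mxZ.
  by rewrite map_mxZ witt_red_pi scale0r mulmx0.
have [s [G [Q [sn GG GQ NE]]]] := minuscule_decomp uN iN iN'.
(* The determinants of A, B and N have valuations 1, n - 1 and s. *)
have sE : s = (n - 2)%N.
  have [u Uu uE] := det_GD (ltnW n2) GG1.
  have [v Uv vE] := det_GD (leq_pred n) GG2.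
  have [w Uw wE] := det_GD sn GG.
  have [y Uy yE] : exists2 y, unitW y & \det N = p ^ s%:Z * y.
    exists (w * \det Q); first by apply: unitW_mul => //; apply: GLW_det.
    by rewrite NE det_mulmx wE mulrA.
  have : unitW (p ^ (n.-1%:Z - 1 - s%:Z)).
    set X := p ^ _; have E : u * y = X * v.
      have : \det A * \det N = \det B by rewrite -det_mulmx mulKVmx.
      rewrite uE vE yE.
      have -> : p ^ n.-1%:Z = X * (p ^ 1%:Z * p ^ s%:Z).
        by rewrite /X -!exprzDr //; congr (p ^ _); lia.
      move=> h; have up : p ^ 1%:Z * p ^ s%:Z \is a GRing.unit.
        by rewrite unitrM !unitrXz.
      by apply: (mulIr up); rewrite [RHS]mulrAC -h; ring.
    have [uv _ _] := Uv; have -> : X = u * y * v^-1 by rewrite E mulrK.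
    by apply: unitW_mul; [apply: unitW_mul|apply: unitW_inv].
  by move/unitW_expz; lia.
have [uG _ _] := GG; exists (A *m G), 1; split.
- by rewrite unitmx_mul uA.
- exact: unitr1.
- by rewrite latg_GLW // E1 lats1.
rewrite mul1r (pi_mxE W R laE) -scalemxAr -scale_latg exprN1 E2; congr (scale_set _ _, _).
have -> : A *m G *m D (n - 2) = B *m invmx Q.
  have [uQ _ _] := GQ.
  by rewrite -[RHS](mulKVmx uA) (mulmxA _ B) -/N NE sE mulmxK ?mulmxA // mulmxK.
by rewrite (latg_GLW uB (GLW_inv GQ)).
Qed.
End GeomRelPos.

(** * Flags in families *)

Section Families.
Context (O : idomainType) (pi : O) (k : finFieldType)
  (red : {rmorphism O -> k}) (W : wittFunctor pi red)
  (kbar : closedFieldType) (iota : {rmorphism k -> kbar}).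
Implicit Types R : perfAlg kbar.

(** Inclusion amounts to integrality of the functionals of F on the generators of E. *)
Lemma geometric_lat_sub R m (E F : set 'cV[wittI W (restr iota R)]_m) :
  is_lattice E -> is_lattice F ->
  (forall (Om : closedFieldType) (t : {rmorphism kbar -> Om})
     (f : perfHom R (geom t)),
     lat_pull (restr_hom iota f) E `<=` lat_pull (restr_hom iota f) F) ->
  E `<=` F.
Proof.
move=> /is_latticeP[r [e [phi [dp ->]]]] /is_latticeP[q [d [psi [dq ->]]]] EF.
suff ipe : mxint (psi *m e).
  move=> x phix; rewrite /lat /= -[x]mul1mx -dp.1 -mulmxA mulmxA.
  exact: mxintM.
move=> i j; apply: geometric_integral => Om t f.
have := EF Om t f; rewrite (lat_pullE _ dp) (lat_pullE _ dq).
move/(_ _ (lat_col j (dual_pair_pull (restr_hom iota f) dp))).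
by move/(_ i 0); rewrite colE mulmxA -colE -map_mxM !mxE.
Qed.

Context (n : nat).
Local Notation X := (grP W iota n).

(** The same z scales both bundles because, in the positions of E_1 and E_2 relative to E^0, the
    constant part of the GL_n entries equals the G_m entry: 0 for E_1 and -1 for E_2. *)
Definition flag z R (P : 'M[R]_n) : pobj X R :=
  (scale_set (piI W (restr iota R) ^ z) (LP W (P : 'M[restr iota R]_n)),
   lats (piI W (restr iota R) ^ z)).

Lemma lats_pull R S (f : perfHom R S) z :
  lat_pull (restr_hom iota f) (lats (piI W (restr iota R) ^ z)) =
  lats (piI W (restr iota S) ^ z).
Proof.
rewrite /lats lat_pull_scale ?unitrXz ?piI_unit //; last first.
  by rewrite std_latticeE; apply: lat_is_lattice (dual_pair1 W _ _).
by rewrite std_pull rmorphXz ?wittI_map_pi // piI_unit.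
Qed.

Lemma flag_pull z R S (f : perfHom R S) (P : 'M[R]_n) : P *m P = P ->
  pres f (flag z P) = flag z (map_mx f P).
Proof.
move=> PP; rewrite /flag /= /gr_pull lats_pull; congr (_, _).
rewrite lat_pull_scale ?unitrXz ?piI_unit //; last exact: LP_lattice.
by rewrite LP_pull // rmorphXz ?wittI_map_pi // piI_unit.
Qed.

Lemma flag_Gr z R (P : 'M[R]_n) : P *m P = P -> Gr (flag z P).
Proof.
move=> PP; split; last by apply: lats_lattice; rewrite unitrXz ?piI_unit.
by apply: scale_set_lattice; [rewrite unitrXz ?piI_unit|apply: LP_lattice].
Qed.

Lemma flag0 R (P : 'M[R]_n) : flag 0 P = (LP W (P : 'M[restr iota R]_n),
  @std_lattice _ _ _ _ W 1 (restr iota R)).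
Proof.
rewrite /flag expr0z lats1; congr (_, _); apply/seteqP.
by split=> [_ [y yP <-]|y yP]; [rewrite scale1r|exists y; rewrite ?scale1r].
Qed.

Lemma flag_sub z R (P Q : 'M[R]_n) : P *m P = P ->
  (flag z P).1 `<=` (flag z Q).1 <-> Q *m (1%:M - P) = 0.
Proof.
move=> PP; rewrite -(@LP_sub _ _ _ _ W (restr iota R) n P Q PP).
have up : piI W (restr iota R) ^ z \is a GRing.unit by rewrite unitrXz ?piI_unit.
split=> [sub x xP|sub _ [x xP <-]]; last by exists x => //; apply: sub.
have /sub[y yQ xy] : (flag z P).1 (piI W (restr iota R) ^ z *: x) by exists x.
by rewrite -[x]scale1r -(mulVr up) -scalerA -xy scalerA mulVr // scale1r.
Qed.

Lemma is_Gr_pull R S (f : perfHom R S) (x : pobj X R) : Gr x -> Gr (pres f x).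
Proof. by case=> x1 x2; split; apply: lat_pull_lattice. Qed.

Lemma pres_id R (f : perfHom R R) (x : pobj X R) : f =1 id -> Gr x -> pres f x = x.
Proof.
by move=> fid [x1 x2]; rewrite /= /gr_pull !(lat_pull_id (f := restr_hom iota f)) //; case: (x).
Qed.

Lemma pres_comp R S T (f : perfHom R S) (g : perfHom S T) (h : perfHom R T)
  (x : pobj X R) : h =1 g \o f -> Gr x -> pres h x = pres g (pres f x).
Proof.
move=> hgf [x1 x2]; rewrite /= /gr_pull /=.
by rewrite !(lat_pull_comp (f := restr_hom iota f) (g := restr_hom iota g)).
Qed.

Lemma base_pull R S (f : perfHom R S) :
  pres f (base W iota n R) = base W iota n S.
Proof. by rewrite /= /gr_pull /base /gr_base !std_pull. Qed.

Lemma geom_flag R (x : pobj X R) s z : Gr x ->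
  (forall (Om : closedFieldType) (t : {rmorphism kbar -> Om})
     (f : perfHom R (geom t)), exists P : 'M[Om]_n,
       [/\ P *m P = P, \rank P = s & pres f x = flag z (P : 'M[geom t]_n)]) ->
  exists P : 'M[R]_n, [/\ P *m P = P, geom_rank P s & x = flag z P].
Proof.
case: x => E L [/= latE latL] geomx.
have up : forall R, piI W (restr iota R) ^ z \is a GRing.unit.
  by move=> S; rewrite unitrXz ?piI_unit.
have upR := up R; pose E' := scale_set (piI W (restr iota R) ^ z)^-1 E.
have [||P [PP Pr EP]] := @geometric_LP _ _ _ _ W _ iota R n s E'.
- by apply: scale_set_lattice => //; rewrite unitrV; apply: up.
- move=> Om t f; have [P [PP Pr [EP _]]] := geomx Om t f; exists P; split=> //.
  rewrite lat_pull_scale ?unitrV // EP rmorphV //.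
  rewrite rmorphXz ?piI_unit // wittI_map_pi.
  have := @scale_setK _ _ (piI W (restr iota (geom t)) ^ z)^-1 (LP W (P : 'M[restr iota (geom t)]_n)).
  by rewrite unitrV invrK => -> //; apply: up.
exists P; split=> //; rewrite /flag -EP scale_setK //; congr (_, _).
have latL' : is_lattice (lats (piI W (restr iota R) ^ z)) by apply: lats_lattice.
apply/seteqP; split; apply: geometric_lat_sub => // Om t f;
  by have [_ [_ _ [_ /= ->]]] := geomx Om t f; rewrite lats_pull.
Qed.

Lemma bounded_step (la : cochar n) s z R (x y : pobj X R) :
  (forall i, la.2 0 i = (i < s)%:R + z) -> bounded la x y <-> position la x y.
Proof.
move=> laE; split=> xy Om t f.
  have [la' [dom' le' pos']] := xy Om t f.
  by rewrite -(cle_step laE dom' le').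
by exists la; split; [exact: step_dominant laE|exact: cle_refl|exact: xy].
Qed.

Lemma Gr_eqP (la : cochar n) s R (x : pobj X R) : (s <= n)%N ->
  (forall i, la.2 0 i = (i < s)%:R + la.1) -> Gr_eq la x <->
  exists P : 'M[R]_n, [/\ P *m P = P, geom_rank P s & x = flag la.1 P].
Proof.
move=> sn laE; split=> [[Gx pos]|[P [PP Pr ->]]].
  apply: geom_flag => // Om t f; have := pos Om t f; rewrite base_pull.
  case/(rel_pos_base_LP (t := t \o iota) _ sn laE) => P [PP Pr xE].
  by exists P.
split; first exact: flag_Gr.
move=> Om t f; rewrite base_pull flag_pull //.
apply/(rel_pos_base_LP (t := t \o iota) _ sn laE).
exists (map_mx f P); split; [by rewrite -[RHS](congr1 (map_mx f) PP) map_mxM|exact: Pr Om t f|by []].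
Qed.

Lemma Gr_leP (la : cochar n) s R (x : pobj X R) : (s <= n)%N ->
  (forall i, la.2 0 i = (i < s)%:R + la.1) -> Gr_le la x <->
  exists P : 'M[R]_n, [/\ P *m P = P, geom_rank P s & x = flag la.1 P].
Proof.
by move=> sn laE; rewrite -Gr_eqP // /Gr_le /Gr_eq /= (bounded_step _ _ laE).
Qed.
End Families.

Section Cochars.
Context (n : nat) (hn : (3 <= n)%N).

Lemma nu1_star_fst : (cstar (nu1 n)).1 = 0.
Proof. by rewrite /= /nu1 /=; case: n hn. Qed.

Lemma nu1_star_step i : (cstar (nu1 n)).2 0 i = (i < 1)%:R + (cstar (nu1 n)).1.
Proof.
rewrite nu1_star_fst /= !mxE; case: i => i /= li; rewrite opprK addr0; congr _%:R.
by lia.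
Qed.

Lemma mu_star_fst : (cstar (mu n)).1 = - 1.
Proof. by []. Qed.

Lemma mu_star_step i : (cstar (mu n)).2 0 i = (i < n - 2)%:R - 1.
Proof.
rewrite /= !mxE; case: i => i /= li; rewrite add0r.
case: ltnP => h.
  have -> : ((n - i.+1).+1 == 1)%N = false by lia.
  by have -> : ((n - i.+1).+1 == 2)%N = false by lia.
have [e|e] : ((n - i.+1).+1 = 1)%N \/ ((n - i.+1).+1 = 2)%N by lia.
  by rewrite e.
by rewrite e.
Qed.

Lemma nu1_tau1_star_fst : (nu1 n + cstar (tau1 n)).1 = - 1.
Proof. by rewrite /= /nu1 /=; case: n hn. Qed.

Lemma nu1_tau1_star_step i : (nu1 n + cstar (tau1 n)).2 0 i =
  (i < n.-1)%:R + (nu1 n + cstar (tau1 n)).1.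
Proof.
rewrite nu1_tau1_star_fst /= !mxE; case: i => i /= li; rewrite subr0; case: ltnP => h.
  by have -> : (i.+1 == n)%N = false by lia.
by have -> : (i.+1 == n)%N = true by lia.
Qed.
End Cochars.

Section Flags.
Context (O : idomainType) (pi : O) (k : finFieldType)
  (red : {rmorphism O -> k}) (W : wittFunctor pi red)
  (kbar : closedFieldType) (iota : {rmorphism k -> kbar})
  (n : nat) (hn : (3 <= n)%N).
Implicit Types R : perfAlg kbar.
Local Notation la := (cstar (nu1 n)).
Local Notation mus := (cstar (mu n)).
Local Notation taus := (cstar (tau1 n)).
Local Notation ka := (nu1 n + cstar (tau1 n)).

Local Notation fl z P := (flag W iota z P).

(** The last equation says that the line [ker Q] lies in the hyperplane [ker P]. *)
Definition nested_flags R (P Q : 'M[R]_n) :=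
  [/\ P *m P = P, geom_rank P 1, Q *m Q = Q, geom_rank Q n.-1 &
      P *m (1%:M - Q) = 0].

Lemma Gr0_eqP R (x : pobj (convP W iota n) R) : Gr0_eq la mus ka x <->
  exists P Q, nested_flags P Q /\ x = (fl 0 P, fl (-1) Q).
Proof.
have n1 : (1 <= n)%N by lia.
have n2 : (2 <= n)%N by lia.
have mus2E := mu_star_step hn.
have posE (P Q : 'M[R]_n) : P *m P = P -> geom_rank P 1 ->
    Q *m Q = Q -> geom_rank Q n.-1 ->
    position mus (fl (-1) Q) (fl 0 P) <-> P *m (1%:M - Q) = 0.
  move=> PP Pr QQ Qr.
  have idemf (Om : closedFieldType) (t : {rmorphism kbar -> Om})
      (f : perfHom R (geom t)) (P' : 'M[R]_n) : P' *m P' = P' ->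
      (map_mx f P' : 'M[Om]_n) *m map_mx f P' = map_mx f P'.
    by move=> PP'; rewrite -[RHS](congr1 (map_mx f) PP') map_mxM.
  have rp (Om : closedFieldType) (t : {rmorphism kbar -> Om})
      (f : perfHom R (geom t)) :=
    rel_pos_LP W (t \o iota) (z := -1) n2 (idemf Om t f P PP) (idemf Om t f Q QQ)
      (Pr Om t f) (Qr Om t f) mus2E (mu_star_fst n).
  split=> [pos|PQ].
    apply: (geometric_mx0 iota) => Om t f; have := pos Om t f.
    rewrite !flag_pull // flag0 map_mxM map_mxB map_mx1.
    exact: (rp Om t f).1.
  move=> Om t f; rewrite !flag_pull // flag0.
  apply: (rp Om t f).2.
  by have := congr1 (map_mx f) PQ; rewrite map_mxM map_mxB map_mx1 map_mx0.
case: x => x y; split.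
  case=> -[/= Gx Gy px pxy py].
  have [P [PP Pr xE]] := (Gr_eqP x n1 (nu1_star_step hn)).1 (conj Gx px).
  have [Q [QQ Qr yE]] := (Gr_eqP y (leq_pred n) (nu1_tau1_star_step hn)).1 py.
  rewrite nu1_star_fst // in xE; rewrite nu1_tau1_star_fst // in yE; subst x y.
  by exists P, Q; split=> //; split=> //; apply/posE.
case=> P [Q [[PP Pr QQ Qr PQ] [-> ->]]].
have xG : Gr_eq la (fl 0 P).
  by apply/(Gr_eqP _ n1 (nu1_star_step hn)); exists P; rewrite nu1_star_fst.
have yG : Gr_eq ka (fl (-1) Q).
  by apply/(Gr_eqP _ (leq_pred n) (nu1_tau1_star_step hn)); exists Q; rewrite nu1_tau1_star_fst.
split=> //; split; [by case: xG|by case: yG|by case: xG|].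
exact/posE.
Qed.

Lemma Gr0P R (x : pobj (convP W iota n) R) : Gr0 x <->
  exists P Q, nested_flags P Q /\ x = (fl 0 P, fl (-1) Q).
Proof.
rewrite -Gr0_eqP /Gr0 /Gr0_le /Gr0_eq /Conv_le /Conv_eq /Gr_le /Gr_eq /=.
by rewrite (propext (bounded_step _ _ (nu1_star_step hn))) (propext (bounded_step _ _ (nu1_tau1_star_step hn)))
  (propext (bounded_step _ _ (mu_star_step hn))).
Qed.

Definition qmx R m r (P : 'M[R]_(m, r)) : 'M[R]_(m, r) :=
  map_mx (fun a => a ^+ #|k|) P.

Lemma twisted_frob_fl R (P : 'M[R]_n) : P *m P = P ->
  twisted_frob taus (fl 0 P) = fl (-1) (perp_mx (qmx P)).
Proof.
move=> PP; rewrite flag0 /twisted_frob /gr_frob /loop_act /=.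
rewrite -/(lat_dual _) frob_dual_LP // /lat_frob std_pull.
rewrite /flag exprN1; congr (_, _).
(* Since [taus] lives on G_m only, it just scales the line bundle by pi^-1. On the vector bundle the
   factor pi^-1 comes from dualizing. *)
have -> : map_mx fst (loop_pi W (restr iota R) taus).1 = 1%:M.
  by apply/matrixP => i j; rewrite !mxE; case: eqP.
by apply/seteqP; split=> [_ [y yP <-]|y yP]; [rewrite mul1mx|exists y; rewrite ?mul1mx].
Qed.
End Flags.

(** * The locus given by pi F(E^vee) inside E *)

Section Locus.
Context (O : idomainType) (pi : O) (k : finFieldType)
  (red : {rmorphism O -> k}) (W : wittFunctor pi red)
  (kbar : closedFieldType) (iota : {rmorphism k -> kbar})
  (n : nat) (hn : (3 <= n)%N).
Implicit Types R S : perfAlg kbar.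
Local Notation X := (grP W iota n).
Local Notation la := (cstar (nu1 n)).
Local Notation mus := (cstar (mu n)).
Local Notation taus := (cstar (tau1 n)).
Local Notation ka := (nu1 n + cstar (tau1 n)).
Local Notation fl z P := (flag W iota z P).
Local Notation fmx f := (map_mx (wittI_map W f)).

(** The last equation says that the hyperplane [ker P] contains the line orthogonal to its Frobenius
    twist. *)
Definition good_mx R (P : 'M[R]_n) :=
  [/\ P *m P = P, geom_rank P 1 & P *m (1%:M - perp_mx (qmx k P)) = 0].

Definition locus : subfunctor X := fun R =>
  [set x | exists2 P : 'M[R]_n, good_mx P & x = fl 0 P].

Lemma qmx_frob R m r (P : 'M[R]_(m, r)) :
  qmx k P = frobmx (R := restr iota R) P.
Proof. by []. Qed.

Lemma qmx_idem R (P : 'M[R]_n) : P *m P = P -> qmx k P *m qmx k P = qmx k P.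
Proof.
move=> PP; rewrite qmx_frob /frobmx.
by rewrite -[RHS](congr1 (map_mx (frob_hom (restr iota R))) PP) map_mxM.
Qed.

Lemma qmx_map R S (f : perfHom R S) m r (P : 'M[R]_(m, r)) :
  map_mx f (qmx k P) = qmx k (map_mx f P).
Proof. by apply/matrixP => i j; rewrite !mxE rmorphXn. Qed.

Lemma perp_mxC (A : comNzRingType) (P : 'M[A]_n) :
  1%:M - perp_mx P = antidiag A n *m P^T *m antidiag A n.
Proof. by rewrite /perp_mx opprB addrC subrK. Qed.

Lemma antidiag_unit (F : fieldType) : antidiag F n \in unitmx.
Proof. by have /mulmx1_unit[] := antidiagK F n. Qed.

Lemma rank_perpC (F : fieldType) (P : 'M[F]_n) :
  \rank (1%:M - perp_mx P) = \rank P.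
Proof.
rewrite perp_mxC mxrankMfree ?row_free_unit ?antidiag_unit //.
by rewrite eqmxMfull ?row_full_unit ?antidiag_unit // mxrank_tr.
Qed.

Lemma rank_perp (F : fieldType) (P : 'M[F]_n) s : P *m P = P ->
  \rank P = s -> \rank (perp_mx P) = (n - s)%N.
Proof.
move=> PP Ps; have := idem_rankC (perp_mx_idem PP); rewrite rank_perpC Ps => h.
apply/eqP; rewrite -(eqn_add2r s) h subnK //.
by rewrite -Ps rank_leq_row.
Qed.

Lemma geom_rank_qmx R (P : 'M[R]_n) s : geom_rank P s -> geom_rank (qmx k P) s.
Proof.
move=> Ps Om t f; rewrite qmx_map; have <- := Ps Om t f.
pose s' : {rmorphism Om -> Om} := perf_fun (frob_hom (restr iota (geom t))).
exact: (mxrank_map s').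
Qed.

Lemma geom_rank_perp R (P : 'M[R]_n) s : P *m P = P -> geom_rank P s ->
  geom_rank (perp_mx P) (n - s).
Proof.
move=> PP Ps Om t f; rewrite map_perp_mx; apply: rank_perp; last exact: Ps.
by rewrite -[RHS](congr1 (map_mx f) PP) map_mxM.
Qed.

Lemma good_nested R (P : 'M[R]_n) : good_mx P -> nested_flags P (perp_mx (qmx k P)).
Proof.
case=> PP Pr PQ; split=> //; first exact/perp_mx_idem/qmx_idem.
rewrite -subn1; apply: geom_rank_perp; first exact: qmx_idem.
exact: geom_rank_qmx.
Qed.

Lemma locusP R (x : pobj X R) : locus x <-> Gr_le la x /\
  [set piI W (restr iota R) *: y | y in lat_frob (lat_dual x.1)] `<=` x.1.
Proof.
have n1 : (1 <= n)%N by lia.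
have upi := piI_unit W (restr iota R).
have cond (P : 'M[R]_n) : P *m P = P ->
    [set piI W (restr iota R) *: y | y in lat_frob (lat_dual (fl 0 P).1)]
      `<=` (fl 0 P).1 <-> P *m (1%:M - perp_mx (qmx k P)) = 0.
  move=> PP; rewrite flag0 /= frob_dual_LP // -/(scale_set _ _) scale_setK //.
  rewrite (@LP_sub _ _ _ _ W (restr iota R) n _ P) //.
  exact/perp_mx_idem/(qmx_idem PP).
split=> [[P [PP Pr PQ] ->]|[Gx xsub]].
  split; last exact/cond.
  by apply/(Gr_leP _ n1 (nu1_star_step hn)); exists P; rewrite nu1_star_fst.
have [P [PP Pr xE]] := (Gr_leP x n1 (nu1_star_step hn)).1 Gx.
rewrite nu1_star_fst // in xE; exists P => //; split=> //.
by apply/cond => //; rewrite xE in xsub.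
Qed.

Lemma locus_Gr0_eq R (x : pobj X R) :
  locus x <-> Gr_eq la x /\ Gr0_eq la mus ka (R := R) (x, twisted_frob taus x).
Proof.
have n1 : (1 <= n)%N by lia.
split=> [[P gP ->]|[_ /(Gr0_eqP hn)[P [Q [[PP Pr QQ Qr PQ] E]]]]].
  have [PP Pr PQ] := gP; split.
    by apply/(Gr_eqP _ n1 (nu1_star_step hn)); exists P; rewrite nu1_star_fst.
  apply/(Gr0_eqP hn); exists P, (perp_mx (qmx k P)).
  by rewrite twisted_frob_fl //; split=> //; apply: good_nested.
have xE : x = fl 0 P := congr1 fst E.
have : twisted_frob taus x = fl (-1) Q := congr1 snd E.
rewrite xE twisted_frob_fl // => yE; exists P => //; split=> //.
have QQ' := perp_mx_idem (qmx_idem PP).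
(* The lattices coincide, but the idempotents Q and [perp_mx (qmx k P)] need only have the same
   kernel; the relation is passed from one to the other through P = P Q. *)
have Q0 : Q *m (1%:M - perp_mx (qmx k P)) = 0.
  by apply/(flag_sub W iota (-1) Q QQ'); rewrite yE.
have PQE : P = P *m Q.
  by apply/eqP; rewrite -subr_eq0 -{1}[P]mulmx1 -mulmxBr PQ.
by rewrite {1}PQE -mulmxA Q0 mulmx0.
Qed.

Lemma XopenP (C : subfunctor (convP W iota n)) : subf (@Gr0 _ _ _ _ W _ iota n) C ->
  forall R (x : pobj X R), Xopen la mus ka taus C x <-> locus x.
Proof.
move=> GC R x; split=> [[h1 _ h2]|/locus_Gr0_eq[h1 h2]].
  exact/locus_Gr0_eq.
by split=> //; apply: GC; apply/(Gr0P hn)/(Gr0_eqP hn).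
Qed.

Lemma lat_square (R : perfAlg k) m (e phi : 'M[wittI W R]_m) :
  e *m phi = 1%:M -> lat phi = latg e.
Proof.
move=> ephi; have [ue _] := mulmx1_unit ephi.
by rewrite latgE // -[phi](mulKmx ue) ephi mulmx1.
Qed.

Lemma GLW_map (R S : perfAlg k) (f : perfHom R S) m (A : 'M[wittI W R]_m) :
  GLW A -> GLW (fmx f A).
Proof.
case/GLWP => g [h [-> _ gh _]]; rewrite fmx_inc.
suff E : map_mx (witt_map W f) g *m map_mx (witt_map W f) h = 1%:M.
  by have [] := @GLW_inc _ _ _ _ W S m _ _ E.
by rewrite -map_mxM gh map_mx1.
Qed.

Lemma unitW_map (R S : perfAlg k) (f : perfHom R S) (c : wittI W R) :
  unitW c -> unitW (wittI_map W f c).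
Proof.
case=> [u i i']; split; [exact: rmorph_unit|exact: integral_map|].
by rewrite -rmorphV //; apply: integral_map.
Qed.

Lemma GLW_antidiag (R : perfAlg k) (c : wittI W R) :
  unitW c -> GLW (c *: antidiag (wittI W R) n).
Proof.
case=> [u i i']; have uJ := J_unit W R n.
split; first by rewrite unitmxZ.
  by apply: mxintZ => //; apply: mxint_antidiag.
rewrite invmxZ ?unitmxZ //; apply: mxintZ => //.
by rewrite -[invmx _]mulmx1 -(antidiagK _ n) mulKmx //; apply: mxint_antidiag.
Qed.

(** For a unit similitude factor, the inverse transpose in the first component of sigma(g) is
    exactly what dualizing a basis produces. *)
Lemma frob_dual_latg (R : perfAlg k) (g : loop W n R) : LG g -> unitW g.2 ->
  lat_frob (lat_dual (latg (loop1 g))) = latg (loop1 (loop_frob g)).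
Proof.
move=> Lg Uc; have uA := LG_unit Lg; set A := loop1 g.
have dp := latg_dual_pair uA; have ddp := dual_pair_dual dp.
rewrite latgE // (lat_dualE dp) /lat_frob (lat_pullE _ ddp).
have [E _] := dual_pair_pull (frob_hom R) ddp.
rewrite (lat_square E) loop_frob1 (LG_snd Lg) -/A.
have -> : g.2 *: (antidiag _ n *m (invmx A)^T *m antidiag _ n) =
    antidiag _ n *m (invmx A)^T *m (g.2 *: antidiag _ n) by rewrite scalemxAr.
rewrite [in RHS]map_mxM latg_GLW //; first by have [] := mulmx1_unit E.
by apply: GLW_map; apply: GLW_antidiag.
Qed.

Lemma loop_act_latg (R : perfAlg k) (h : loop W n R) A c :
  loop_act h (latg A, lats c) = (latg (loop1 h *m A), lats (h.2 * c)).
Proof.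
rewrite /loop_act /latg /lats /scale_set /loop1; congr (_, _).
  rewrite [X in image X]/fst; apply/seteqP; split=> [_ [_ [v vE <-] <-]|_ [v vE <-]].
    by exists v => //; rewrite mulmxA.
  by exists (A *m v); [exists v|rewrite mulmxA].
rewrite [X in image X]/snd; apply/seteqP; split=> [_ [_ [v vE <-] <-]|_ [v vE <-]].
  by exists v => //; rewrite scalerA.
by exists (c *: v); [exists v|rewrite scalerA].
Qed.

Lemma gr_frob_latg (R : perfAlg k) (g : loop W n R) : LG g -> unitW g.2 ->
  gr_frob (latg (loop1 g), lats g.2) = loop_act (loop_frob g) (gr_base W n R).
Proof.
move=> Lg Uc; have stdE : lats g.2 = @std_lattice _ _ _ _ W 1 R.
  have [u _ _] := Uc; rewrite -lats1; apply/lats_eq; rewrite ?unitr1 //.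
  by rewrite invr1 mul1r.
rewrite loop_actE /gr_frob /= stdE -/(lat_dual _) frob_dual_latg //.
rewrite /lat_frob std_pull; congr (_, _); rewrite -lats1.
have [u _ _] := unitW_map (frob_hom R) Uc.
apply/esym/lats_eq; rewrite ?unitr1 //.
by rewrite invr1 mul1r; apply: unitW_map.
Qed.

Lemma twisted_frob_latg (R : perfAlg k) (g : loop W n R) : LG g -> unitW g.2 ->
  loop_act (loop_pi W R taus) (gr_frob (latg (loop1 g), lats g.2)) =
  loop_act (loop_mul (loop_pi W R taus) (loop_frob g)) (gr_base W n R).
Proof.
by move=> Lg Uc; rewrite gr_frob_latg // !loop_actE loop_act_latg loop_mul1.
Qed.

(** The element g that realizes the position of pi^taus sigma(x) relative to x serves as
    representative. Then g pi^mus and pi^taus sigma(g) define the same point, so they differ on the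
    right by an element [h2] of L^+G, and [h1] can be taken to be 1. *)
Lemma locus_ADLV R (x : pobj X R) : locus x -> ADLV mus taus x.
Proof.
move=> lx; have [[Gx _] _] := (locus_Gr0_eq x).1 lx; split=> // Om t f RO.
have [[_ _ _ pos] _] := ((locus_Gr0_eq x).1 lx).2.
have [g [Lg E1 E2]] := pos Om t f.
have [P gP xE] := lx; have [PP Pr PQ] := gP.
have fPP : map_mx f P *m map_mx f P = map_mx f P.
  by rewrite -[RHS](congr1 (map_mx f) PP) map_mxM.
have fx0 : pres f x = fl 0 (map_mx f P) by rewrite xE flag_pull.
have tfx : pres f (twisted_frob taus x) = twisted_frob taus (pres f x).
  rewrite fx0 twisted_frob_fl // xE twisted_frob_fl // flag_pull.
    by rewrite map_perp_mx qmx_map.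
  exact/perp_mx_idem/qmx_idem.
have [ug cu] := ((LGP g).1 Lg); have uA := LG_unit Lg.
have Uc : unitW g.2.
  have : lats g.2 = lats 1.
    rewrite lats1; have := congr1 snd (E1 : pres f x = loop_act g (gr_base W n RO)); rewrite fx0 flag0 /= => ->.
    by [].
  by move/(lats_eq cu (unitr1 _)); rewrite invr1 mul1r.
exists g; split=> //.
have {}E2 : twisted_frob taus (pres f x) =
    loop_act (loop_mul g (loop_pi W RO mus)) (gr_base W n RO) := etrans (esym tfx) E2.
have {}E1 : pres f x = loop_act g (gr_base W n RO) := E1.
rewrite E1 /twisted_frob (twisted_frob_latg (R := RO)) // in E2.
pose h0 := loop_mul (loop_pi W RO taus) (loop_frob g).
pose g0 := loop_mul g (loop_pi W RO mus).
have Lh0 : LG h0 by apply: LG_mul; [exact: LG_pi|exact: LG_frob].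
have Lg0 : LG g0 by apply: LG_mul => //; exact: LG_pi.
have uh0 := LG_unit Lh0; have ug0 := LG_unit Lg0.
have [_ ch0] := (LGP h0).1 Lh0; have [_ cg0] := (LGP g0).1 Lg0.
have GB : GLW (invmx (loop1 g0) *m loop1 h0).
  by apply: latg_eq => //; have := congr1 fst E2; rewrite !loop_actE => /= ->.
have Ub : unitW (g0.2^-1 * h0.2).
  by apply/lats_eq => //; have := congr1 snd E2; rewrite !loop_actE => /= ->.
pose h2 := loop_mk (invmx (loop1 g0) *m loop1 h0) (g0.2^-1 * h0.2).
pose h1 : loop W n RO := loop_mk 1%:M 1.
have uGB : invmx (loop1 g0) *m loop1 h0 \in unitmx by case: GB.
have uUb : g0.2^-1 * h0.2 \is a GRing.unit by case: Ub.
have Lh2 : LG h2 by apply: LG_mk.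
have Lh1 : LG h1 by apply: LG_mk; rewrite ?unitmx1 ?unitr1.
exists mus, h1, h2; split.
- exact: step_dominant (mu_star_step hn).
- exact: cle_refl.
- apply/LGplusP; split=> //; last exact: unitW1.
  rewrite loop_mk1; split; rewrite ?unitmx1 ?invmx1 //;
    by apply: mxint_scalar; apply: integral1.
- by apply/LGplusP; split=> //; rewrite loop_mk1.
apply: LG_ext => //.
- by apply: LG_mul => //; apply: LG_mul => //; apply: LG_mul => //; apply: LG_pi.
- rewrite -/h0 !(loop_mul1 g) !(loop_mul1 h1) !loop_mk1 mul1mx loop_mul1 loop_mk1.
  by rewrite mulmxA -loop_mul1 -/g0 mulKVmx.
- have -> : (loop_mul g (loop_mul h1 (loop_mul (loop_pi W RO mus) h2))).2 =
     g0.2 * (g0.2^-1 * h0.2) by rewrite /= mul1r mulrA.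
  by rewrite mulVKr.
Qed.

Lemma closed_mxint (R : perfAlg k) m r (M : 'M[wittI W R]_(m, r)) :
  exists I : set R, forall (S : perfAlg k) (f : perfHom R S),
    mxint (fmx f M) <-> (forall a, I a -> f a = 0).
Proof.
pose c i j := cid (closed_integral (M i j)).
exists [set a | exists i j, projT1 (c i j) a] => S f; split=> [iM a [i [j]]|fI i j].
  by apply: ((projT2 (c i j)) S f).1; have := iM i j; rewrite mxE.
rewrite mxE; apply: ((projT2 (c i j)) S f).2 => a Ia.
by apply: fI; exists i, j.
Qed.
End Locus.

(** * Closedness of the locus in the affine Deligne-Lusztig variety *)

Section Closure.
Context (O : idomainType) (pi : O) (k : finFieldType)
  (red : {rmorphism O -> k}) (W : wittFunctor pi red)
  (kbar : closedFieldType) (iota : {rmorphism k -> kbar})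
  (n : nat) (hn : (3 <= n)%N).
Implicit Types R S : perfAlg kbar.
Local Notation la := (cstar (nu1 n)).
Local Notation mus := (cstar (mu n)).
Local Notation taus := (cstar (tau1 n)).
Local Notation redmx := (map_mx (witt_red W _)).
Local Notation fmx f := (map_mx (wittI_map W f)).
Local Notation locus := (@locus _ _ _ _ W _ iota n).

(** The functionals of the lattice evaluated on generators of pi F(E^vee): the dual lattice is
    generated by the columns of J phi^T. Integrality of this matrix is the inclusion defining the
    locus, in a form compatible with base change. *)
Definition frob_pairing (R : perfAlg k) r (phi : 'M[wittI W R]_(r, n)) :=
  piI W R *: (phi *m fmx (frob_hom R) (antidiag _ n *m phi^T)).

Lemma frob_pairing_map (R S : perfAlg k) (f : perfHom R S) r
    (phi : 'M[wittI W R]_(r, n)) :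
  fmx f (frob_pairing phi) = frob_pairing (fmx f phi).
Proof.
rewrite /frob_pairing map_mxZ map_mxM wittI_map_pi; congr (_ *: (_ *m _)).
have comm (b : wittI W R) : wittI_map W f (wittI_map W (frob_hom R) b) =
    wittI_map W (frob_hom S) (wittI_map W f b).
  pose h := perf_comp f (frob_hom R).
  have h1 : h =1 f \o frob_hom R by [].
  have h2 : h =1 frob_hom S \o f by move=> a; rewrite /= /frobq rmorphXn.
  by rewrite -[LHS](wittI_map_comp (W := W) h1 b) (wittI_map_comp (W := W) h2 b).
have commx a b (M : 'M_(a, b)) :
    fmx f (fmx (frob_hom R) M) = fmx (frob_hom S) (fmx f M).
  by apply/matrixP => i j; rewrite !mxE comm.
by rewrite commx map_mxM map_antidiag matrix.map_trmx.
Qed.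

Lemma frob_pairingP (R : perfAlg k) r (e : 'M[wittI W R]_(n, r)) phi :
  dual_pair e phi ->
  [set piI W R *: y | y in lat_frob (lat_dual (lat phi))] `<=` lat phi <->
  mxint (frob_pairing phi).
Proof.
move=> dp; have ddp := dual_pair_dual dp.
have fdp := dual_pair_pull (frob_hom R) ddp.
rewrite (lat_dualE dp) /lat_frob (lat_pullE _ ddp); split=> [sub|ip _ [x xE <-]].
  apply/mxint_col => j; have /sub : [set piI W R *: y | y in
      lat (fmx (frob_hom R) (e^T *m antidiag (wittI W R) n))]
      (piI W R *: col j (fmx (frob_hom R) (antidiag _ n *m phi^T))).
    by exists (col j (fmx (frob_hom R) (antidiag _ n *m phi^T))) => //; exact: lat_col.
  by rewrite /lat /= -scalemxAr !colE -scalemxAl mulmxA.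
have xE' : x = fmx (frob_hom R) (antidiag _ n *m phi^T) *m
    (fmx (frob_hom R) (e^T *m antidiag _ n) *m x).
  by rewrite mulmxA fdp.1 mul1mx.
rewrite /lat /= {1}xE' -scalemxAr (mulmxA phi) scalemxAl.
exact: mxintM.
Qed.

(** Let z be the valuation of the determinant of the first factor A of h. Up to a unit scalar, the
    first factor of sigma(h) is the Frobenius twist of J A^-T J, with determinant of valuation -z;
    [pi_mx taus] contributes 0 and [pi_mx mus] contributes -2. So -z = z - 2, that is z = 1, and the
    integral matrix A has elementary divisors pi, 1, ..., 1. *)
Lemma ADLV_position (Om : closedFieldType) (t : {rmorphism k -> Om})
    (h h1 h2 : loop W n (geom t)) (y : gr_obj W n (geom t)) :
  LG h -> unitW h.2 -> mxint (loop1 h) -> LGplus h1 -> LGplus h2 ->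
  loop_mul (loop_pi W (geom t) taus) (loop_frob h) =
    loop_mul h (loop_mul h1 (loop_mul (loop_pi W (geom t) mus) h2)) ->
  y = (latg (loop1 h), lats h.2) -> rel_pos la y (gr_base W n (geom t)).
Proof.
move=> Lh Uc iA /LGplusP[_ GH1 _] /LGplusP[_ GH2 _] eqh yE.
have n1 : (1 <= n)%N by lia.
have uA := LG_unit Lh; set A := loop1 h in uA iA yE *.
have upi := piI_unit W (geom t).
have [z [v [detA Uv]]] : exists z v, \det A = piI W (geom t) ^ z * v /\ unitW v.
  by apply: wittI_val; rewrite -unitmxE.
have s2 : loop2 h = h.2 *: (antidiag _ n *m (invmx A)^T *m antidiag _ n) := LG_snd Lh.
have det_taus : \det (pi_mx W (geom t) taus) = 1.
  rewrite (pi_mxE W (geom t) (s := 0) (t := 0)).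
    by rewrite expr0z scale1r det_Dmx ?expr0.
  by move=> i; rewrite /= !mxE /= oppr0.
have det_mus : \det (pi_mx W (geom t) mus) = piI W (geom t) ^ (- 2).
  rewrite (pi_mxE W (geom t) (mu_star_step hn)) detZ det_Dmx ?leq_subr //.
  rewrite -[_ ^+ (n - 2)]/(_ ^ (n - 2)%:Z) -[_ ^+ n]/(_ ^ n%:Z) exprz_exp -exprzDr //.
  by congr (_ ^ _); lia.
have JJ : \det (antidiag (wittI W (geom t)) n) * \det (antidiag (wittI W (geom t)) n) = 1.
  by rewrite -det_mulmx antidiagK det1.
pose sg := wittI_map W (frob_hom (geom t)).
have Usc m : unitW (sg h.2 ^+ m).
  have Us : unitW (sg h.2) := unitW_map _ Uc.
  by elim: m => [|m IH]; [exact: unitW1|rewrite exprS; apply: unitW_mul].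
have Usv : unitW (sg v) := unitW_map _ Uv.
have E : sg h.2 ^+ n * (piI W (geom t) ^ z * sg v)^-1 = piI W (geom t) ^ z * v *
    (\det (loop1 h1) * (piI W (geom t) ^ (- 2) * \det (loop1 h2))).
  have := congr1 (fun g : loop W n (geom t) => \det (loop1 g)) eqh.
  rewrite !loop_mul1 !loop_pi1 !det_mulmx det_taus det_mus mul1r -/A detA => <-.
  rewrite loop_frob1 s2 map_mxZ detZ det_map_mx !det_mulmx det_tr det_inv detA.
  by rewrite mulrAC JJ mul1r -/sg rmorphV -?detA -?unitmxE // detA rmorphM
    rmorphXz // wittI_map_pi.
have z1 : z = 1.
  have U : unitW (piI W (geom t) ^ (2 * z - 2)).
    have Ud1 := GLW_det GH1; have Ud2 := GLW_det GH2.
    have Ud := unitW_mul Uv (unitW_mul Ud1 Ud2).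
    have -> : piI W (geom t) ^ (2 * z - 2) = sg h.2 ^+ n * (sg v)^-1 *
        (v * (\det (loop1 h1) * \det (loop1 h2)))^-1.
      have [ud _ _] := Ud; have [usv _ _] := Usv.
      apply: (mulIr ud); rewrite divrK //.
      have upz : piI W (geom t) ^ z \is a GRing.unit by rewrite unitrXz.
      have sc : sg h.2 ^+ n = piI W (geom t) ^ z * v *
          (\det (loop1 h1) * (piI W (geom t) ^ (- 2) * \det (loop1 h2))) *
          (piI W (geom t) ^ z * sg v) by rewrite -E divrK // unitrM upz.
      rewrite sc [in RHS]mulrA mulrK //.
      have -> : piI W (geom t) ^ (2 * z - 2) =
          piI W (geom t) ^ z * piI W (geom t) ^ z * piI W (geom t) ^ (- 2).
        by rewrite -!exprzDr //; congr (_ ^ _); lia.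
      by ring.
    by apply: unitW_mul; [apply: unitW_mul => //|]; apply: unitW_inv.
  by have := unitW_expz U; lia.
subst z.
(* As det A is pi times a unit, this matrix is the adjugate of A up to a unit. *)
have iA' : mxint (piI W (geom t) *: invmx A).
  have [uv _ iv'] := Uv; have /mxintP[a aE] := iA.
  rewrite /invmx uA scalerA detA invrM ?expr1z // mulrCA mulrV // mulr1.
  by apply: mxintZ => //; rewrite aE -map_mx_adj; apply: mxint_inc.
have [s [G [Q [sn GG GQ AE]]]] := minuscule_decomp uA iA iA'.
have s1 : s = 1%N.
  have [w Uw wE] := det_GD (t := t) sn GG.
  have : unitW (piI W (geom t) ^ (s%:Z - 1)).
    have -> : piI W (geom t) ^ (s%:Z - 1) = v * (w * \det Q)^-1.
      have Uwq := unitW_mul Uw (GLW_det GQ); have [uwq _ _] := Uwq.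
      apply: (mulIr uwq); rewrite divrK // exprzDr //.
      apply: (mulIr upi); rewrite [RHS]mulrC -[_ * v in RHS]/(piI W (geom t) ^ 1 * v).
      rewrite -detA AE det_mulmx wE exprN1 mulrAC divrK //; ring.
    by apply: unitW_mul => //; apply: unitW_inv; apply: unitW_mul => //; apply: GLW_det.
  by move/unitW_expz; lia.
have laE0 i : (cstar (nu1 n)).2 0 i = (i < 1)%:R + 0 by rewrite (nu1_star_step hn) nu1_star_fst.
apply/(rel_pos_base _ laE0); exists G => //.
rewrite yE AE s1; have [uG _ _] := GG.
rewrite latg_GLW ?unitmx_mul ?uG ?pi_mx_unit // scale_latg expr0z scale1r; congr (_, _).
rewrite nu1_star_fst // expr0z; have [uc _ _] := Uc.
by apply/lats_eq; rewrite ?unitr1 // invr1 mul1r.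
Qed.

(* On the points of ADLV, the locus is cut out by the integrality of finitely
   many elements of W_O(R)[1/pi]. *)
Lemma locus_closed : closed_in (ADLV mus taus) locus.
Proof.
split=> [R x|R x [[xlat1 xlat2] xpos]]; first exact: locus_ADLV.
have [r [e [phi [dp x1E]]]] := (is_latticeP x.1).1 xlat1.
have [q [d [psi [dq x2E]]]] := (is_latticeP x.2).1 xlat2.
(* For the pair (E, L) the four conditions say that E lies in W^n, that L lies in W, that W lies in
   L, and that pi F(E^vee) lies in E. *)
have [I1 I1P] := closed_mxint e; have [I2 I2P] := closed_mxint d.
have [I3 I3P] := closed_mxint psi; have [I4 I4P] := closed_mxint (frob_pairing phi).
exists (I1 `|` I2 `|` I3 `|` I4) => S f.
have y1E : (pres f x).1 = lat (fmx (restr_hom iota f) phi).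
  by rewrite /= x1E (lat_pullE _ dp).
have y2E : (pres f x).2 = lat (fmx (restr_hom iota f) psi).
  by rewrite /= x2E (lat_pullE _ dq).
have dpf := dual_pair_pull (restr_hom iota f) dp.
have dqf := dual_pair_pull (restr_hom iota f) dq.
have colstd m' (E : set 'cV[wittI W (restr iota S)]_m') r' (M : 'M_(m', r')) :
    (forall j, E (col j M)) -> E `<=` @std_lattice _ _ _ _ W m' (restr iota S) ->
    mxint M.
  by move=> EM Estd i j; have := Estd _ (EM j) i; rewrite mxE.
split.
  move=> /(locusP hn)[Gy ysub].
  have n1 : (1 <= n)%N by lia.
  have [P [PP Pr yE]] := (Gr_leP _ n1 (nu1_star_step hn)).1 Gy.
  rewrite nu1_star_fst // flag0 in yE.
  have ie : mxint (fmx (restr_hom iota f) e).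
    apply: (colstd _ (pres f x).1) => [j|]; first by rewrite y1E; apply: lat_col dpf.
    by rewrite yE; apply: LP_sub_std.
  have id : mxint (fmx (restr_hom iota f) d).
    apply: (colstd _ (pres f x).2) => [j|]; first by rewrite y2E; apply: lat_col dqf.
    by rewrite yE.
  have ipsi : mxint (fmx (restr_hom iota f) psi).
    have : lat (fmx (restr_hom iota f) psi) 1%:M.
      rewrite -y2E yE => i /=; rewrite ord1 mxE; exact: integral1.
    by rewrite /lat /= mulmx1.
  have ip : mxint (fmx (restr_hom iota f) (frob_pairing phi)).
    rewrite frob_pairing_map; apply/(frob_pairingP dpf).
    by rewrite -y1E.
  move=> a [[[Ia|Ia]|Ia]|Ia].
  - exact: (I1P _ (restr_hom iota f)).1 ie a Ia.
  - exact: (I2P _ (restr_hom iota f)).1 id a Ia.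
  - exact: (I3P _ (restr_hom iota f)).1 ipsi a Ia.
  - exact: (I4P _ (restr_hom iota f)).1 ip a Ia.
move=> fI.
have ie : mxint (fmx (restr_hom iota f) e).
  by apply/I1P => a Ia; apply: fI; do 3 left.
have id : mxint (fmx (restr_hom iota f) d).
  by apply/I2P => a Ia; apply: fI; do 2 left; right.
have ipsi : mxint (fmx (restr_hom iota f) psi).
  by apply/I3P => a Ia; apply: fI; left; right.
have ip : mxint (fmx (restr_hom iota f) (frob_pairing phi)).
  by apply/I4P => a Ia; apply: fI; right.
have y2std : (pres f x).2 = @std_lattice _ _ _ _ W 1 (restr iota S).
  rewrite y2E std_latticeE; apply/seteqP; split=> v; rewrite /lat /= mul1mx.
    by move=> iv; rewrite -[v]mul1mx -dqf.1 -mulmxA; apply: mxintM.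
  by move=> iv; apply: mxintM.
apply/(locusP hn); split; last first.
  rewrite y1E; apply/(frob_pairingP dpf); rewrite -frob_pairing_map.
  exact: ip.
have Gx : Gr x by [].
have Gy : Gr (pres f x) by apply: is_Gr_pull.
split=> //; apply/(bounded_step _ _ (nu1_star_step hn)) => Om t g.
rewrite base_pull -(pres_comp (h := perf_comp g f)) //.
(* The representative h comes from x being in the affine Deligne-Lusztig variety. The equations make
   its similitude factor a unit, since L = W, and its first factor integral, since E lies in W^n;
   these are the hypotheses of [ADLV_position]. *)
have [h [Lh hE [la' [h1 [h2 [dom' le' Lh1 Lh2 eqh]]]]]] := xpos Om t (perf_comp g f).
have la'E := cle_step (mu_star_step hn) dom' le'; subst la'.
have zE : pres (perf_comp g f) x = pres g (pres f x) by apply: pres_comp.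
have n1 : (1 <= n)%N by lia.
have uA := LG_unit Lh; have [_ cu] := (LGP h).1 Lh.
have {}hE : pres g (pres f x) = (latg (loop1 h), lats h.2) := etrans (esym zE) hE.
have Uc : unitW h.2.
  have : lats h.2 = lats 1.
    rewrite lats1 -[LHS]/((latg (loop1 h), lats h.2).2) -hE.
    by rewrite -[LHS]/(lat_pull (restr_hom iota g) (pres f x).2) y2std std_pull.
  by move/(lats_eq cu (unitr1 _)); rewrite invr1 mul1r.
have iA : mxint (loop1 h).
  have hlat : latg (loop1 h) = lat (fmx (restr_hom iota g) (fmx (restr_hom iota f) phi)).
    by rewrite -(lat_pullE _ dpf) -y1E -[LHS]/((latg (loop1 h), lats h.2).1) -hE.
  have [gephi _] := dual_pair_pull (restr_hom iota g) dpf.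
  apply/mxint_col => j; rewrite -[col j _]mul1mx -gephi -mulmxA.
  apply: mxintM; first exact: mxint_fmx.
  have : latg (loop1 h) (col j (loop1 h)).
    by rewrite latgE //; apply: lat_col (latg_dual_pair uA).
  by rewrite hlat.
rewrite zE; apply: (ADLV_position (t := t \o iota) Lh Uc iA Lh1 Lh2 eqh hE).
Qed.
End Closure.

(** * Irreducibility *)

Section PerfectLocalization.
Context (A B : comNzRingType) (psi : {rmorphism A -> B}) (d : A)
  (cp : {p | p \in [pchar B]}).
Local Notation p := (sval cp).

(** Inside an algebraically closed field B with [psi d] nonzero, this is the perfection of
    psi(A)[1/psi(d)]. It is defined for arbitrary rings B so as to apply also to a product of two
    fields, where it is the graph of a map between such perfections. *)
Definition perf_loc : {pred B} := fun b =>
  `[< exists m j a, b ^+ (p ^ m) * psi d ^+ j = psi a >].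

Lemma perf_loc_subring : subring_closed perf_loc.
Proof.
have charp := svalP cp.
have charX m : [pchar B].-nat (p ^ m)%N.
  by rewrite pnatX (eq_pnat _ (pcharf_eq charp)) pnat_id ?(pcharf_prime charp).
split.
- by apply/asboolP; exists 0%N, 0%N, 1; rewrite expr1n mul1r rmorph1.
- move=> x y /asboolP[m [j [a xE]]] /asboolP[m' [j' [a' yE]]]; apply/asboolP.
  exists (m + m')%N, (j * p ^ m' + j' * p ^ m)%N.
  exists (a ^+ (p ^ m') * d ^+ (j' * p ^ m) +
          (-1) ^+ (p ^ (m + m')) * (a' ^+ (p ^ m) * d ^+ (j * p ^ m'))).
  rewrite rmorphD !rmorphM !rmorphXn rmorphN1 -xE -yE.
  rewrite exprDn_pchar ?charX // [(- y) ^+ _]exprNn !exprMn -!exprM !expnD exprD.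
  by rewrite [(p ^ m' * p ^ m)%N]mulnC; ring.
- move=> x y /asboolP[m [j [a xE]]] /asboolP[m' [j' [a' yE]]]; apply/asboolP.
  exists (m + m')%N, (j * p ^ m' + j' * p ^ m)%N, (a ^+ (p ^ m') * a' ^+ (p ^ m)).
  rewrite rmorphM !rmorphXn -xE -yE !exprMn -!exprM !expnD exprD.
  by rewrite [(p ^ m' * p ^ m)%N]mulnC; ring.
Qed.
HB.instance Definition _ := GRing.isSubringClosed.Build B perf_loc perf_loc_subring.

Definition perf_loc_ring := {b : B | perf_loc b}.
HB.instance Definition _ := [isSub of perf_loc_ring for sval].
HB.instance Definition _ := [Choice of perf_loc_ring by <:].
HB.instance Definition _ := [SubChoice_isSubComNzRing of perf_loc_ring by <:].

Lemma perf_loc_img a : perf_loc (psi a).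
Proof. by apply/asboolP; exists 0%N, 0%N, a; rewrite expn0 expr1 mulr1. Qed.

Lemma perf_loc_inv b a : b * psi d = psi a -> perf_loc b.
Proof. by move=> ba; apply/asboolP; exists 0%N, 1%N, a; rewrite expn0 !expr1. Qed.
End PerfectLocalization.

(** The iterated polynomial ring, the new variable being the one of index [ord_max]; only the
    existence of specializations is recorded. *)
Lemma poly_family (K : fieldType) N :
  exists (A : idomainType) (s : {rmorphism K -> A}) (x : 'I_N -> A),
    forall (B : comNzRingType) (t : {rmorphism K -> B}) (b : 'I_N -> B),
      exists phi : {rmorphism A -> B},
        (forall c, phi (s c) = t c) /\ forall i, phi (x i) = b i.
Proof.
elim: N => [|N [A [s [x xP]]]].
  exists K, idfun, (fun=> 0).
  by move=> B t b; exists t; split=> // -[].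
exists {poly A}, (polyC \o s),
  (fun i => if unlift ord_max i is Some j then (x j)%:P else 'X).
move=> B t b; have [phi [phis phix]] := xP B t (fun j => b (lift ord_max j)).
exists (horner_eval (b ord_max) \o map_poly phi); split=> [c|i] /=.
  by rewrite map_polyC /= horner_evalE hornerC phis.
case: unliftP => [j ->|->] /=.
  by rewrite map_polyC /= horner_evalE hornerC phix.
by rewrite map_polyX horner_evalE hornerX.
Qed.

(* The perfection of kbar[x_ij][1/det], inside an algebraic closure of the
   function field. *)
Lemma universal_matrix (k : finFieldType) (kbar : closedFieldType)
    (iota : {rmorphism k -> kbar}) (n : nat) :
  exists (R : perfAlg kbar) (g h : 'M[R]_n),
  [/\ g *m h = 1%:M,
      exists (Om : closedFieldType) (t : {rmorphism kbar -> Om})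
        (f : perfHom R (geom t)), injective f &
      forall (Om : closedFieldType) (t : {rmorphism kbar -> Om}) (B : 'M[Om]_n),
        B \in unitmx -> exists f : perfHom R (geom t), map_mx f g = B].
Proof.
have [A [s [x xP]]] := poly_family kbar (n * n).
have [p0 _ charp0] := finPcharP k.
pose X : 'M[A]_n := \matrix_(i, j) x (mxvec_index i j).
have XP (B : comNzRingType) (t : {rmorphism kbar -> B}) (M : 'M[B]_n) :
    exists phi : {rmorphism A -> B},
      (forall c, phi (s c) = t c) /\ map_mx phi X = M.
  have [phi [phis phix]] := xP B t (fun l => mxvec M 0 l).
  exists phi; split=> //; apply/matrixP => i j.
  by rewrite !mxE phix mxvecE.
pose d := \det X.
have d0 : d != 0.
  have [phi [_ phiX]] := XP kbar idfun 1%:M.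
  apply: contraTneq (oner_neq0 kbar) => d0; rewrite negbK.
  by rewrite -(det1 kbar n) -phiX det_map_mx -/d d0 rmorph0.
have [Om0 [h0 _]] := exists_closed_extension {fraction A}.
pose psi : {rmorphism A -> Om0} := h0 \o (@tofrac A).
have psi_inj : injective psi.
  by move=> a b /fmorph_inj/eqP; rewrite tofrac_eq => /eqP.
have charOm0 : p0 \in [pchar Om0] := rmorph_pchar (psi \o (s \o iota)) charp0.
pose cp : {p | p \in [pchar Om0]} := exist _ p0 charOm0.
pose R0 := @perf_loc_ring A Om0 psi d cp.
have R0perf : perfect R0.
  move=> q charq; pose v : {rmorphism R0 -> Om0} := val.
  have qE : q = p0.
    have charq' := rmorph_pchar v charq.
    by apply/eqP; rewrite -[_ == _]/(q \in (p0 : nat_pred)) -(pcharf_eq charOm0).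
  have [root rootK rootK'] := closed_perfect charOm0; subst q.
  have root_in (y : R0) : perf_loc psi d cp (root (val y)).
    have /asboolP[m [j [a yE]]] := valP y.
    apply/asboolP; exists m.+1, j, a; rewrite expnS exprM.
    by rewrite -yE; congr (_ ^+ _ * _); exact: rootK'.
  have vX (z : R0) : val (z ^+ p0) = val z ^+ p0 := rmorphXn v p0 z.
  exists (fun y => exist _ (root (val y)) (root_in y)) => y; apply: val_inj.
    by rewrite /= [X in root X]vX rootK.
  by rewrite vX /= rootK'.
pose v : {rmorphism R0 -> Om0} := val.
have psi_in a : perf_loc psi d cp (psi a) := perf_loc_img psi d cp a.
pose toR (a : A) : R0 := exist _ (psi a) (psi_in a).
have toRD : nmod_morphism toR.
  by split=> [|a b]; apply: val_inj; rewrite /= ?rmorph0 ?rmorphD.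
have toRM : monoid_morphism toR.
  by split=> [|a b]; apply: val_inj; rewrite /= ?rmorph1 ?rmorphM.
pose toRm : {rmorphism A -> R0} :=
  HB.pack toR (GRing.isNmodMorphism.Build A R0 toR toRD)
    (GRing.isMonoidMorphism.Build A R0 toR toRM).
pose R : perfAlg kbar := PerfAlg (toRm \o s) R0perf.
have dV : psi d != 0 by rewrite -(rmorph0 psi) (inj_eq psi_inj).
have dinv_in : perf_loc psi d cp (psi d)^-1.
  by apply: (@perf_loc_inv _ _ psi d cp _ 1); rewrite mulVf // rmorph1.
pose dinv : R0 := exist (fun b => is_true (perf_loc psi d cp b)) _ dinv_in.
have dinvE : toRm d * dinv = 1 by apply: val_inj; rewrite /= mulfV.
pose g : 'M[R]_n := map_mx toRm X.
exists R, g, (dinv *: \adj g); split.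
- rewrite -scalemxAr mul_mx_adj det_map_mx -/d scale_scalar_mx mulrC.
  by rewrite (dinvE : toRm d * dinv = 1).
- exists Om0, (psi \o s).
  by exists (@PerfHom kbar R (geom (psi \o s)) v (fun=> erefl)); exact: val_inj.
move=> Om t B uB; have [phi [phis phiX]] := XP Om t B.
have charOm : p0 \in [pchar Om] := rmorph_pchar (t \o iota) charp0.
pose BB := (Om0 * Om)%type.
have charBB : p0 \in [pchar BB].
  rewrite inE (pcharf_prime charp0) /=; apply/eqP.
  have E m : m%:R = (m%:R, m%:R) :> BB.
    by elim: m => [//|m IH]; rewrite !mulrS IH.
  by rewrite E (pcharf0 charOm0) (pcharf0 charOm).
pose psi2 (a : A) : BB := (psi a, phi a).
have psi2D : nmod_morphism psi2.
  by split=> [|a b]; rewrite /psi2 ?rmorph0 ?rmorphD.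
have psi2M : monoid_morphism psi2.
  by split=> [|a b]; rewrite /psi2 ?rmorph1 ?rmorphM.
pose psi2m : {rmorphism A -> BB} :=
  HB.pack psi2 (GRing.isNmodMorphism.Build A BB psi2 psi2D)
    (GRing.isMonoidMorphism.Build A BB psi2 psi2M).
pose cpB : {p | p \in [pchar BB]} := exist _ p0 charBB.
(* The graph of the extension of phi to [R0]. Being a subring of the product, it yields a ring
   morphism as soon as it is the graph of a function. *)
pose Rel y z := (y, z) \in @perf_loc A BB psi2m d cpB.
have pairX (u : Om0) (w : Om) m : ((u, w) : BB) ^+ m = (u ^+ m, w ^+ m).
  by elim: m => [//|m IH]; rewrite !exprS IH.
have RelP y z : Rel y z <-> exists m j a,
    y ^+ (p0 ^ m) * psi d ^+ j = psi a /\ z ^+ (p0 ^ m) * phi d ^+ j = phi a.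
  split=> [/asboolP[m [j [a]]]|[m [j [a [yE zE]]]]].
    by rewrite /= !pairX => -[yE zE]; exists m, j, a.
  by apply/asboolP; exists m, j, a; rewrite /= !pairX; congr (_, _).
have phid : phi d != 0.
  by move: uB; rewrite unitmxE unitfE -phiX det_map_mx.
(* By subtraction only the pair (0, z - z') matters: injectivity of psi makes the numerator a
   vanish, and [phi d] is nonzero because B is invertible. *)
have Rel_uniq y z z' : Rel y z -> Rel y z' -> z = z'.
  move=> yz yz'; have : Rel 0 (z - z').
    rewrite /Rel (_ : (0, z - z') = ((y, z) : BB) - (y, z')); first exact: rpredB.
    by congr (_, _); rewrite subrr.
  case/RelP => m [j [a [aE]]].
  have pm : (p0 ^ m)%N != 0%N by rewrite expn_eq0 (gtn_eqF (prime_gt0 (pcharf_prime charp0))).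
  have a0 : a = 0.
    by apply: psi_inj; rewrite -aE expr0n (negPf pm) mul0r rmorph0.
  rewrite a0 rmorph0 => /eqP; rewrite mulf_eq0 [X in _ || X]expf_eq0 (negPf phid) andbF orbF.
  by rewrite expf_eq0 subr_eq0 => /andP[_ /eqP].
have Rel_ex (y : R0) : exists z, Rel (val y) z.
  have /asboolP[m [j [a yE]]] := valP y.
  have [z zE] := perfect_root charOm (@closed_perfect Om) m (phi a / phi d ^+ j).
  exists z; apply/RelP; exists m, j, a; split=> //.
  by rewrite zE divfK // expf_neq0.
pose f (y : R0) : Om := projT1 (cid (Rel_ex y)).
have fP y : Rel (val y) (f y) := projT2 (cid (Rel_ex y)).
have fD : nmod_morphism f.
  split=> [|y y'].
    by apply: (Rel_uniq 0) => //; [exact: fP 0|exact: rpred0].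
  apply: (Rel_uniq (val y + val y')); first exact: fP (y + y').
  exact: (rpredD (fP y) (fP y')).
have fM : monoid_morphism f.
  split=> [|y y'].
    by apply: (Rel_uniq 1) => //; [exact: fP 1|exact: rpred1].
  apply: (Rel_uniq (val y * val y')); first exact: fP (y * y').
  exact: (rpredM (fP y) (fP y')).
pose fm : {rmorphism R0 -> Om} :=
  HB.pack f (GRing.isNmodMorphism.Build R0 Om f fD)
    (GRing.isMonoidMorphism.Build R0 Om f fM).
have f_img a : f (toR a) = phi a.
  by apply: (Rel_uniq (psi a)); [exact: fP (toR a)|exact: (perf_loc_img psi2m)].
have fs c : fm (perf_str R c) = perf_str (geom t) c.
  by rewrite -[LHS]/(f (toR (s c))) f_img phis.
exists (@PerfHom kbar R (geom t) fm fs).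
by rewrite -phiX; apply/matrixP => i j; rewrite !mxE -[LHS]/(f (toR _)) f_img.
Qed.

(** * Transitivity of GL_n on flags *)

Section FlagTransitivity.
Context (F : fieldType) (n : nat).

Lemma delta_tperm (i j : 'I_n) :
  delta_mx 0 i *m tperm_mx i j = delta_mx 0 j :> 'rV[F]_n.
Proof.
rewrite -rowE; apply/rowP => l; rewrite !mxE tpermL eqxx /=.
by rewrite eq_sym.
Qed.

Lemma tperm_delta (i j : 'I_n) :
  tperm_mx i j *m delta_mx j 0 = delta_mx i 0 :> 'cV[F]_n.
Proof.
rewrite -colE; apply/colP => l; rewrite !mxE andbT; congr _%:R.
by rewrite (can2_eq (tpermK i j) (tpermK i j)) tpermR.
Qed.

Lemma row_completion (i0 : 'I_n) (h : 'rV[F]_n) : h != 0 ->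
  exists2 B : 'M[F]_n, B \in unitmx & delta_mx 0 i0 *m B = h.
Proof.
move=> h0; have z_lt : (0 < n)%N by rewrite (leq_ltn_trans (leq0n i0)).
pose z : 'I_n := Ordinal z_lt.
have rh : \rank h = 1%N.
  by apply/eqP; rewrite eqn_leq rank_leq_row lt0n mxrank_eq0.
have pidE : pid_mx (\rank h) = delta_mx 0 z :> 'rV[F]_n.
  apply/rowP => j; rewrite rh !mxE eqxx andbT -[j == z]/(val j == val z) /=.
  by rewrite eq_sym.
have hE := mulmx_ebase h; rewrite pidE in hE.
have [a aE] : exists a, col_ebase h = a%:M by exists (col_ebase h 0 0); exact: mx11_scalar.
have a0 : a != 0.
  by have := col_ebase_unit h; rewrite aE unitmxE det_scalar1 unitfE.
exists (tperm_mx i0 z *m (a *: row_ebase h)).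
  by rewrite unitmx_mul unitmx_perm unitmxZ ?unitfE // row_ebase_unit.
by rewrite mulmxA delta_tperm -scalemxAr -[RHS]hE aE mul_scalar_mx scalemxAl.
Qed.

Lemma flag_completion (i0 i1 : 'I_n) (h : 'rV[F]_n) (v : 'cV[F]_n) : i0 != i1 ->
  h != 0 -> v != 0 -> h *m v = 0 ->
  exists B d, [/\ B \in unitmx, d != 0, delta_mx 0 i0 *m B = h &
    B *m v = d *: delta_mx i1 0].
Proof.
move=> i01 h0 v0 hv; have [B1 uB1 B1E] := row_completion i0 h0.
have [v1 v1E] : exists v1, v1 = B1 *m v by exists (B1 *m v).
have v1_0 : v1 i0 0 = 0.
  have /matrixP/(_ 0 0) := hv; rewrite -B1E -mulmxA -v1E -rowE mxE => ->.
  by rewrite mxE.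
have v1n : v1 != 0.
  by apply: contra_neq v0 => v10; rewrite -[v](mulKmx uB1) -v1E v10 mulmx0.
have [l v1l] : exists l, v1 l 0 != 0.
  by have /cV0Pn[l] := v1n; exists l.
have li0 : (l == i0) = false by apply/negbTE; apply: contra_neq v1l => ->.
(* The transvection 1 - u e clears all coordinates of v1 except the l-th; it is invertible since e u
   = 0, and it fixes the row [delta_mx 0 i0] since u has no i0-th coordinate. A transposition then
   moves l to i1. *)
pose u := (v1 l 0)^-1 *: v1 - delta_mx l 0.
pose e : 'rV[F]_n := delta_mx 0 l.
have eu : e *m u = 0.
  by apply/matrixP => i j; rewrite !ord1 -rowE !mxE eqxx mulVf // subrr.
pose E := 1%:M - u *m e.
have uE : E \in unitmx.
  have : E *m (1%:M + u *m e) = 1%:M.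
    rewrite /E mulmxBl mul1mx mulmxDr mulmx1 -mulmxA (mulmxA e) eu mul0mx mulmx0.
    by rewrite addr0 addrK.
  by case/mulmx1_unit.
have Ev : E *m v1 = v1 l 0 *: delta_mx l 0.
  rewrite /E mulmxBl mul1mx -mulmxA.
  have -> : e *m v1 = (v1 l 0)%:M by apply/matrixP => i j; rewrite !ord1 -rowE !mxE mulr1n.
  rewrite mul_mx_scalar /u scalerBr scalerA divff // scale1r.
  by rewrite opprB addrC subrK.
have Ei0 : delta_mx 0 i0 *m E = delta_mx 0 i0 :> 'rV[F]_n.
  rewrite /E mulmxBr mulmx1 mulmxA.
  have -> : delta_mx 0 i0 *m u = 0 :> 'M_1.
    apply/matrixP => i j; rewrite !ord1 -rowE !mxE v1_0 mulr0 eq_sym li0.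
    by rewrite subr0.
  by rewrite mul0mx subr0.
have Ti0 : delta_mx 0 i0 *m tperm_mx i1 l = delta_mx 0 i0 :> 'rV[F]_n.
  rewrite -rowE; apply/rowP => j; rewrite !mxE tpermD ?(eq_sym i1) // ?li0 //.
  by rewrite eq_sym.
exists (tperm_mx i1 l *m E *m B1), (v1 l 0); split=> //.
- by rewrite !unitmx_mul unitmx_perm uE.
- by rewrite !mulmxA Ti0 Ei0.
- by rewrite -!mulmxA -v1E Ev -scalemxAr tperm_delta.
Qed.

Lemma rank1_factor (P : 'M[F]_n) : \rank P = 1%N ->
  exists (c : 'cV[F]_n) (h : 'rV[F]_n), [/\ P = c *m h, c != 0 & h != 0].
Proof.
move=> Pr; have PE := mulmx_base P; move: PE.
move: (col_base P) (row_base P); rewrite Pr => c h PE; exists c, h; split=> //.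
  by apply: contra_eq_neq Pr => c0; rewrite -PE c0 mul0mx mxrank0.
by apply: contra_eq_neq Pr => h0; rewrite -PE h0 mulmx0 mxrank0.
Qed.

Lemma cv_rv_neq0 (c : 'cV[F]_n) (h : 'rV[F]_n) a :
  c != 0 -> h != 0 -> c *m a%:M *m h = 0 -> a = 0.
Proof.
move=> /cV0Pn[i ci] /rV0Pn[j hj] /matrixP/(_ i j).
rewrite mul_mx_scalar -scalemxAl !mxE big_ord1 => /eqP.
by rewrite !mulf_eq0 (negPf ci) (negPf hj) !orbF => /eqP.
Qed.

Lemma idem_factor (c : 'cV[F]_n) (h : 'rV[F]_n) : c != 0 -> h != 0 ->
  c *m h *m (c *m h) = c *m h -> h *m c = 1%:M.
Proof.
move=> c0 h0 PP; apply/eqP; rewrite -subr_eq0 [h *m c]mx11_scalar -raddfB.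
have -> : (h *m c) 0 0 - 1 = 0; last by rewrite raddf0.
apply: (cv_rv_neq0 c0 h0); rewrite raddfB /= -mx11_scalar mulmxBr mulmxBl mulmx1.
by rewrite mulmxA -mulmxA PP subrr.
Qed.

(* GL_n is transitive on pairs (ker P, ker Q) of a hyperplane and a line in it. *)
Lemma flag_transitive (i0 i1 : 'I_n) (P Q : 'M[F]_n) : i0 != i1 ->
  P *m P = P -> \rank P = 1%N -> Q *m Q = Q -> \rank Q = n.-1 ->
  P *m (1%:M - Q) = 0 ->
  exists A, [/\ A \in unitmx,
    P *m (1%:M - A *m delta_mx i0 i0 *m invmx A) = 0,
    A *m delta_mx i0 i0 *m invmx A *m (1%:M - P) = 0,
    Q *m (A *m delta_mx i1 i1 *m invmx A) = 0 &
    (1%:M - A *m delta_mx i1 i1 *m invmx A) *m (1%:M - Q) = 0].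
Proof.
move=> i01 PP Pr QQ Qr PQ.
have n_gt0 : (0 < n)%N by rewrite (leq_ltn_trans (leq0n i0)).
(* With P = c h and 1 - Q = v w, the hyperplane [ker P] is that of h and v spans the line [ker Q];
   the incidence becomes h v = 0. The four equations to prove compare these kernels with those of
   the idempotents moved by A. *)
have [c [h [PE c0 h0]]] := rank1_factor Pr.
have Sr : \rank (1%:M - Q)%R = 1%N.
  have := idem_rankC QQ; rewrite Qr => e; apply/eqP.
  by rewrite -(eqn_add2l n.-1) e addn1 prednK.
have [v [w [SE v0 w0]]] := rank1_factor Sr.
have hc : h *m c = 1%:M by apply: idem_factor; rewrite -?PE.
have wv : w *m v = 1%:M.
  apply: idem_factor; rewrite -?SE //.
  by rewrite mulmxBl mul1mx mulmxBr mulmx1 QQ subrr subr0.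
have hv : h *m v = 0.
  rewrite [h *m v]mx11_scalar; have -> : (h *m v) 0 0 = 0; last by rewrite raddf0.
  apply: (cv_rv_neq0 c0 w0).
  by rewrite -mx11_scalar mulmxA -PE -mulmxA -SE.
have Qv : Q *m v = 0.
  by rewrite -[v]mulmx1 -wv (mulmxA v) -SE !mulmxA mulmxBr mulmx1 QQ subrr mul0mx.
have [B [d [uB d0 hB Bv]]] := flag_completion i01 h0 v0 hv.
pose A := invmx B.
have DE i : delta_mx i i = (delta_mx i 0 : 'cV[F]_n) *m delta_mx 0 i.
  by rewrite mul_delta_mx.
have hA : h *m A = delta_mx 0 i0 by rewrite -hB mulmxK.
have vA : v = d *: (A *m delta_mx i1 0) by rewrite scalemxAr -Bv mulKmx.
exists A; rewrite invmxK unitmx_inv; split=> //.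
- rewrite mulmxBr mulmx1.
  have -> : P *m (A *m delta_mx i0 i0 *m B) = c *m (h *m A *m delta_mx i0 i0 *m B).
    by rewrite PE !mulmxA.
  by rewrite hA mul_delta_mx hB -PE subrr.
- have -> : A *m delta_mx i0 i0 *m B *m (1%:M - P) =
      A *m (delta_mx i0 0 : 'cV_n) *m (delta_mx 0 i0 *m B *m (1%:M - P)).
    by rewrite DE !mulmxA.
  by rewrite hB PE mulmxBr mulmx1 mulmxA hc mul1mx subrr mulmx0.
- have QA : Q *m (A *m delta_mx i1 0) = 0 :> 'cV[F]_n.
    by apply: (scalerI d0); rewrite scaler0 scalemxAr -vA.
  have -> : Q *m (A *m delta_mx i1 i1 *m B) =
      Q *m (A *m (delta_mx i1 0 : 'cV_n)) *m (delta_mx 0 i1 *m B) by rewrite DE !mulmxA.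
  by rewrite QA mul0mx.
rewrite SE mulmxA mulmxBl mul1mx.
have -> : A *m delta_mx i1 i1 *m B *m v = A *m (delta_mx i1 i1 *m (B *m v)).
  by rewrite !mulmxA.
by rewrite Bv -scalemxAr mul_delta_mx -scalemxAr -vA subrr mul0mx.
Qed.
End FlagTransitivity.

Section Irreducibility.
Context (O : idomainType) (pi : O) (k : finFieldType)
  (red : {rmorphism O -> k}) (W : wittFunctor pi red)
  (kbar : closedFieldType) (iota : {rmorphism k -> kbar})
  (n : nat) (hn : (3 <= n)%N).
Local Notation Gr0 := (@Gr0 _ _ _ _ W _ iota n).

Definition flags (R : perfAlg kbar) (P Q : 'M[R]_n) : pobj (convP W iota n) R :=
  (flag W iota 0 P, flag W iota (-1) Q).

Lemma geom_rank_map (R S : perfAlg kbar) (f : perfHom R S) m r (P : 'M[R]_(m, r)) s :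
  geom_rank P s -> geom_rank (map_mx f P) s.
Proof.
move=> Ps Om t g; rewrite -(Ps Om t (perf_comp g f)); congr (\rank _).
by apply/matrixP => i j; rewrite !mxE.
Qed.

Lemma idem_map (R S : perfAlg kbar) (f : perfHom R S) (P : 'M[R]_n) :
  P *m P = P -> map_mx f P *m map_mx f P = map_mx f P.
Proof. by move=> PP; rewrite -[RHS](congr1 (map_mx f) PP) map_mxM. Qed.

Lemma nested_map (R S : perfAlg kbar) (f : perfHom R S) (P Q : 'M[R]_n) :
  nested_flags P Q -> nested_flags (map_mx f P) (map_mx f Q).
Proof.
case=> PP Pr QQ Qr PQ; split; rewrite ?idem_map //; try exact: geom_rank_map.
by have := congr1 (map_mx f) PQ; rewrite map_mxM map_mxB map_mx1 map_mx0.
Qed.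

Lemma flags_pull (R S : perfAlg kbar) (f : perfHom R S) (P Q : 'M[R]_n) :
  nested_flags P Q -> pres f (flags P Q) = flags (map_mx f P) (map_mx f Q).
Proof.
case=> PP _ QQ _ _; rewrite /flags.
by rewrite -(flag_pull W iota 0 f PP) -(flag_pull W iota (-1) f QQ).
Qed.

Lemma Gr0_pull (R S : perfAlg kbar) (f : perfHom R S) (x : pobj (convP W iota n) R) :
  Gr0 x -> Gr0 (pres f x).
Proof.
move=> /(Gr0P hn)[P [Q [nPQ ->]]]; rewrite -/(flags P Q) flags_pull //.
by apply/(Gr0P hn); exists (map_mx f P), (map_mx f Q); split=> //; apply: nested_map.
Qed.

Lemma fl_eq z (R : perfAlg kbar) (P P' : 'M[R]_n) : P *m P = P -> P' *m P' = P' ->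
  P *m (1%:M - P') = 0 -> P' *m (1%:M - P) = 0 -> flag W iota z P = flag W iota z P'.
Proof.
move=> PP PP' E E'; have : (flag W iota z P).1 = (flag W iota z P').1.
  by apply/seteqP; split; apply/flag_sub.
by rewrite /flag /= => ->.
Qed.

Lemma Gr0_irreducible : irreducible_in Gr0 Gr0.
Proof.
have [R [g [h [gh [Om0 [t0 [f0 f0_inj]]] univ]]]] := universal_matrix iota n.
have hg := mulmx1C gh.
have i0_lt : (0 < n)%N by lia.
have i1_lt : (1 < n)%N by lia.
pose i0 : 'I_n := Ordinal i0_lt; pose i1 : 'I_n := Ordinal i1_lt.
have i01 : i0 != i1 by [].
have conj_mul (D E : 'M[R]_n) : g *m D *m h *m (g *m E *m h) = g *m (D *m E) *m h.
  by rewrite -!mulmxA (mulmxA h g) hg mul1mx.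
have conj_idem i : g *m delta_mx i i *m h *m (g *m delta_mx i i *m h) =
    g *m delta_mx i i *m h by rewrite conj_mul mul_delta_mx.
have conj_rank i : geom_rank (g *m delta_mx i i *m h) 1.
  move=> Om t f; rewrite !map_mxM map_delta_mx.
  have E : (map_mx f g : 'M[Om]_n) *m map_mx f h = 1%:M.
    by rewrite -map_mxM gh map_mx1.
  have [ug uh] := mulmx1_unit E.
  by rewrite mxrankMfree ?row_free_unit // eqmxMfull ?row_full_unit // mxrank_delta.
pose P := g *m delta_mx i0 i0 *m h; pose S := g *m delta_mx i1 i1 *m h.
have SS : S *m S = S := conj_idem i1.
pose Q := 1%:M - S.
have QQ : Q *m Q = Q by rewrite /Q mulmxBl mul1mx mulmxBr mulmx1 SS subrr subr0.
have nPQ : nested_flags P Q.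
  split=> //; [exact: conj_idem|exact: conj_rank| |].
    move=> Om t f; rewrite map_mxB map_mx1.
    have := idem_rankC (idem_map f SS : (map_mx f S : 'M[Om]_n) *m _ = _).
    rewrite (conj_rank i1 Om t f) => e; apply/eqP.
    by rewrite -(eqn_add2l 1) e add1n prednK.
  by rewrite /Q opprB addrC subrK conj_mul mul_delta_mx_0 ?mulmx0 ?mul0mx.
have XG : Gr0 (flags P Q) by apply/(Gr0P hn); exists P, Q.
(* The equations of Z on T vanish at every geometric point of T, the flag there being a
   specialization of the universal one by transitivity of GL_n; as T is reduced they vanish. *)
have closed_all Z : closed_in Gr0 Z ->
    (forall S (f : perfHom R S), Z S (pres f (flags P Q))) -> subf Gr0 Z.
  move=> [_ Zcl] ZX T x xG; have [I IP] := Zcl T x xG.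
  have [P' [Q' [nPQ' xE]]] := (Gr0P hn x).1 xG.
  have [_ Pr' _ Qr' _] := nPQ'.
  have Gx : Gr x.1 /\ Gr x.2 by rewrite xE; case: nPQ' => *; split; apply: flag_Gr.
  have <- : pres (perf_id T) x = x.
    case: Gx => G1 G2.
    have e1 := pres_id (f := perf_id T) (fun=> erefl) G1.
    have e2 := pres_id (f := perf_id T) (fun=> erefl) G2.
    by rewrite [RHS]surjective_pairing -[X in _ = (X, _)]e1 -[X in _ = (_, X)]e2.
  apply/IP => a Ia; apply: (geometric_eq0 iota) => Om t f.
  suff : Z _ (pres f x) by move/IP; apply.
  have [fPP fPr fQQ fQr fPQ] := nested_map f nPQ'.
  have [A [uA E1 E2 E3 E4]] := flag_transitive i01
    (fPP : (map_mx f P' : 'M[Om]_n) *m _ = _) (Pr' Om t f) fQQ (Qr' Om t f) fPQ.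
  have [f' f'g] := univ Om t A uA.
  suff -> : pres f x = pres f' (flags P Q) by exact: ZX.
  have f'h : map_mx f' h = invmx A.
    have E : A *m map_mx f' h = 1%:M by rewrite -f'g -map_mxM gh map_mx1.
    by rewrite -[LHS](mulKmx uA) E mulmx1.
  rewrite xE -/(flags P' Q') !flags_pull //.
  have [f'PP _ f'QQ _ _] := nested_map f' nPQ.
  have PE : map_mx f' P = A *m delta_mx i0 i0 *m invmx A.
    by rewrite /P !map_mxM f'g f'h map_delta_mx.
  have QE : map_mx f' Q = 1%:M - A *m delta_mx i1 i1 *m invmx A.
    by rewrite /Q map_mxB map_mx1 !map_mxM f'g f'h map_delta_mx.
  congr (_, _); apply: fl_eq => //.
  - by rewrite PE.
  - by rewrite PE.
  - by rewrite QE opprB addrC subrK.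
  - by rewrite QE.
split.
- split=> [T x //|T x xG]; exists set0 => S' f; split=> // _; exact: Gr0_pull.
- exists Om0, t0, (pres f0 (flags P Q)); exact: Gr0_pull.
move=> Z1 Z2 cl1 cl2 cover.
have [_ /(_ R _ XG)[I1 I1P]] := cl1; have [_ /(_ R _ XG)[I2 I2P]] := cl2.
(* The embedding [f0] is a generic geometric point: equations that hold there already hold in R, so
   the universal flag itself lies in Z1 or in Z2. *)
have [h1|h2] : (forall a, I1 a -> a = 0) \/ (forall a, I2 a -> a = 0).
  have f00 a : f0 a = 0 -> a = 0 by move=> fa; apply: f0_inj; rewrite fa rmorph0.
  have [Z|Z] := cover Om0 t0 _ (Gr0_pull f0 XG).
    by left=> a Ia; apply: f00; apply: (I1P _ f0).1 Z a Ia.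
  by right=> a Ia; apply: f00; apply: (I2P _ f0).1 Z a Ia.
- left; apply: closed_all => // T f; apply/I1P => a /h1 ->; exact: rmorph0.
- right; apply: closed_all => // T f; apply/I2P => a /h2 ->; exact: rmorph0.
Qed.
End Irreducibility.

(** * The Deligne-Lusztig variety *)

Section Lines.
Context (k : finFieldType) (kbar : closedFieldType) (iota : {rmorphism k -> kbar})
  (n : nat).
Implicit Types R S : perfAlg kbar.

Definition ker_mx R (P : 'M[R]_n) : set 'cV[R]_n := [set v | P *m v = 0].

Definition im_mx R (P : 'M[R]_n) : set 'cV[R]_n :=
  range (mulmx P : 'cV_n -> 'cV_n).

Lemma bil0P (A : comNzRingType) (x y : 'cV[A]_n) :
  bil x y = 0 <-> x^T *m antidiag A n *m y = 0.
Proof.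
rewrite -bilE; split=> [->|/matrixP/(_ 0 0)]; first by rewrite raddf0.
by rewrite !mxE mulr1n.
Qed.

Lemma im_mx_ker R (P : 'M[R]_n) : P *m P = P -> im_mx P = ker_mx (1%:M - P).
Proof.
move=> PP; apply/seteqP; split=> [_ [z _ <-]|v]; rewrite /ker_mx /=.
  by rewrite mulmxA mulmxBl mul1mx PP subrr mul0mx.
by rewrite mulmxBl mul1mx => /eqP; rewrite subr_eq0 => /eqP vE; exists v.
Qed.

Lemma perp_mxK (A : comNzRingType) (P : 'M[A]_n) : perp_mx (perp_mx P) = P.
Proof.
rewrite /perp_mx linearB /= trmx1 !trmx_mul trmxK antidiag_tr.
rewrite mulmxBr mulmx1 mulmxBl antidiagK -!mulmxA antidiagK mulmx1 mulmxA.
by rewrite antidiagK mul1mx opprB addrC subrK.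
Qed.

Lemma perp_mxB (A : comNzRingType) (P : 'M[A]_n) :
  perp_mx (1%:M - P) = 1%:M - perp_mx P.
Proof. by rewrite /perp_mx linearB /= trmx1 mulmxBr mulmx1 mulmxBl antidiagK. Qed.

Lemma idemC (A : comNzRingType) (P : 'M[A]_n) :
  P *m P = P -> (1%:M - P) *m (1%:M - P) = 1%:M - P.
Proof. by move=> PP; rewrite mulmxBl mul1mx mulmxBr mulmx1 PP subrr subr0. Qed.

Lemma perp_ker R (P : 'M[R]_n) : P *m P = P ->
  line_perp (ker_mx P) = im_mx (1%:M - perp_mx P).
Proof.
move=> PP; have QQ := perp_mx_idem PP.
have QQ' : (1%:M - perp_mx P) *m (1%:M - perp_mx P) = 1%:M - perp_mx P.
  by rewrite mulmxBl mul1mx mulmxBr mulmx1 QQ subrr subr0.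
rewrite (im_mx_ker QQ') opprB addrC subrK.
have E : perp_mx P = antidiag R n *m ((1%:M - P)^T *m antidiag R n).
  rewrite /perp_mx linearB /= trmx1 mulmxBl mul1mx mulmxBr antidiagK.
  by rewrite mulmxA.
apply/seteqP; split=> y; rewrite /line_perp /ker_mx /=.
  move=> yE; rewrite E -!mulmxA.
  suff -> : (1%:M - P)^T *m (antidiag R n *m y) = 0 by rewrite mulmx0.
  apply/matrixP => i j; rewrite ord1.
  have /yE/bil0P : P *m col i (1%:M - P) = 0.
    by rewrite colE mulmxA mulmxBr mulmx1 PP subrr mul0mx.
  by move/matrixP/(_ 0 0); rewrite tr_col -mulmxA -row_mul !mxE => ->.
move=> yE x Px; apply/bil0P.
have h : (1%:M - P)^T *m antidiag R n *m y = 0.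
  have : antidiag R n *m (perp_mx P *m y) = 0 by rewrite yE mulmx0.
  by rewrite E !mulmxA antidiagK mul1mx.
have -> : x = (1%:M - P) *m x by rewrite mulmxBl mul1mx Px subr0.
have -> : ((1%:M - P) *m x)^T *m antidiag R n *m y =
    x^T *m ((1%:M - P)^T *m antidiag R n *m y) by rewrite trmx_mul !mulmxA.
by rewrite h mulmx0.
Qed.

Lemma perp_im R (P : 'M[R]_n) : P *m P = P ->
  line_perp (im_mx (1%:M - perp_mx P)) = ker_mx P.
Proof.
move=> PP; have QQ := perp_mx_idem PP.
rewrite (im_mx_ker (idemC QQ)) opprB addrC subrK perp_ker // perp_mxK.
by rewrite (im_mx_ker (idemC PP)) opprB addrC subrK.
Qed.

Lemma span_map_im R S (f : {rmorphism R -> S}) (Q : 'M[R]_n) :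
  Defs.span idfun [set map_mx f x | x in im_mx Q] = im_mx (map_mx f Q).
Proof.
apply/seteqP; split=> [_ [r [a [x [xQ ->]]]]|_ [v _ <-]].
  have /choice[z zE] i : exists z, x i = map_mx f Q *m z.
    by have [_ [z _ <-] <-] := xQ i; exists (map_mx f z); rewrite map_mxM.
  exists (\sum_i a i *: z i) => //; rewrite mulmx_sumr.
  by apply: eq_bigr => i _; rewrite -scalemxAr zE.
exists n, (fun i => v i 0), (fun i => map_mx f (col i Q)); split=> [i|].
  by exists (col i Q) => //; exists (delta_mx i 0); rewrite // -colE.
apply/colP => i; rewrite !mxE summxE; apply: eq_bigr => j _.
by rewrite !mxE mulrC.
Qed.

Lemma line_frob_im R (Q : 'M[R]_n) :
  line_frob k (im_mx Q) = im_mx (qmx k Q).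
Proof.
exact: (span_map_im (perf_fun (frob_hom (restr iota R)) : {rmorphism R -> R}) Q).
Qed.

(* Both sides say that P kills the image of qmx P under the form. *)
Lemma DLV_im R (P : 'M[R]_n) : P *m P = P -> geom_rank P 1 ->
  DLV k (im_mx (1%:M - perp_mx P)) <-> P *m (1%:M - perp_mx (qmx k P)) = 0.
Proof.
move=> PP Pr; have QQ := idemC (perp_mx_idem PP).
have qPP := qmx_idem iota PP.
have sub : im_mx (1%:M - perp_mx P) `<=`
      line_frob k (line_perp (im_mx (1%:M - perp_mx P))) <->
    P *m (1%:M - perp_mx (qmx k P)) = 0.
  have kerE : ker_mx P = im_mx (1%:M - P).
    by rewrite (im_mx_ker (idemC PP)) opprB addrC subrK.
  have qE : qmx k (1%:M - P) = 1%:M - qmx k P.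
    rewrite (qmx_frob iota) /frobmx; pose s := frob_hom (restr iota R).
    exact: (etrans (map_mxB s 1%:M P) (congr1 (fun M => M - map_mx s P) (map_mx1 s n))).
  rewrite perp_im // kerE line_frob_im qE.
  rewrite (im_mx_ker (idemC qPP)) !perp_mxC.
  set J := antidiag R n; have JJ : J *m J = 1%:M := antidiagK R n.
  (* As the form is symmetric, the line lies in the twisted hyperplane exactly when the twisted line
     lies in the hyperplane; on matrices this is a transposition. *)
  have tr_eq : (qmx k P *m (J *m P^T *m J))^T = J *m (P *m (J *m (qmx k P)^T *m J)) *m J.
    rewrite !trmx_mul antidiag_tr trmxK -!mulmxA -/J JJ mulmx1.
    by [].
  have sub_mx : im_mx (J *m P^T *m J) `<=` ker_mx (qmx k P) <->
      qmx k P *m (J *m P^T *m J) = 0.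
    split=> [h|h _ [z _ <-]]; last by rewrite /ker_mx /= mulmxA h mul0mx.
    apply/matrixP => i j.
    have /h : im_mx (J *m P^T *m J) (col j (J *m P^T *m J)).
      by exists (delta_mx j 0) => //; rewrite -colE.
    by rewrite /ker_mx /= colE mulmxA -colE => /colP/(_ i); rewrite !mxE.
  rewrite subKr sub_mx; split=> h.
    have : J *m (J *m (P *m (J *m (qmx k P)^T *m J)) *m J) *m J = 0.
      by rewrite -tr_eq h trmx0 mulmx0 mul0mx.
    by rewrite !mulmxA JJ mul1mx -(mulmxA _ J J) JJ mulmx1.
  apply: trmx_inj; rewrite tr_eq h mulmx0 mul0mx trmx0 //.
split=> [[_ /sub]//|h]; split; last exact/sub.
exists (1%:M - perp_mx P); split=> // Om t f.
rewrite map_mxB map_mx1 map_perp_mx rank_perpC; exact: Pr.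
Qed.

Lemma DLVP R (M : set 'cV[R]_n) : DLV k M <->
  exists P : 'M[R]_n, [/\ P *m P = P, geom_rank P 1,
    P *m (1%:M - perp_mx (qmx k P)) = 0 & M = im_mx (1%:M - perp_mx P)].
Proof.
split=> [[[P0 [PP ME Pr]] sub]|[P [PP Pr PQ ->]]]; last exact/DLV_im.
pose P := 1%:M - perp_mx P0.
have PE : 1%:M - perp_mx P = P0.
  by rewrite /P perp_mxB perp_mxK opprB addrC subrK.
exists P; have PPP : P *m P = P := idemC (perp_mx_idem PP).
have PPr : geom_rank P 1.
  by move=> Om t f; rewrite map_mxB map_mx1 map_perp_mx rank_perpC; exact: Pr.
split=> //; last by rewrite PE.
apply/DLV_im => //; rewrite PE; split; first by exists P0.
by move: sub; rewrite ME.
Qed.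
End Lines.

(** * The component, the locus and the variety of lines *)

Section Main.
Context (O : idomainType) (pi : O) (k : finFieldType)
  (red : {rmorphism O -> k}) (W : wittFunctor pi red)
  (kbar : closedFieldType) (iota : {rmorphism k -> kbar})
  (n : nat) (hn : (3 <= n)%N).
Local Notation locus := (@locus _ _ _ _ W _ iota n).

Lemma X_b1_x0P (C : subfunctor (convP W iota n)) : is_Gr0_a1 C ->
  forall R (x : pobj (grP W iota n) R), X_b1_x0 C x <-> locus x.
Proof.
move=> [[irrC maxC] _] R x.
have CG : subf C (@Gr0 _ _ _ _ W _ iota n) by case: irrC => -[].
have GC := maxC _ (Gr0_irreducible W iota hn) CG.
have XC := XopenP hn GC.
split=> [[_]|lx].
  apply; first exact: locus_closed.
  by move=> S y /XC.
by split=> [|T _]; [exact: locus_ADLV|apply; apply/XC].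
Qed.

(** Stated through the lattice alone, because the lattice determines only the kernel of P and not
    P. *)
Definition line_of (R : perfAlg kbar) (x : pobj (grP W iota n) R) :
    pobj (lineP kbar n) R :=
  line_perp [set map_mx (witt_red W (restr iota R)) w | w in
    [set w | x.1 (map_mx (witt_inc W (restr iota R)) w)]].

Lemma line_of_fl (R : perfAlg kbar) (P : 'M[R]_n) : P *m P = P ->
  line_of (flag W iota 0 P) = im_mx (1%:M - perp_mx P).
Proof.
move=> PP; rewrite -perp_ker // /line_of; congr line_perp.
rewrite flag0; apply/seteqP; split=> [_ [w [v /incmx_inj <- Pw] <-]|v Pv] //.
have [w wE] := lift_mx W (v : 'cV[restr iota R]_n).
by exists w => //; exists w => //; rewrite wE.
Qed.

Lemma locus_DLV : iso_subfunctor locus (@DLV k kbar n).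
Proof.
exists line_of; split=> [R|R S f x [P [PP Pr PQ] ->]].
  split.
  - move=> _ [P [PP Pr PQ] ->]; rewrite line_of_fl //.
    by apply/(DLVP iota); exists P.
  - move=> x y /set_mem[P [PP _ _] ->] /set_mem[Q [QQ _ _] ->].
    rewrite !line_of_fl // => PQ.
    (* The line determines its orthogonal hyperplane, and this determines the lattice as its
       preimage. *)
    have kerPQ : ker_mx P = ker_mx Q by rewrite -(perp_im PP) PQ perp_im.
    rewrite !flag0; congr (_, _).
    apply/seteqP; split=> _ [w -> h]; exists w => //.
      by have : ker_mx P (map_mx (witt_red W _) w) by []; rewrite kerPQ.
    by have : ker_mx Q (map_mx (witt_red W _) w) by []; rewrite -kerPQ.
  - move=> M /(DLVP iota)[P [PP Pr PQ ->]].
    by exists (flag W iota 0 P); [exists P|rewrite line_of_fl].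
rewrite flag_pull // !line_of_fl ?idem_map //.
by rewrite -map_perp_mx -(map_mx1 f) -map_mxB -span_map_im.
Qed.
End Main.

Theorem proposition8p2
  (O : idomainType) (pi : O) (k : finFieldType) (red : {rmorphism O -> k})
  (hO : strict_lift pi red) (W : wittFunctor pi red)
  (kbar : closedFieldType) (iota : {rmorphism k -> kbar})
  (hkbar : forall x, algebraicOver iota x)
  (n : nat) (hn : (3 <= n)%N)
  (C : subfunctor (convP W iota n)) (hC : is_Gr0_a1 C) :
  (forall (R : perfAlg kbar) (x : pobj (grP W iota n) R),
     X_b1_x0 C x <->
     Gr_le (cstar (nu1 n)) x /\
     [set piI W (restr iota R) *: y | y in lat_frob (lat_dual x.1)] `<=` x.1)
  /\ iso_subfunctor (X_b1_x0 C) (@DLV k kbar n).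
Proof.
have XP := X_b1_x0P hn hC.
split=> [R x|]; first by rewrite XP (locusP hn).
have <- : locus (W := W) (iota := iota) (n := n) = X_b1_x0 C; last exact: locus_DLV.
apply: functional_extensionality_dep => R; apply/seteqP.
by split=> x /XP.
Qed.
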